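(* Let $\Omega\subset\mathbb R^2$ be a polygonal connected open bounded set. There exist constants $C_{PW}>0$, $C_B>0$ (one may take $C_B=C_{PW}$) and $C_{LS}>0$ depending only on $\Omega$ such that the following holds. Let $(\mathcal T,\mathcal E,\mathcal P)$ be a mesh of $\Omega$ satisfying the regularity constraint with parameter $\zeta>0$, and let $(\mu_K)_{K\in\mathcal T}$ satisfy $\mu_K\ge0$ for all $K\in\mathcal T$ and $\sum_{K\in\mathcal T}\mathrm m_K\mu_K=1$. Put $\mu^\infty=\sup_{K\in\mathcal T}\mu_K$. (i) (Discrete Poincaré–Wirtinger inequality) For every real family $(f_K)_{K\in\mathcal T}$, $$\sum_{K\in\mathcal T}\mathrm m_K\Big|f_K-\sum_{\tilde K\in\mathcal T}\mathrm m_{\tilde K}f_{\tilde K}\mu_{\tilde K}\Big|^2\mu_K\le\frac{C_{PW}}{\zeta}\,\mu^\infty\sum_{\sigma=K|L\in\mathcal E_{\rm int}}\tau_\sigma|f_K-f_L|^2 .$$ (ii) (Discrete Beckner inequality) For every $p\in(1,2]$ and every $(f_K)_{K\in\mathcal T}$ with $f_K\ge0$ for all $K$, $$\sum_{K\in\mathcal T}\mathrm m_Kf_K^2\mu_K-\Big(\sum_{K\in\mathcal T}\mathrm m_Kf_K^{2/p}\mu_K\Big)^p\le\frac{C_B}{\zeta}\,\mu^\infty\sum_{\sigma=K|L\in\mathcal E_{\rm int}}\tau_\sigma|f_K-f_L|^2 .$$ (iii) (Discrete logarithmic Sobolev inequality) For every $(f_K)_{K\in\mathcal T}$ with $f_K>0$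 for all $K$, $$\sum_{K\in\mathcal T}\mathrm m_Kf_K^2\log\left(\frac{f_K^2}{\sum_{\tilde K\in\mathcal T}\mathrm m_{\tilde K}f_{\tilde K}^2\mu_{\tilde K}}\right)\mu_K\le\frac{C_{LS}}{\zeta^2}\,\sqrt{\mu^\infty}\sum_{\sigma=K|L\in\mathcal E_{\rm int}}\tau_\sigma|f_K-f_L|^2 .$$
   Context: **Mesh** (no orthogonality condition is required). $\mathcal T$ is a finite family of disjoint open convex polygonal control volumes $K\subset\Omega$ whose closures cover $\overline\Omega$; $\mathcal E$ is a finite family of edges (segments of positive length); for each $K$, $\mathcal E_K\subset\mathcal E$ is the set of its edges, $\partial K=\bigcup_{\sigma\in\mathcal E_K}\overline\sigma$, and $\mathcal E=\bigcup_K\mathcal E_K$; for $K\ne L$ either $\overline K\cap\overline L$ has zero length or $\overline K\cap\overline L=\overline\sigma$ for some $\sigma\in\mathcal E$, denoted $\sigma=K|L$ (interior edges, $\sigma\in\mathcal E_{\rm int}$); the other edges lie on $\partial\Omega$ ($\mathcal E_{\rm ext}$). $\mathcal P=(\boldsymbol x_K)_{K\in\mathcal T}$ is a family of points with $\boldsymbol x_K\in K$. Notation: $\mathrm m_K$ is the area of $K$, $\mathrm m_\sigma$ the length of $\sigma$, $d(\boldsymbol x_K,\sigma)$ the Euclidean distance from $\boldsymbol x_K$ to its orthogonal projection on the line containing $\sigma$; $\mathrm d_\sigma=|\boldsymbol x_K-\boldsymbol x_L|$ if $\sigma=K|L\in\mathcal E_{\rm int}$ and $\mathrm d_\sigma=d(\boldsymbol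 x_K,\sigma)$ if $\sigma\in\mathcal E_K\cap\mathcal E_{\rm ext}$; $\tau_\sigma=\mathrm m_\sigma/\mathrm d_\sigma$. **Regularity constraint with parameter $\zeta>0$:** $d(\boldsymbol x_K,\sigma)\ge\zeta\,\mathrm d_\sigma$ for all $K\in\mathcal T$ and $\sigma\in\mathcal E_K$. *)

(* Defs.v *)
From HB Require Import structures.
From mathcomp Require Import all_boot all_order all_algebra.
From mathcomp Require Import all_classical all_reals all_analysis.
Set Implicit Arguments.
Unset Strict Implicit.
Unset Printing Implicit Defensive.
Import Order.TTheory GRing.Theory Num.Theory.
Import numFieldNormedType.Exports.
Local Open Scope classical_set_scope.
Local Open Scope ring_scope.

(* The norm that the library puts on a product is the max norm: it is used only
   through the topology and boundedness. All lengths below are Euclidean. *)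

Definition dot (R : realType) (u v : R * R) : R := u.1 * v.1 + u.2 * v.2.

Definition edist (R : realType) (x y : R * R) : R :=
  Num.sqrt (dot (x - y) (x - y)).

Definition area (R : realType) (A : set (R * R)) : \bar R :=
  (lebesgue_measure \x lebesgue_measure)%E A.

Definition frontier (R : realType) (A : set (R * R)) : set (R * R) :=
  closure A `\` interior A.

Definition line_point (R : realType) (a b : R * R) (t : R) : R * R :=
  ((1 - t) * a.1 + t * b.1, (1 - t) * a.2 + t * b.2).

Definition open_segment (R : realType) (a b : R * R) : set (R * R) :=
  [set line_point a b t | t in [set t : R | 0 < t < 1]].

Definition closed_segment (R : realType) (a b : R * R) : set (R * R) :=
  [set line_point a b t | t in [set t : R | 0 <= t <= 1]].

Definition line_proj (R : realType) (a b x : R * R) : R * R :=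
  line_point a b (dot (x - a) (b - a) / dot (b - a) (b - a)).

(* One-dimensional Hausdorff measure. The supremum includes 0, so that the
   empty set has diameter 0 and not -oo. *)
Definition diameter (R : realType) (A : set (R * R)) : \bar R :=
  ereal_sup (0%E |` [set (edist x y)%:E | x in A & y in A]).

Definition hausdorff1 (R : realType) (A : set (R * R)) : \bar R :=
  ereal_sup [set ereal_inf
      [set (\sum_(0 <= n <oo) diameter (U n))%E | U in
        [set U : nat -> set (R * R) |
          A `<=` \bigcup_n U n /\ forall n, (diameter (U n) <= delta%:E)%E]]
    | delta in [set delta : R | 0 < delta]].

Definition polygonal (R : realType) (A : set (R * R)) : Prop :=
  exists s : seq ((R * R) * (R * R)),
    (forall e, e \in s -> e.1 != e.2) /\
    frontier A = \bigcup_(e in [set` s]) closed_segment e.1 e.2.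

(* Edges are open segments given by their two end points, so that the closure of
   an edge is the corresponding closed segment. *)
Record mesh (R : realType) (Omega : set (R * R)) := Mesh {
  cells : finType;
  edges : finType;
  cell : cells -> set (R * R);
  endpoints : edges -> (R * R) * (R * R);
  cell_edges : cells -> {set edges};
  center : cells -> R * R;
  edge := fun s : edges => open_segment (endpoints s).1 (endpoints s).2;
  (* s = K|L *)
  separates := fun (s : edges) (K L : cells) =>
    [/\ K != L, s \in cell_edges K, s \in cell_edges L &
        closure (cell K) `&` closure (cell L) = closure (edge s)];
  cell_open : forall K, open (cell K);
  cell_convex : forall K, convex_set (cell K : set (R^o * R^o));
  cell_polygonal : forall K, polygonal (cell K);
  cell_sub : forall K, cell K `<=` Omega;
  cell_disjoint : forall K L, K != L -> cell K `&` cell L = set0;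
  cell_cover : closure Omega = \bigcup_K closure (cell K);
  endpoints_neq : forall s, (endpoints s).1 != (endpoints s).2;
  edge_inj : injective edge;
  cell_edgesE : forall K,
    frontier (cell K) = \bigcup_(s in [set` cell_edges K]) closure (edge s);
  edges_cover : forall s, exists K, s \in cell_edges K;
  cell_meet : forall K L, K != L ->
    hausdorff1 (closure (cell K) `&` closure (cell L)) = 0%E \/
    exists s, separates s K L;
  edge_boundary : forall s,
    ~ (exists K L, separates s K L) -> edge s `<=` frontier Omega;
  center_in : forall K, cell K (center K)
}.

Section MeshQuantities.
Variables (R : realType) (Omega : set (R * R)) (M : mesh Omega).
Implicit Types (K : cells M) (s : edges M) (f : cells M -> R).

Definition cell_area K : R := fine (area (cell K)).

Definition edge_length s : R := edist (endpoints s).1 (endpoints s).2.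

Definition dist_edge (x : R * R) s : R :=
  edist x (line_proj (endpoints s).1 (endpoints s).2 x).

(* Some (K, L) for an interior edge s = K|L, where {K, L} is determined by s and
   its ordering is arbitrary; None for an exterior edge. *)
Definition sides s : option (cells M * cells M) :=
  [pick KL : cells M * cells M | `[< separates s KL.1 KL.2 >]].

(* The default value 0 is never taken, by edges_cover. *)
Definition edge_dist s : R :=
  match sides s with
  | Some (K, L) => edist (center K) (center L)
  | None => if [pick K | s \in cell_edges K] is Some K
            then dist_edge (center K) s else 0
  end.

Definition transmissibility s : R := edge_length s / edge_dist s.

Definition regular_mesh (zeta : R) : Prop :=
  forall K s, s \in cell_edges K ->
    zeta * edge_dist s <= dist_edge (center K) s.

(* The sum over interior edges s = K|L of tau_s |f_K - f_L|^2. *)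
Definition dirichlet_energy f : R :=
  \sum_s (if sides s is Some (K, L)
          then transmissibility s * `|f K - f L| ^+ 2 else 0).

End MeshQuantities.

(* Main.v *)
(* The heart is a relative isoperimetric inequality for unions of cells: if Per is
   the total length of the interior edges between a union of cells and the union
   of the others, the smaller of the two areas is at most C Per^2. On a
   parallelogram, the coordinate lines that meet both unions must cross such an
   edge, so they form a set of measure O(Per) in each of the two directions, and
   outside those lines the two unions cannot coexist. A polygonal domain is, up
   to a null set, a finite union of parallelograms (cut a big triangle along all
   boundary lines), and the inequality passes to unions of overlapping sets.
   The coarea formula turns it into |h|_2 <= C |h|_BV for h with median 0; applied to h
   and h|h| it gives L^2 and L^4 bounds by the energy, where Cauchy-Schwarz uses
   sum_s m_s d(x_K, s) <= 4 m_K (disjoint triangles with apex x_K).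
   Beckner follows from Poincare-Wirtinger by Jensen, and the entropy is
   controlled by |f - c|_4^2. *)

Require Import Defs.
From mathcomp Require Import all_boot all_order all_algebra.
From mathcomp Require Import all_classical all_reals all_analysis.
From mathcomp Require Import measurable_realfun ring lra.
Set Implicit Arguments.
Unset Strict Implicit.
Unset Printing Implicit Defensive.
Import Order.TTheory GRing.Theory Num.Theory.
Import numFieldNormedType.Exports.
Local Open Scope classical_set_scope.
Local Open Scope ring_scope.

(** * Affine maps and area *)

(** The constants may not see the mesh, so the isoperimetric constant is fixed before the mesh is.
    Counting crossings by edge lengths needs each contact between a cell of the union and a cell
    outside it to be a single point or an edge recorded by [sides]. Nothing in [mesh] says outright
    that an edge lies between at most two cells, and [sides] picks one pair. Convexity settles this:
    of three disjoint convex cells along one segment, two would lie on the same side of it and meet.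

    The median is taken for the area, the measure of the isoperimetric inequality, whereas the
    theorem centres at the mean for the density. In L^2 the change is free, since the mean minimises
    the variance; in L^4 it costs a constant. The density itself is bounded by its supremum, once in
    L^2, and under a square root in the entropy bound, where the squared L^4 norm appears.

    The L^4 argument yields 1/zeta; the stated 1/zeta^2 follows because one interior edge forces
    zeta <= 1, and without interior edges the energy is 0. The summand 1 in each constant makes it
    positive, as the isoperimetric constant is only known to be nonnegative. *)

Section plane_measure.
Variable R : realType.
Local Notation mu := (@lebesgue_measure R).
Implicit Types (E : set (R * R)) (A : set R).

(** The scaled pushforward agrees with Lebesgue measure on half-open intervals, hence everywhere by
    uniqueness. A negative [c] exchanges the open and the closed end, hence the two cases. *)
Lemma lebesgue_measure_affine (c t : R) A : c != 0 ->
  measurable (A : set (measurableTypeR R)) ->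
  mu A = (`|c|%:E * mu ((fun x => c * x + t)%R @^-1` A))%E.
Proof.
move=> c0 mA.
have mf : measurable_fun (setT : set (measurableTypeR R))
    ((fun x => c * x + t) : _ -> measurableTypeR R).
  by apply: measurable_funD => //; exact: measurable_funM.
pose m0 : {measure set (measurableTypeR R) -> \bar R} :=
  measure_function_pushforward__canonical__measure_function_Measure mu mf.
pose m' : {measure set (measurableTypeR R) -> \bar R} :=
  mscale (NngNum (normr_ge0 c)) m0.
rewrite (@lebesgue_measure_unique R m') //.
move=> X /ocitvP[->|[[a b] /= ab ->]]; first by rewrite !measure0.
rewrite /m' /mscale lebesgue_measure_itv /= lte_fin ab /pushforward.
have [c_gt0|c_le0] := ltP 0 c.
   rewrite [X in mu X](_ : _ = `](a - t) / c, (b - t) / c]%classic); last first.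
    apply/seteqP; split => x /=; rewrite !in_itv /= ltr_pdivrMr// ler_pdivlMr//;
    rewrite ![x * c]mulrC; lra.
  rewrite lebesgue_measure_itv /= lte_fin ltr_pM2r ?invr_gt0// ltrD2r ab.
  rewrite -!EFinD -EFinM gtr0_norm//; congr (_%:E); field.
  by rewrite lt0r_neq0.
have c_lt0 : c < 0 by rewrite lt_neqAle c0.
rewrite [X in mu X](_ : _ = `[(b - t) / c, (a - t) / c[%classic); last first.
  apply/seteqP; split => x /=; rewrite !in_itv /= ler_ndivrMr// ltr_ndivlMr//;
  rewrite ![x * c]mulrC; lra.
rewrite lebesgue_measure_itv /= lte_fin ltr_nM2r ?invr_lt0// ltrD2r ab.
rewrite -!EFinD -EFinM ltr0_norm//; congr (_%:E); field.
by rewrite ltr0_neq0.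
Qed.

Lemma measurable_fun_affine (a b c : R) :
  measurable_fun setT ((fun z => a * z.1 + b * z.2 + c)
    : measurableTypeR R * measurableTypeR R -> measurableTypeR R).
Proof.
by apply: measurable_funD => //; apply: measurable_funD;
  apply: measurable_funM.
Qed.


Definition aff (x p q : R * R) (z : R * R) : R * R :=
  (x.1 + z.1 * p.1 + z.2 * q.1, x.2 + z.1 * p.2 + z.2 * q.2).

(** Determinant of the linear part of [aff x u v]. *)
Definition cross (u v : R * R) : R := u.1 * v.2 - u.2 * v.1.

Local Notation mR2 := (measurableTypeR R * measurableTypeR R)%type.

Lemma measurable_aff (x p q : R * R) :
  measurable_fun setT (aff x p q : mR2 -> mR2).
Proof.
apply: measurable_fun_pair => /=.
- rewrite (_ : (fun _ => _) = (fun z => p.1 * z.1 + q.1 * z.2 + x.1)).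
    exact: measurable_fun_affine.
  by apply/funext => z; ring.
- rewrite (_ : (fun _ => _) = (fun z => p.2 * z.1 + q.2 * z.2 + x.2)).
    exact: measurable_fun_affine.
  by apply/funext => z; ring.
Qed.

Lemma measurable_preimage_aff (x p q : R * R) E :
  measurable (E : set mR2) -> measurable (aff x p q @^-1` E : set mR2).
Proof.
by move=> mE; rewrite -[X in measurable X]setTI; exact: measurable_aff.
Qed.

Lemma area_vertical (b c t : R) E : b != 0 -> measurable (E : set mR2) ->
  area E = (`|b|%:E * area ((aff (0, t) (1, c) (0, b))%R @^-1` E))%E.
Proof.
move=> b0 mE; have mE' := measurable_preimage_aff (0, t) (1, c) (0, b) mE.
rewrite /area /product_measure1 -ge0_integralZl//=; last first.
  exact: measurable_fun_xsection.
apply: eq_integral => x _ /=.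
rewrite (@lebesgue_measure_affine b (c * x + t) _ b0); last first.
  exact: measurable_xsection.
congr (_ * mu _)%E; apply/seteqP; split => y /=;
  rewrite /xsection /= !inE /= /aff /=; congr (E (_, _)); ring.
Qed.

Lemma area_horizontal (b c t : R) E : b != 0 -> measurable (E : set mR2) ->
  area E = (`|b|%:E * area ((aff (t, 0) (b, 0) (c, 1))%R @^-1` E))%E.
Proof.
move=> b0 mE; have mE' := measurable_preimage_aff (t, 0) (b, 0) (c, 1) mE.
have areaE F : measurable (F : set mR2) -> area F = (mu \x^ mu)%E F.
  move=> mF; apply: product_measure_unique => //= *.
  by rewrite product_measure2E.
rewrite !areaE// /product_measure2 -ge0_integralZl//=; last first.
  exact: measurable_fun_ysection.
apply: eq_integral => y _ /=.
rewrite (@lebesgue_measure_affine b (c * y + t) _ b0); last first.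
  exact: measurable_ysection.
congr (_ * mu _)%E; apply/seteqP; split => x /=;
  rewrite /ysection /= !inE /= /aff /=; congr (E (_, _)); ring.
Qed.

(** When [q.2 != 0], [aff x p q] factors into a map that moves points vertically followed by one
    that moves them horizontally. Slicing the product measure in the matching direction reduces each
    factor to dimension one. *)
Lemma area_aff (x p q : R * R) E : cross p q != 0 ->
  measurable (E : set mR2) ->
  area E = (`|cross p q|%:E * area (aff x p q @^-1` E))%E.
Proof.
move=> pq0 mE.
(* If [q.2 = 0] then [p.2 != 0], and [q] may be replaced by [p + q]: this is a shear, which keeps
   both the determinant and the area. *)
wlog q2 : x p q pq0 / q.2 != 0.
  have [q20|] := eqVneq q.2 0; last by move=> q2 /(_ x p q pq0 q2).
  have p20 : p.2 != 0.
    by move: pq0; apply: contra_neq => p20; rewrite /cross p20 q20; ring.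
  move=> /(_ x p (q.1 + p.1, p.2)).
  have -> : cross p (q.1 + p.1, p.2) = cross p q by rewrite /cross q20 /=; ring.
  move=> /(_ pq0 p20) ->; congr (_ * _)%E.
  rewrite [RHS](@area_horizontal 1 1 0) ?oner_neq0//; last first.
    exact: measurable_preimage_aff.
  rewrite normr1 mul1e; congr area; apply/seteqP; split => z /=;
    rewrite /aff /= q20; congr (E (_, _)); ring.
have pq2 : cross p q / q.2 != 0 by rewrite mulf_neq0 ?invr_neq0.
rewrite (area_horizontal (q.1 / q.2) (x.1 - q.1 / q.2 * x.2) pq2 mE).
have mE' := measurable_preimage_aff (x.1 - q.1 / q.2 * x.2, 0)
  (cross p q / q.2, 0) (q.1 / q.2, 1) mE.
rewrite (area_vertical p.2 x.2 q2 mE') muleA -EFinM -normrM (divfK q2).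
congr (_ * _)%E; congr area.
by apply/seteqP; split => z /=; rewrite /aff /cross /=; congr (E (_, _)); field.
Qed.

End plane_measure.

(** * Convex sets and segments in the plane *)

Section plane_topology.
Variable R : realType.
Implicit Types (E F K L : set (R * R)) (x y z w a b p q : R * R).

Lemma continuous_pair (T : topologicalType) (f g : T -> R) :
  continuous f -> continuous g -> continuous (fun t => (f t, g t)).
Proof. by move=> cf cg t; exact: (cvg_pair (cf t) (cg t)). Qed.

Lemma continuous_line_point a b : continuous (line_point a b).
Proof.
apply: continuous_pair => t; apply: cvgD; apply: cvgM; try exact: cvg_cst;
  try exact: cvg_id; apply: cvgB; try exact: cvg_cst; exact: cvg_id.
Qed.

Lemma continuous_affine2 (c1 c2 c3 : R) :
  continuous (fun z : R * R => c1 * z.1 + c2 * z.2 + c3).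
Proof.
move=> z; apply: cvgD; last exact: cvg_cst.
by apply: cvgD; apply: cvgM; try exact: cvg_cst; [exact: cvg_fst|exact: cvg_snd].
Qed.

Lemma continuous_aff x p q : continuous (aff x p q).
Proof.
rewrite (_ : aff x p q = fun z => (p.1 * z.1 + q.1 * z.2 + x.1,
    p.2 * z.1 + q.2 * z.2 + x.2)).
  by apply: continuous_pair; exact: continuous_affine2.
by apply/funext => z; congr pair; ring.
Qed.

(** If the two closed sets did not meet on the segment, the trace of [F1] would be clopen and
    nonempty, hence all of the connected segment, and would contain [w]. *)
Lemma segment_closed_meet F1 F2 z w : closed F1 -> closed F2 -> F1 z -> F2 w ->
  (forall t, 0 <= t <= 1 -> (F1 `|` F2) (line_point z w t)) ->
  exists2 t, 0 <= t <= 1 & (F1 `&` F2) (line_point z w t).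
Proof.
move=> cF1 cF2 F1z F2w F12; apply: contrapT => noF.
pose g := line_point z w.
have g0 : g 0 = z by rewrite /g /line_point [in RHS](surjective_pairing z); congr pair; ring.
have g1 : g 1 = w by rewrite /g /line_point [in RHS](surjective_pairing w); congr pair; ring.
have gc : continuous g by exact: continuous_line_point.
suff : `[0, 1] `&` (g @^-1` F1) = `[(0:R), 1]%classic.
  move=> /seteqP[_ /(_ 1)]; rewrite /= in_itv /= ler01 lexx => /(_ isT)[_].
  by rewrite g1 => F1w; apply: noF; exists 1; rewrite ?ler01 ?lexx// -/g g1.
apply: (@segment_connected R 0 1).
- by exists 0; split => /=; rewrite ?in_itv /= ?lexx ?ler01// g0.
- exists (~` (g @^-1` F2)).
    by rewrite openC; apply: closed_comp => // t _; exact: gc.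
  apply/seteqP; split => t [] /=; rewrite in_itv /= => t01 Ft; split => //.
    by move=> F2t; apply: noF; exists t.
  by have [|] := F12 t t01.
- by exists (g @^-1` F1) => //; apply: closed_comp => // t _; exact: gc.
Qed.

Definition convex2 E := forall x y t, E x -> E y -> 0 <= t <= 1 ->
  E (line_point x y t).

Lemma convex_set2 E : convex_set (E : set (R^o * R^o)) -> convex2 E.
Proof.
move=> cE x y t Ex Ey /andP[t0 t1].
have := cE y x (Itv01 t0 t1); rewrite !inE => /(_ Ey Ex); congr E.
by rewrite /conv /= addrC.
Qed.

Lemma line_point0 a b : line_point a b 0 = a.
Proof. by rewrite /line_point [RHS](surjective_pairing a); congr pair; ring. Qed.

Lemma line_point1 a b : line_point a b 1 = b.
Proof. by rewrite /line_point [RHS](surjective_pairing b); congr pair; ring. Qed.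

Lemma line_pointC a b t : line_point a b t = line_point b a (1 - t).
Proof. by rewrite /line_point; congr pair; ring. Qed.

Lemma convex2_closure E : convex2 E -> convex2 (closure E).
Proof.
move=> cE x y t Ex Ey t01 V.
pose g (u : (R * R) * (R * R)) := line_point u.1 u.2 t.
have gc : continuous g.
  apply: continuous_pair => u; (apply: cvgD; apply: cvgM; try exact: cvg_cst).
  - by apply: (cvg_comp _ _ cvg_fst); exact: cvg_fst.
  - by apply: (cvg_comp _ _ cvg_snd); exact: cvg_fst.
  - by apply: (cvg_comp _ _ cvg_fst); exact: cvg_snd.
  - by apply: (cvg_comp _ _ cvg_snd); exact: cvg_snd.
move=> /(gc (x, y))[[A B] /= [xA yB] ABV].
have [x' [Ex' Ax']] := Ex _ xA; have [y' [Ey' By']] := Ey _ yB.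
by exists (g (x', y')); split; [exact: cE|exact: (ABV (x', y'))].
Qed.

(** For [y] near [z], let [g y] be the point from which [p] is reached at the same parameter [t] on
    the way to [y]. As [g z = x] and [K] is open, some [y] in [K] has [g y] in [K], and [p] lies
    between them. *)
Lemma convex2_interior_segment K x z t : open K -> convex2 K ->
  K x -> closure K z -> 0 <= t < 1 -> K (line_point x z t).
Proof.
move=> oK cK Kx Kz /andP[t0 t1]; have t1' : 1 - t != 0 by lra.
set p := line_point x z t.
pose g y := ((1 - t)^-1 * (p.1 - t * y.1), (1 - t)^-1 * (p.2 - t * y.2)) : R * R.
have gc : continuous g.
  rewrite (_ : g = fun y => (- (t / (1 - t)) * y.1 + 0 * y.2 + p.1 / (1 - t),
      0 * y.1 + - (t / (1 - t)) * y.2 + p.2 / (1 - t))).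
    by apply: continuous_pair; exact: continuous_affine2.
  by apply/funext => y; congr pair; field.
have gz : g z = x.
  by rewrite /g /p /line_point /= [RHS](surjective_pairing x); congr pair; field.
have : nbhs z (g @^-1` K).
  by apply: gc; rewrite gz; exact: open_nbhs_nbhs.
move=> /Kz[y [Ky Kgy]].
have -> : p = line_point (g y) y t.
  by rewrite /g /line_point [LHS](surjective_pairing p) /=; congr pair; field.
by apply: cK => //; rewrite t0 ltW.
Qed.

Lemma open_disjoint_closure K L x : open K -> K `&` L = set0 ->
  K x -> ~ closure L x.
Proof.
move=> oK KL0 Kx /(_ K (open_nbhs_nbhs (conj oK Kx)))[y [Ly Ky]].
by have : (K `&` L) y by []; rewrite KL0.
Qed.

(** Twice the signed area of the triangle [a b y]; its sign tells on which side of the line the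
    point [y] lies. *)
Definition side a b y : R :=
  (b.1 - a.1) * (y.2 - a.2) - (b.2 - a.2) * (y.1 - a.1).

Lemma side_line_point a b x y t :
  side a b (line_point x y t) = (1 - t) * side a b x + t * side a b y.
Proof. by rewrite /side /line_point /=; ring. Qed.

Lemma dist2_gt0 a b : a != b -> 0 < (b.1 - a.1) ^+ 2 + (b.2 - a.2) ^+ 2.
Proof.
move=> ab; rewrite lt_neqAle addr_ge0 ?sqr_ge0// andbT eq_sym.
rewrite paddr_eq0 ?sqr_ge0// !sqrf_eq0 !subr_eq0.
apply: contraNN ab => /andP[/eqP ab1 /eqP ab2].
by rewrite (surjective_pairing a) (surjective_pairing b) ab1 ab2.
Qed.

Lemma side_eq0 a b y : a != b -> side a b y = 0 ->
  exists r, y = line_point a b r.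
Proof.
move=> /dist2_gt0; set D := (X in 0 < X) => D0 yab.
have Dn0 : D != 0 by rewrite gt_eqF.
exists (((y.1 - a.1) * (b.1 - a.1) + (y.2 - a.2) * (b.2 - a.2)) / D).
rewrite /line_point [LHS](surjective_pairing y); congr pair; apply/eqP;
  rewrite -subr_eq0; apply/eqP; apply: (mulfI Dn0); rewrite mulr0.
- rewrite (_ : D * _ = - (b.2 - a.2) * side a b y); first by rewrite yab mulr0.
  by rewrite /side /D; field; rewrite -/D.
- rewrite (_ : D * _ = (b.1 - a.1) * side a b y); first by rewrite yab mulr0.
  by rewrite /side /D; field; rewrite -/D.
Qed.

(** A point of [K] on the line but off the segment would see the midpoint strictly before a further
    point of the segment (at 3/4 or 1/4, according to the end). This puts the midpoint in [K]. *)
Lemma side_neq0 K a b y : open K -> convex2 K -> a != b ->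
  open_segment a b `<=` closure K -> (forall z, open_segment a b z -> ~ K z) ->
  K y -> side a b y != 0.
Proof.
move=> oK cK ab abK abnK Ky; apply/eqP => /(side_eq0 ab)[r yr]; subst y; clear ab.
have midK : ~ K (line_point a b (1/2)) by apply: abnK; exists (1/2) => //=; lra.
have [r0|r0] := leP r 0.
- have d0 : 3/4 - r != 0 by lra.
  apply: midK; have -> : line_point a b (1/2) =
      line_point (line_point a b r) (line_point a b (3/4)) ((1/2 - r) / (3/4 - r)).
    by rewrite /line_point /=; congr pair; field; lra.
  apply: convex2_interior_segment => //.
    by apply: abK; exists (3/4) => //=; lra.
  by rewrite divr_ge0 ?ltr_pdivrMr//; lra.
- have [r1|r1] := leP 1 r; last by apply: (abnK (line_point a b r)) => //; exists r => //=; lra.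
  have d0 : r - 1/4 != 0 by lra.
  apply: midK; have -> : line_point a b (1/2) =
      line_point (line_point a b r) (line_point a b (1/4)) ((r - 1/2) / (r - 1/4)).
    by rewrite /line_point /=; congr pair; field; lra.
  apply: convex2_interior_segment => //.
    by apply: abK; exists (1/4) => //=; lra.
  by rewrite divr_ge0 ?ltr_pdivrMr//; lra.
Qed.

Lemma side_same_sign K a b x y : open K -> convex2 K -> a != b ->
  open_segment a b `<=` closure K -> (forall z, open_segment a b z -> ~ K z) ->
  K x -> K y -> 0 < side a b x * side a b y.
Proof.
move=> oK cK ab abK abnK Kx Ky.
have s0 z : K z -> side a b z != 0 by exact: side_neq0.
clear ab.
have x0 := s0 _ Kx; have y0 := s0 _ Ky.
rewrite lt_neqAle eq_sym mulf_neq0//= leNgt; apply/negP => xy.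
have d0 : side a b x - side a b y != 0.
  by apply: contraTneq xy => /subr0_eq ->; rewrite -leNgt sqr_ge0.
pose t := side a b x / (side a b x - side a b y).
have : side a b (line_point x y t) != 0.
  apply: s0; apply: cK => //; rewrite /t.
  have [sx|sx] := ltP 0 (side a b x).
  + have sy : side a b y < 0 by rewrite -(pmulr_rlt0 _ sx).
    by rewrite divr_ge0 ?ler_pdivrMr; lra.
  + have sx' : side a b x < 0 by rewrite lt_neqAle x0.
    have sy : 0 < side a b y by rewrite -(nmulr_rlt0 _ sx').
    by rewrite -mulrNN -invrN divr_ge0 ?ler_pdivrMr; lra.
by rewrite side_line_point => /eqP; apply; rewrite /t; field.
Qed.

(** A point close to the midpoint of the segment, on the way from [x], lies in [K]. It is also on
    the way from [y] to another point of the segment, hence in [L]. *)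
Lemma same_side_meet K L a b x y : open K -> convex2 K -> open L -> convex2 L ->
  open_segment a b `<=` closure K -> open_segment a b `<=` closure L ->
  K x -> L y -> 0 < side a b x * side a b y -> K `&` L !=set0.
Proof.
move=> oK cK oL cL abK abL Kx Ly xy.
have y0 : side a b y != 0 by apply: contraTneq xy => ->; rewrite mulr0 ltxx.
(* [xa], [xb] and [xy'] are the barycentric coordinates of [x] in the triangle [a b y]; being on the
   same side means [xy' > 0]. *)
pose xy' := side a b x / side a b y.
pose xa := side b y x / side a b y; pose xb := side y a x / side a b y.
have xy'0 : 0 < xy'.
  rewrite (_ : xy' = side a b x * side a b y / side a b y ^+ 2).
    by rewrite divr_gt0// exprn_even_gt0.
  by rewrite /xy'; field.
have na := normr_ge0 xa; have nb := normr_ge0 xb.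
(* Small enough that [e * x + (1 - e) * m] keeps positive coordinates on both [a] and [b]. *)
pose e := (4 * (1 + `|xa| + `|xb| + xy'))^-1.
have e0 : 0 < e by rewrite invr_gt0; lra.
have ee : e * (1 + `|xa| + `|xb| + xy') = 1 / 4 by rewrite /e; field; lra.
have ea : - (e * `|xa|) <= e * xa.
  by rewrite -mulrN ler_pM2l//; have := ler_norm (- xa); rewrite normrN; lra.
have eb : - (e * `|xb|) <= e * xb.
  by rewrite -mulrN ler_pM2l//; have := ler_norm (- xb); rewrite normrN; lra.
have ea0 : 0 <= e * `|xa| by rewrite mulr_ge0// ltW.
have eb0 : 0 <= e * `|xb| by rewrite mulr_ge0// ltW.
have ey0 : 0 < e * xy' by rewrite mulr_gt0.
have l1 : 1 - e * xy' != 0 by lra.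
pose m := line_point a b (1 / 2).
(* Parameter of the point where the ray from [y] through the common point hits the segment. *)
pose tau := ((1 - e) / 2 + e * xb) / (1 - e * xy').
have tau01 : 0 < tau < 1.
  have sum1 : xa + xb + xy' = 1 by rewrite /xa /xb /xy' /side; move: y0; rewrite /side => y0; field.
  have esum : e * xa + e * xb + e * xy' = e by rewrite -!mulrDr sum1 mulr1.
  by rewrite /tau divr_gt0 ?ltr_pdivrMr; lra.
exists (line_point x m (1 - e)); split.
  apply: convex2_interior_segment => //; last by lra.
  by apply: abK; exists (1/2) => //=; lra.
have -> : line_point x m (1 - e) = line_point y (line_point a b tau) (1 - e * xy').
  have xE1 : x.1 = xy' * y.1 + xa * a.1 + xb * b.1.
    by rewrite /xa /xb /xy' /side; move: y0; rewrite /side => y0; field.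
  have xE2 : x.2 = xy' * y.2 + xa * a.2 + xb * b.2.
    by rewrite /xa /xb /xy' /side; move: y0; rewrite /side => y0; field.
  have xaE : xa = 1 - xb - xy' by rewrite /xa /xb /xy' /side; move: y0; rewrite /side => y0; field.
  by rewrite /m /line_point /= xE1 xE2 xaE /tau; congr pair; field.
apply: convex2_interior_segment => //; last by lra.
by apply: abL; exists tau.
Qed.

(** Pigeonhole on the signs of [side]: none vanishes, so two of the three cells are on the same
    side, and [same_side_meet] contradicts their disjointness. *)
Lemma three_cells (K1 K2 K3 : set (R * R)) a b : a != b ->
  (open K1 /\ convex2 K1) -> (open K2 /\ convex2 K2) -> (open K3 /\ convex2 K3) ->
  K1 `&` K2 = set0 -> K1 `&` K3 = set0 -> K2 `&` K3 = set0 ->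
  K1 !=set0 -> K2 !=set0 -> K3 !=set0 ->
  open_segment a b `<=` closure K1 -> open_segment a b `<=` closure K2 ->
  ~ open_segment a b `<=` closure K3.
Proof.
move=> ab [ o1 c1] [ o2 c2] [ o3 c3] d12 d13 d23 [x1 K1x] [x2 K2x] [x3 K3x] s1 s2 s3.
have n1 : side a b x1 != 0.
  apply: (@side_neq0 K1) => // z abz K1z.
  exact: (open_disjoint_closure o1 d12 K1z (s2 _ abz)).
have n2 : side a b x2 != 0.
  apply: (@side_neq0 K2) => // z abz K2z.
  exact: (open_disjoint_closure o2 d23 K2z (s3 _ abz)).
have n3 : side a b x3 != 0.
  apply: (@side_neq0 K3) => // z abz K3z.
  by apply: (open_disjoint_closure o3 _ K3z (s1 _ abz)); rewrite setIC.
have m12 : ~ 0 < side a b x1 * side a b x2.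
  move=> /(same_side_meet o1 c1 o2 c2 s1 s2 K1x K2x); rewrite d12 => -[]; done.
have m13 : ~ 0 < side a b x1 * side a b x3.
  move=> /(same_side_meet o1 c1 o3 c3 s1 s3 K1x K3x); rewrite d13 => -[]; done.
have m23 : ~ 0 < side a b x2 * side a b x3.
  move=> /(same_side_meet o2 c2 o3 c3 s2 s3 K2x K3x); rewrite d23 => -[]; done.
move: n1 n2 n3; rewrite !neq_lt => /orP[n1|n1] /orP[n2|n2] /orP[n3|n3];
  solve [by apply: m12; rewrite -mulrNN mulr_gt0 ?oppr_gt0|by apply: m12; rewrite mulr_gt0|
   by apply: m13; rewrite -mulrNN mulr_gt0 ?oppr_gt0|by apply: m13; rewrite mulr_gt0|
   by apply: m23; rewrite -mulrNN mulr_gt0 ?oppr_gt0|by apply: m23; rewrite mulr_gt0].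
Qed.

End plane_topology.

(** * Measurability and real-valued area of plane sets *)

Section plane_area.
Variable R : realType.
Local Notation mu := (@lebesgue_measure R).
Local Notation mR2 := (measurableTypeR R * measurableTypeR R)%type.
Implicit Types (E F : set (R * R)) (x a b : R * R).

Lemma open_box E x : open E -> E x -> exists2 e : R, 0 < e &
  forall y, `|x.1 - y.1| < e -> `|x.2 - y.2| < e -> E y.
Proof.
move=> oE Ex; have [[A B] /= [xA xB] ABE] := open_nbhs_nbhs (conj oE Ex).
move: xA xB => /nbhs_ballP[d /= d0 dA] /nbhs_ballP[e /= e0 eB].
exists (Num.min d e); first by rewrite lt_min d0.
move=> y; rewrite !lt_min => /andP[y1 _] /andP[_ y2].
by rewrite (surjective_pairing y); apply: (ABE (y.1, y.2)); split; [exact: dA|exact: eB].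
Qed.

Lemma open_measurable2 E : open E -> measurable (E : set mR2).
Proof.
move=> oE.
pose box (q : (rat * rat) * (rat * rat)) : set (R * R) :=
  `]ratr q.1.1, ratr q.1.2[%classic `*` `]ratr q.2.1, ratr q.2.2[%classic.
rewrite (_ : E = \bigcup_q if pselect (box q `<=` E) then box q else set0).
  apply: countable_bigcupT_measurable; first exact: countableP.
  move=> q; case: pselect => ?; last exact: measurable0.
  by rewrite /box; apply: measurableX; exact: measurable_itv.
apply/seteqP; split => [x Ex|x [q _]]; last by case: pselect => // bE /bE.
have [e e0 eE] := open_box oE Ex.
have lt1 (r : R) : r - e < r by lra.
have lt2 (r : R) : r < r + e by lra.
have [q1] := rat_in_itvoo (lt1 x.1); rewrite in_itv /= => q1x.
have [q2] := rat_in_itvoo (lt2 x.1); rewrite in_itv /= => q2x.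
have [q3] := rat_in_itvoo (lt1 x.2); rewrite in_itv /= => q3x.
have [q4] := rat_in_itvoo (lt2 x.2); rewrite in_itv /= => q4x.
exists ((q1, q2), (q3, q4)) => //.
case: pselect => [?|]; first by rewrite /box /= !in_itv /=; split => /=; lra.
move=> nE; exfalso; apply: nE => y; rewrite /box /= !in_itv /= => -[y1 y2].
by apply: eE; rewrite ltr_norml; lra.
Qed.

Lemma closed_measurable2 E : closed E -> measurable (E : set mR2).
Proof.
move=> cE; rewrite -(setCK E); apply: measurableC; apply: open_measurable2.
by rewrite openC.
Qed.

Lemma closed_side a b : closed [set z | side a b z = 0].
Proof.
apply: (@closed_comp _ _ (side a b) [set 0]); last exact: closed_eq.
move=> z _; rewrite (_ : side a b = fun z => - (b.2 - a.2) * z.1 + (b.1 - a.1) * z.2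
    + ((b.2 - a.2) * a.1 - (b.1 - a.1) * a.2)).
  exact: continuous_affine2.
by apply/funext => y; rewrite /side; ring.
Qed.

Lemma area_line a b : a != b -> area [set z | side a b z = 0] = 0%E.
Proof.
move=> /dist2_gt0; set D := (X in 0 < X) => D0.
pose p := (b.1 - a.1, b.2 - a.2); pose q := (- (b.2 - a.2), b.1 - a.1).
have pq : cross p q = D by rewrite /cross /D /=; ring.
rewrite (@area_aff _ a p q); last 2 first.
- by rewrite pq gt_eqF.
- by apply: closed_measurable2; exact: closed_side.
rewrite (_ : _ @^-1` _ = setT `*` [set (0 : R)]).
  rewrite /area product_measure1E; [|exact: measurableT|exact: measurable_set1].
  by rewrite /= lebesgue_measure_set1 !mule0.
apply/seteqP; split => z /=; rewrite /side /aff /p /q /=.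
- move=> /eqP; rewrite (_ : _ - _ = z.2 * D); last by rewrite /D; ring.
  by rewrite mulf_eq0 (gt_eqF D0) orbF => /eqP.
- by move=> [_ ->]; ring.
Qed.

Definition ar E : R := fine (area E).

Definition bounded_area E := measurable (E : set mR2) /\ (area E < +oo)%E.

Lemma area_ge0 E : (0 <= area E)%E.
Proof. by rewrite /area; exact: measure_ge0. Qed.

Lemma ar_ge0 E : 0 <= ar E.
Proof. by rewrite fine_ge0// area_ge0. Qed.

Lemma arE E : bounded_area E -> area E = (ar E)%:E.
Proof. by move=> [_ fE]; rewrite /ar fineK// ge0_fin_numE// area_ge0. Qed.

Lemma bounded_areaW E F : bounded_area F -> measurable (E : set mR2) ->
  E `<=` F -> bounded_area E.
Proof.
move=> [mF fF] mE EF; split=> //; apply: le_lt_trans fF.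
by rewrite /area; apply: le_measure; rewrite ?inE.
Qed.

Lemma ar_le E F : bounded_area F -> measurable (E : set mR2) -> E `<=` F ->
  ar E <= ar F.
Proof.
move=> bF mE EF; have bE := bounded_areaW bF mE EF.
rewrite -lee_fin -(arE bE) -(arE bF); apply: le_measure; rewrite ?inE//.
by case: bF.
Qed.

Lemma bounded_areaU E F : bounded_area E -> bounded_area F ->
  bounded_area (E `|` F).
Proof.
move=> [mE fE] [mF fF]; split; first exact: measurableU.
apply: le_lt_trans (lte_add_pinfty fE fF).
exact: measureU2.
Qed.

Lemma ar_U E F : bounded_area E -> bounded_area F ->
  ar (E `|` F) <= ar E + ar F.
Proof.
move=> bE bF; have bEF := bounded_areaU bE bF.
rewrite -lee_fin EFinD -(arE bE) -(arE bF) -(arE bEF).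
by apply: measureU2; [case: bE|case: bF].
Qed.

Lemma ar_le_null E F (N : set (R * R)) : bounded_area F ->
  measurable (E : set mR2) -> measurable (N : set mR2) -> area N = 0%E ->
  E `<=` F `|` N -> ar E <= ar F.
Proof.
move=> bF mE mN N0 EFN.
have bN : bounded_area N by split; rewrite // N0.
apply: (le_trans (ar_le (bounded_areaU bF bN) mE EFN)).
by apply: (le_trans (ar_U bF bN)); rewrite {2}/ar N0 addr0.
Qed.

Lemma area_gt0 E : open E -> E !=set0 -> (0 < area E)%E.
Proof.
move=> oE [x Ex]; have [e e0 eE] := open_box oE Ex.
pose S : set (R * R) := `]x.1 - e, x.1 + e[%classic `*` `]x.2 - e, x.2 + e[%classic.
have mS : measurable (S : set mR2) by apply: measurableX; exact: measurable_itv.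
apply: (@lt_le_trans _ _ (area S)); last first.
  rewrite /area; apply: le_measure; rewrite ?inE//; first exact: open_measurable2.
  move=> y []; rewrite /= !in_itv /= => y1 y2.
  by apply: eE; rewrite ltr_norml; lra.
rewrite /area /S product_measure1E//= !lebesgue_measure_itv /= !lte_fin.
rewrite !ifT; [|lra|lra].
by rewrite -!EFinD -EFinM lte_fin mulr_gt0//; lra.
Qed.

Lemma bounded_area_box (B : R) E : measurable (E : set mR2) ->
  (forall z, E z -> `|z.1| <= B /\ `|z.2| <= B) -> bounded_area E.
Proof.
move=> mE EB; pose S : set (R * R) := `[- B, B]%classic `*` `[- B, B]%classic.
have mS : measurable (S : set mR2) by apply: measurableX; exact: measurable_itv.
apply: (@bounded_areaW _ S) => //; last first.
  by move=> z /EB[]; rewrite !ler_norml /S /= !in_itv.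
split => //; rewrite /area /S product_measure1E//= !lebesgue_measure_itv /=.
by case: ifPn => _; rewrite ?mule0// -!EFinD -EFinM ltry.
Qed.

Lemma ar_bigcup (I : finType) (P : pred I) (F : I -> set (R * R)) E : bounded_area E ->
  (forall i, P i -> measurable (F i : set mR2)) -> (forall i, P i -> F i `<=` E) ->
  (forall i j, P i -> P j -> i != j -> F i `&` F j = set0) ->
  \sum_(i | P i) ar (F i) <= ar E.
Proof.
move=> bE mF FE tF.
have bF i : P i -> bounded_area (F i) by move=> Pi; exact: (bounded_areaW bE (mF _ Pi) (FE _ Pi)).
suff H (s : seq I) : uniq s -> exists2 G, [/\ measurable (G : set mR2), G `<=` E &
    forall x, G x -> exists2 i, (i \in s) && P i & F i x] &
    \sum_(i <- s | P i) ar (F i) = ar G.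
  have [G [mG GE _] ->] := H _ (index_enum_uniq I).
  exact: ar_le.
elim: s => [_|i s IH /= /andP[nis us]].
  exists set0; last by rewrite big_nil /ar /area measure0.
  by split.
have [G [mG GE Gs] GE'] := IH us.
have bG : bounded_area G by exact: (bounded_areaW bE).
rewrite big_cons; case: ifPn => Pi; last first.
  exists G => //; split => // x /Gs[j /andP[js Pj] Fj]; exists j => //.
  by rewrite inE js orbT.
exists (F i `|` G); last first.
  have bFi := bF i Pi; have bFG := bounded_areaU bFi bG.
  rewrite GE'; apply/esym; apply: EFin_inj.
  rewrite EFinD -(arE bFi) -(arE bG) -(arE bFG).
  apply: measureU => //; first exact: mF.
  apply/seteqP; split => // x [Fix /Gs[j /andP[js Pj] Fjx]].
  have ij : i != j by apply: contraNneq nis => ->.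
  by have := tF _ _ Pi Pj ij => /seteqP[+ _]; apply.
split; first by apply: measurableU => //; exact: mF.
  by move=> x [|/GE//]; exact: FE.
move=> x [Fix|/Gs[j /andP[js Pj] Fj]]; first by exists i => //; rewrite inE eqxx.
by exists j => //; rewrite inE js orbT.
Qed.

End plane_area.

(** * Isoperimetric inequality on the unit square *)

Section square.
Variable R : realType.
Local Notation mu := (@lebesgue_measure R).
Local Notation mR := (measurableTypeR R).
Local Notation mR2 := (measurableTypeR R * measurableTypeR R)%type.
Implicit Types (X Y : set R) (A B N : set (R * R)).

Lemma measure_le_bigsetU (I : finType) (P : pred I) (F : I -> set R) X :
  measurable (X : set mR) -> (forall i, P i -> measurable (F i : set mR)) ->
  X `<=` \bigcup_(i in [set i | P i]) F i ->
  (mu X <= \sum_(i | P i) mu (F i))%E.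
Proof.
move=> mX mF XF.
have H (s : seq I) : measurable (\big[setU/set0]_(i <- s | P i) F i : set mR) /\
    (mu (\big[setU/set0]_(i <- s | P i) F i) <= \sum_(i <- s | P i) mu (F i))%E.
  elim: s => [|i s [IH1 IH2]]; first by rewrite !big_nil measure0.
  rewrite !big_cons; case: ifPn => // Pi; split.
    by apply: measurableU => //; exact: mF.
  by apply: (le_trans (measureU2 _ _ _)) => //; [exact: mF|exact: leeD2l].
have [mU leU] := H (index_enum I).
apply: le_trans leU; apply: le_measure; rewrite ?inE//.
move=> x /XF[i /= Pi Fix]; rewrite -bigcup_seq_cond; exists i => //=.
by rewrite mem_index_enum.
Qed.

Definition unit_square : set (R * R) := [set z | 0 < z.1 < 1 /\ 0 < z.2 < 1].

Definition len X : R := fine (mu X).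

Lemma lenE X : measurable (X : set mR) -> X `<=` `]0, 1[%classic ->
  mu X = (len X)%:E.
Proof.
move=> mX X01; rewrite /len fineK// ge0_fin_numE//.
apply: (@le_lt_trans _ _ (mu `]0, 1[%classic)).
  by apply: le_measure; rewrite ?inE//; exact: measurable_itv.
by rewrite lebesgue_measure_itv /=; case: ifP => _; rewrite ?ltry// -EFinD ltry.
Qed.

Lemma len_ge0 X : 0 <= len X. Proof. by rewrite fine_ge0. Qed.

Lemma unit_squareE : unit_square = `]0, 1[%classic `*` `]0, 1[%classic.
Proof. by apply/seteqP; split => z; rewrite /unit_square /= !in_itv. Qed.

Lemma bounded_area_square : bounded_area unit_square.
Proof.
apply: (@bounded_area_box _ 1).
  by rewrite unit_squareE; apply: measurableX; exact: measurable_itv.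
by move=> z [/andP[? ?] /andP[? ?]]; rewrite !ler_norml; split; lra.
Qed.

Lemma area_setX X Y : measurable (X : set mR) -> measurable (Y : set mR) ->
  X `<=` `]0, 1[%classic -> Y `<=` `]0, 1[%classic ->
  ar (X `*` Y) = len X * len Y.
Proof.
move=> mX mY X01 Y01; rewrite /ar /area product_measure1E//=.
by rewrite (lenE mX X01) (lenE mY Y01).
Qed.

Lemma open_fst A : open A -> measurable ([set z.1 | z in A] : set mR).
Proof. by move=> oA; apply: open_measurable; exact: fst_open. Qed.

Lemma open_snd A : open A -> measurable ([set z.2 | z in A] : set mR).
Proof. by move=> oA; apply: open_measurable; exact: snd_open. Qed.

Lemma len_split X Y : measurable (X : set mR) -> measurable (Y : set mR) ->
  X `<=` `]0, 1[%classic -> len X = len (X `\` Y) + len (X `&` Y).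
Proof.
move=> mX mY X01; apply: EFin_inj; rewrite EFinD.
have mD : measurable (X `\` Y : set mR) by exact: measurableD.
have mI : measurable (X `&` Y : set mR) by exact: measurableI.
rewrite -!lenE//; try by move=> x [] /X01.
rewrite -measureU//; first by rewrite setUC setUIDK.
by apply/seteqP; split => // x [[_ nY] [_ Y']].
Qed.

(* [XA `\` XB] times [YB `\` YA] avoids [A] and [B], so one factor is null. *)
Lemma square_isoperimetric A B N (p : R) : open A -> open B ->
  A `<=` unit_square -> B `<=` unit_square ->
  measurable (N : set mR2) -> area N = 0%E -> unit_square `<=` A `|` B `|` N ->
  (mu ([set z.1 | z in A] `&` [set z.1 | z in B]) <= p%:E)%E ->
  (mu ([set z.2 | z in A] `&` [set z.2 | z in B]) <= p%:E)%E ->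
  Num.min (ar A) (ar B) <= p ^+ 2.
Proof.
move=> oA oB AS BS mN N0 SABN.
set XA := [set z.1 | z in A]; set XB := [set z.1 | z in B].
set YA := [set z.2 | z in A]; set YB := [set z.2 | z in B].
have mXA : measurable (XA : set mR) by exact: open_fst.
have mXB : measurable (XB : set mR) by exact: open_fst.
have mYA : measurable (YA : set mR) by exact: open_snd.
have mYB : measurable (YB : set mR) by exact: open_snd.
have XA01 : XA `<=` `]0, 1[%classic by move=> _ [z /AS[z1 z2] <-]; rewrite /= in_itv.
have XB01 : XB `<=` `]0, 1[%classic by move=> _ [z /BS[z1 z2] <-]; rewrite /= in_itv.
have YA01 : YA `<=` `]0, 1[%classic by move=> _ [z /AS[z1 z2] <-]; rewrite /= in_itv.
have YB01 : YB `<=` `]0, 1[%classic by move=> _ [z /BS[z1 z2] <-]; rewrite /= in_itv.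
rewrite (@lenE (XA `&` XB)) ?(@lenE (YA `&` YB)) ?lee_fin;
  try exact: measurableI; try (by move=> x [] /XA01); try (by move=> x [] /YA01).
move=> xp yp.
have bound C (XC YC : set R) : measurable (XC : set mR) -> measurable (YC : set mR) ->
    XC `<=` `]0, 1[%classic -> YC `<=` `]0, 1[%classic -> open C -> C `<=` XC `*` YC ->
    ar C <= len XC * len YC.
  move=> mXC mYC XC01 YC01 oC CXY; rewrite -area_setX//; apply: ar_le => //.
    apply: (bounded_areaW bounded_area_square); first exact: measurableX.
    by rewrite unit_squareE => z [/XC01 ? /YC01].
  exact: open_measurable2.
have null (XC YC : set R) : measurable (XC : set mR) -> measurable (YC : set mR) ->
    XC `<=` `]0, 1[%classic -> YC `<=` `]0, 1[%classic -> XC `*` YC `<=` N ->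
    len XC * len YC = 0.
  move=> mXC mYC XC01 YC01 CXY; rewrite -area_setX//; apply/eqP.
  rewrite eq_le ar_ge0 andbT -[leRHS](_ : ar N = 0); last by rewrite /ar N0.
  by apply: ar_le => //; [split; rewrite // N0|exact: measurableX].
have boundA : ar A <= len XA * len YA by apply: bound => // z Az; split; exists z.
have boundB : ar B <= len XB * len YB by apply: bound => // z Bz; split; exists z.
have mD X Y : measurable (X : set mR) -> measurable (Y : set mR) ->
  measurable (X `\` Y : set mR) by exact: measurableD.
have D01 X Y : X `<=` `]0, 1[%classic -> X `\` Y `<=` `]0, 1[%classic.
  by move=> X01 x [/X01].
have nullAB : len (XA `\` XB) * len (YB `\` YA) = 0.
  apply: null; rewrite ?mD//; try exact: D01; try exact: mD.
  move=> z [[XAz XBz] [YBz YAz]].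
  have : unit_square z by rewrite unit_squareE; split; [exact: XA01|exact: YB01].
  by move=> /SABN[[Az|Bz]|//]; exfalso; [apply: YAz|apply: XBz]; exists z.
have nullBA : len (XB `\` XA) * len (YA `\` YB) = 0.
  apply: null; rewrite ?mD//; try exact: D01; try exact: mD.
  move=> z [[XBz XAz] [YAz YBz]].
  have : unit_square z by rewrite unit_squareE; split; [exact: XB01|exact: YA01].
  by move=> /SABN[[Az|Bz]|//]; exfalso; [apply: XAz|apply: YBz]; exists z.
have leA := len_split mXA mXB XA01; have leYA := len_split mYA mYB YA01.
have leB := len_split mXB mXA XB01; have leYB := len_split mYB mYA YB01.
move: leB leYB; rewrite (setIC XB) (setIC YB) => leB leYB.
have len01 : len `]0, 1[%classic = 1.
  by rewrite /len lebesgue_measure_itv /= lte_fin ltr01 -EFinD /= subr0.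
have p0 : 0 <= p by apply: le_trans xp; exact: len_ge0.
have area1 C : open C -> C `<=` unit_square -> ar C <= 1.
  move=> oC CS; rewrite (_ : 1 = ar unit_square).
    by apply: ar_le => //; [exact: bounded_area_square|exact: open_measurable2].
  by rewrite unit_squareE area_setX ?len01 ?mulr1//; exact: measurable_itv.
(* Almost every abscissa is then in both shadows, so [p >= 1] and the trivial bound by the area of
   the square suffices. *)
have fullX : len (XA `\` XB) = 0 -> len (XB `\` XA) = 0 -> 1 <= p.
  move=> a0 b0.
  have mXU : measurable (XA `|` XB : set mR) by exact: measurableU.
  have := @null (`]0, 1[%classic `\` (XA `|` XB)) `]0, 1[%classic.
  rewrite len01 mulr1 => H; apply: le_trans xp; rewrite -len01.
  rewrite (len_split _ mXU)//.
  rewrite H ?add0r//; last 2 first.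
  - exact: mD.
  - move=> z [[z1 nX] z2].
    have : unit_square z by rewrite unit_squareE.
    by move=> /SABN[[Az|Bz]|//]; exfalso; apply: nX; [left|right]; exists z.
  rewrite (_ : _ `&` _ = XA `|` XB); last by rewrite setIC setIidl// subUset.
  have XU01 : XA `|` XB `<=` `]0, 1[%classic by rewrite subUset.
  rewrite (len_split mXU mXA XU01) (_ : _ `\` _ = XB `\` XA) ?b0 ?add0r; last first.
    by apply/seteqP; split => x [] => [[|]|] ? ? //; split => //; right.
  rewrite (_ : _ `&` _ = XA); last by rewrite setIC setIidl//; exact: subsetUl.
  by rewrite leA a0 add0r.
have fullY : len (YA `\` YB) = 0 -> len (YB `\` YA) = 0 -> 1 <= p.
  move=> a0 b0.
  have mYU : measurable (YA `|` YB : set mR) by exact: measurableU.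
  have := @null `]0, 1[%classic (`]0, 1[%classic `\` (YA `|` YB)).
  rewrite len01 mul1r => H; apply: le_trans yp; rewrite -len01.
  rewrite (len_split _ mYU)//.
  rewrite H ?add0r//; last 2 first.
  - exact: mD.
  - move=> z [z1 [z2 nX]].
    have : unit_square z by rewrite unit_squareE.
    by move=> /SABN[[Az|Bz]|//]; exfalso; apply: nX; [left|right]; exists z.
  rewrite (_ : _ `&` _ = YA `|` YB); last by rewrite setIC setIidl// subUset.
  have YU01 : YA `|` YB `<=` `]0, 1[%classic by rewrite subUset.
  rewrite (len_split mYU mYA YU01) (_ : _ `\` _ = YB `\` YA) ?b0 ?add0r; last first.
    by apply/seteqP; split => x [] => [[|]|] ? ? //; split => //; right.
  rewrite (_ : _ `&` _ = YA); last by rewrite setIC setIidl//; exact: subsetUl.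
  by rewrite leYA a0 add0r.
have p1 : 1 <= p -> Num.min (ar A) (ar B) <= p ^+ 2.
  move=> p1; rewrite ge_min; apply/orP; left.
  by apply: (le_trans (area1 _ oA AS)); rewrite -(expr1n _ 2) lerXn2r ?nnegrE.
move/eqP: nullAB; move/eqP: nullBA; rewrite !mulf_eq0.
(* In the two mixed cases, one of the sets has both shadows, up to null sets, inside the common
   shadows, so its area is at most [p * p]. *)
move=> /orP[/eqP xb|/eqP ya] /orP[/eqP xa|/eqP yb].
- by apply: p1; exact: fullX.
- rewrite ge_min; apply/orP; right; apply: (le_trans boundB).
  by rewrite leB leYB xb yb !add0r expr2 ler_pM ?len_ge0.
- rewrite ge_min; apply/orP; left; apply: (le_trans boundA).
  by rewrite leA leYA xa ya !add0r expr2 ler_pM ?len_ge0.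
- by apply: p1; exact: fullY.
Qed.

End square.

(** * Sets of zero length *)

Section hausdorff.
Variable R : realType.
Local Notation mu := (@lebesgue_measure R).
Local Notation mR := (measurableTypeR R).

Lemma edist_ge_fst (x y : R * R) : `|x.1 - y.1| <= Defs.edist x y.
Proof.
by rewrite /Defs.edist /dot /= -sqrtr_sqr ler_wsqrtr// expr2 lerDl -expr2 sqr_ge0.
Qed.

Lemma edist_ge_snd (x y : R * R) : `|x.2 - y.2| <= Defs.edist x y.
Proof.
by rewrite /Defs.edist /dot /= -sqrtr_sqr ler_wsqrtr// expr2 lerDr -expr2 sqr_ge0.
Qed.

(** A 1-Lipschitz map sends a cover of [C] to a cover of the interval from [u] to [v], so the
    diameters add up to at least half its length. Covers of mesh size 1 are enough, the measure
    being a supremum over mesh sizes. *)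
Lemma hausdorff1_proj_gt0 (C : set (R * R)) (g : R * R -> R) (u v : R) :
  (forall x y, `|g x - g y| <= Defs.edist x y) -> u < v ->
  (forall r, u <= r <= v -> exists2 z, C z & g z = r) ->
  (0 < hausdorff1 C)%E.
Proof.
move=> glip uv Cuv.
apply: (@lt_le_trans _ _ ((v - u) / 2)%:E); first by rewrite lte_fin; lra.
apply: (@le_trans _ _ (ereal_inf
      [set (\sum_(0 <= n <oo) diameter (U n))%E | U in
        [set U : nat -> set (R * R) |
          C `<=` \bigcup_n U n /\ forall n, (diameter (U n) <= 1%:E)%E]])); last first.
  by apply: ereal_sup_ubound; exists (1 : R); [exact: ltr01|].
apply: le_ereal_inf_tmp => _ [U [CU U1] <-].
have d0 n : (0 <= diameter (U n))%E by apply: ereal_sup_ubound; left.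
have dfin n : diameter (U n) = (fine (diameter (U n)))%:E.
  by rewrite fineK// ge0_fin_numE//; apply: (le_lt_trans (U1 n)); rewrite ltry.
pose d n := fine (diameter (U n)).
(* The image of [U n] is enclosed in an interval centred at the image of an arbitrary point; this
   doubles the diameter and explains the factor 2. *)
pose V n : set R := if pselect (exists x, U n x) is left e
   then `[g (projT1 (cid e)) - d n, g (projT1 (cid e)) + d n]%classic else set0.
have mV n : measurable (V n : set mR).
  by rewrite /V; case: pselect => ?; [exact: measurable_itv|exact: measurable0].
have muV n : (mu (V n) <= 2%:E * diameter (U n))%E.
  rewrite /V; case: pselect => e; last first.
    by rewrite measure0 mule_ge0.
  rewrite lebesgue_measure_itv /= dfin -/(d n) -EFinM.
  have dn0 : 0 <= d n by rewrite fine_ge0.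
  by case: ifP => _; rewrite -?EFinD lee_fin; lra.
have : (mu `[u, v]%classic <= \sum_(0 <= n <oo) mu (V n))%E.
  apply: measure_sigma_subadditive => //.
  move=> r; rewrite /= in_itv /= => /Cuv[z /CU[n _ Unz] gz]; exists n => //.
  rewrite /V; case: pselect => [e|[]]; last by exists z.
  case: (cid e) => y Uy /=; rewrite in_itv /=.
  have : ((Defs.edist z y)%:E <= diameter (U n))%E.
    by apply: ereal_sup_ubound; right; exists z => //; exists y.
  rewrite dfin lee_fin -/(d n) => /(le_trans (glip z y)).
  by rewrite gz ler_norml; lra.
rewrite lebesgue_measure_itv /= lte_fin uv -EFinB => uvV.
have : ((v - u)%:E <= 2%:E * \sum_(0 <= n <oo) diameter (U n))%E.
  rewrite -nneseriesZl//; apply: (le_trans uvV); exact: lee_nneseries.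
by move=> H; rewrite mulrC EFinM lee_pdivrMl.
Qed.

(** Two distinct points differ in a coordinate, and by convexity that coordinate takes all values in
    between. A contact of zero length between two cells is thus at most one point. *)
Lemma hausdorff1_eq0 (C : set (R * R)) (x y : R * R) : convex2 C ->
  hausdorff1 C = 0%E -> C x -> C y -> x = y.
Proof.
move=> cC C0 Cx Cy; apply: contrapT => xy.
have pos (g : R * R -> R) : (forall x y, `|g x - g y| <= Defs.edist x y) ->
    (forall x y t, g (line_point x y t) = (1 - t) * g x + t * g y) ->
    forall x y, C x -> C y -> ~ g x < g y.
  move=> glip glin {xy}x {Cx Cy}y Cx Cy gxy.
  suff : (0 < hausdorff1 C)%E by rewrite C0 ltxx.
  apply: (hausdorff1_proj_gt0 glip gxy) => r r01.
  clear C0; have n0 : g y - g x != 0 by lra.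
  exists (line_point x y ((r - g x) / (g y - g x))).
    by apply: cC => //; rewrite divr_ge0 ?ler_pdivrMr; lra.
  by rewrite glin; field.
have H1 := pos fst edist_ge_fst (fun x y t => erefl).
have H2 := pos snd edist_ge_snd (fun x y t => erefl).
apply: xy; rewrite (surjective_pairing x) (surjective_pairing y).
congr pair; apply/eqP; rewrite eq_le !leNgt; apply/andP; split; apply/negP.
- exact: H1.
- exact: H1.
- exact: H2.
- exact: H2.
Qed.

End hausdorff.

(** * Meshes and parallelograms *)

Section mesh_geometry.
Variables (R : realType) (Omega : set (R * R)) (M : mesh Omega).
Local Notation mu := (@lebesgue_measure R).
Local Notation mR := (measurableTypeR R).
Local Notation mR2 := (measurableTypeR R * measurableTypeR R)%type.
Implicit Types (K L : cells M) (s : edges M) (P : pred (cells M)).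

Lemma area_bigcup_null (I : choiceType) (F : I -> set (R * R)) (r : seq I) :
  (forall i, i \in r -> measurable (F i : set mR2) /\ area (F i) = 0%E) ->
  measurable (\bigcup_(i in [set` r]) F i : set mR2) /\
  area (\bigcup_(i in [set` r]) F i) = 0%E.
Proof.
elim: r => [_|i r IH mF].
  by rewrite bigcup_seq big_nil /area measure0.
have [mG G0] : measurable (\bigcup_(i in [set` r]) F i : set mR2) /\
    area (\bigcup_(i in [set` r]) F i) = 0%E.
  by apply: IH => j jr; apply: mF; rewrite inE jr orbT.
have [mFi Fi0] := mF i (mem_head _ _).
rewrite bigcup_seq big_cons -bigcup_seq; split; first exact: measurableU.
apply/eqP; rewrite eq_le area_ge0 andbT -[leRHS]adde0 -{1}Fi0 -{1}G0.
by rewrite /area; exact: measureU2.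
Qed.

Lemma cell_convex2 K : convex2 (cell K).
Proof. by apply: convex_set2; exact: cell_convex. Qed.

Lemma cell_neq0 K : cell K !=set0.
Proof. by exists (Defs.center K); exact: center_in. Qed.

Lemma separates_open_segment s K L : separates s K L ->
  open_segment (endpoints s).1 (endpoints s).2 `<=` closure (cell K).
Proof.
move=> [_ _ _ KL] z ez; have : closure (edge s) z by exact: subset_closure.
by rewrite -KL => -[].
Qed.

Lemma separatesC s K L : separates s K L -> separates s L K.
Proof. by move=> [KL sK sL e]; split => //; [rewrite eq_sym|rewrite setIC]. Qed.

Lemma separates_third s K L K' : separates s K L ->
  open_segment (endpoints s).1 (endpoints s).2 `<=` closure (cell K') ->
  K' = K \/ K' = L.
Proof.
move=> sKL sK'; apply: contrapT => /not_orP[/eqP K'K /eqP K'L].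
have [KL _ _ _] := sKL.
have oc K0 : open (cell K0) /\ convex2 (cell K0).
  by split; [exact: cell_open|exact: cell_convex2].
apply: (three_cells (endpoints_neq s) (oc K) (oc L) (oc K')
  (cell_disjoint KL) _ _ (cell_neq0 K) (cell_neq0 L) (cell_neq0 K')
  (separates_open_segment sKL) (separates_open_segment (separatesC sKL)) sK');
  by apply: cell_disjoint; rewrite eq_sym.
Qed.

Lemma sides_separates s K L : sides s = Some (K, L) -> separates s K L.
Proof.
by rewrite /sides; case: pickP => // -[K' L'] /= /asboolP + [<- <-].
Qed.

(** The choice made by [sides] loses no interface: by [three_cells], it can only exchange the two
    cells. *)
Lemma separates_sides s K L : separates s K L ->
  sides s = Some (K, L) \/ sides s = Some (L, K).
Proof.
move=> sKL; case E : (sides s) => [[K' L']|]; last first.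
  move: E; rewrite /sides; case: pickP => // /(_ (K, L)) /= /asboolP.
  by rewrite -/(separates s K L).
have sKL' := sides_separates E; have [KL' _ _ _] := sKL'.
have := separates_third sKL (separates_open_segment sKL').
have := separates_third sKL (separates_open_segment (separatesC sKL')).
by move=> [EL|EL] [EK|EK]; subst K' L'; rewrite ?eqxx // in KL' *; [right|left].
Qed.

Definition edge_line s := [set z | side (endpoints s).1 (endpoints s).2 z = 0].

(** A closed null set that contains all cell boundaries; whole lines are used because [area_line]
    gives their nullity at once. *)
Definition mesh_lines := \bigcup_(s in [set` enum (edges M)]) edge_line s.

Lemma mesh_lines_null : measurable (mesh_lines : set mR2) /\ area mesh_lines = 0%E.
Proof.
apply: area_bigcup_null => s _; split.
  by apply: closed_measurable2; exact: closed_side.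
exact/area_line/endpoints_neq.
Qed.

Lemma closure_edge_line s : closure (edge s) `<=` edge_line s.
Proof.
have /closure_id E := @closed_side R (endpoints s).1 (endpoints s).2.
rewrite /edge_line [X in _ `<=` X]E.
apply: closure_subset => _ [t _ <-]; rewrite /= /side /line_point /=; ring.
Qed.

Definition cells_in P : set (R * R) := [set z | exists2 K, P K & cell K z].

Lemma cells_inE P : cells_in P = \bigcup_(K in [set K | P K]) cell K.
Proof. by []. Qed.

Lemma open_cells_in P : open (cells_in P).
Proof. by rewrite cells_inE; apply: bigcup_open => K _; exact: cell_open. Qed.

Lemma closure_cells_lines : closure Omega `<=`
  cells_in predT `|` mesh_lines.
Proof.
rewrite (cell_cover M) => z [K _ Kz].
have [Kz'|nKz] := pselect (cell K z); first by left; exists K.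
right; have : frontier (cell K) z.
  by split => // /interior_subset.
rewrite cell_edgesE => -[s _ /closure_edge_line sz]; exists s => //.
by rewrite /= mem_enum.
Qed.

Definition perimeter P : R := \sum_s (if sides s is Some (K, L)
   then if P K != P L then edge_length s else 0 else 0).

Lemma edge_length_ge0 s : 0 <= edge_length s.
Proof. exact: sqrtr_ge0. Qed.

(** The closures of the cells in [P] and those of the other cells form two finite, hence closed,
    unions that cover the segment; [segment_closed_meet] applies. *)
Lemma crossing P z w : cells_in P z -> cells_in (predC P) w ->
  (forall t, 0 <= t <= 1 -> Omega (line_point z w t)) ->
  exists2 t, 0 <= t <= 1 &
    (exists K L, [/\ P K, ~~ P L & (closure (cell K) `&` closure (cell L)) (line_point z w t)]).
Proof.
move=> [K PK Kz] [L PL Lw] zwO.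
pose F (Q : pred (cells M)) : set (R * R) := \bigcup_(K in [set` enum Q]) closure (cell K).
have cF Q : closed (F Q).
  by apply: closed_bigcup => [|? _]; [exact: finite_seq|exact: closed_closure].
have [|||t t01 [[K' PK' K't] [L' PL' L't]]] :=
    @segment_closed_meet R (F P) (F (predC P)) z w (cF _) (cF _).
- by exists K; [rewrite /= mem_enum|exact: subset_closure].
- by exists L; [rewrite /= mem_enum|exact: subset_closure].
- move=> t /zwO /subset_closure; rewrite (cell_cover M) => -[K' _ K't].
  have [PK'|PK'] := boolP (P K'); [left|right]; exists K' => //=; by rewrite mem_enum.
exists t => //; exists K', L'; move: PK' PL'; rewrite /= !mem_enum => PK' PL'.
by split.
Qed.

(** Each [u] in [Z] is the constant value of an affine function on a segment of [Omega] joining the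
    two unions. The segment crosses an interface, so [u] is in the image of that interface, and the
    images have total length O(perimeter). *)
Lemma projection_bound P (a1 a2 a3 c : R) (Z : set R) :
  `|a1| <= c -> `|a2| <= c ->
  measurable (Z : set mR) ->
  (forall u, Z u -> exists z w, [/\ cells_in P z, cells_in (predC P) w,
     (forall t, 0 <= t <= 1 -> Omega (line_point z w t)) &
     forall t, 0 <= t <= 1 ->
       a1 * (line_point z w t).1 + a2 * (line_point z w t).2 + a3 = u]) ->
  (mu Z <= (2 * c * perimeter P)%:E)%E.
Proof.
move=> a1c a2c mZ Zu.
pose g z := a1 * z.1 + a2 * z.2 + a3.
pose cut K L : set (R * R) := closure (cell K) `&` closure (cell L).
pose crossed s := if sides s is Some (K, L) then P K != P L else false.
pose ga s := g (endpoints s).1; pose gb s := g (endpoints s).2.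
(* Left summands are contacts of zero length, which contribute a single value and no measure; right
   summands are edges, whose image lies between the values at the end points. *)
pose F (i : (cells M * cells M) + edges M) : set R := match i with
  | inl (K, L) => if pselect (exists x, cut K L x) is left e
                  then [set g (projT1 (cid e))] else set0
  | inr s => `[Num.min (ga s) (gb s), Num.max (ga s) (gb s)]%classic
  end.
pose Q (i : (cells M * cells M) + edges M) : bool := match i with
  | inl (K, L) => (K != L) && `[< hausdorff1 (cut K L) = 0%E >]
  | inr s => crossed s
  end.
have mF i : Q i -> measurable (F i : set mR).
  move=> _; case: i => [[K L]|s]; last exact: measurable_itv.
  by rewrite /F; case: pselect => ?; [exact: measurable_set1|exact: measurable0].
have ZF : Z `<=` \bigcup_(i in [set i | Q i]) F i.
  move=> u /Zu[z [w [Pz Pw zwO gu]]].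
  have [t t01 [K [L [PK PL KLt]]]] := crossing Pz Pw zwO.
  have KL : K != L by apply: contraNneq PL => <-.
  have [H0|[s sKL]] := cell_meet KL.
    exists (inl (K, L)) => //=; first by rewrite KL; apply/asboolP.
    case: pselect => [e|[]]; last by exists (line_point z w t).
    case: (cid e) => y cy /=; rewrite -(gu t t01) -/(g _); congr g.
    apply: (@hausdorff1_eq0 R (cut K L)) => //.
    move=> x x' r [Kx Lx] [Kx' Lx'] r01.
    by split; apply: convex2_closure => //; exact: cell_convex2.
  exists (inr s) => /=.
    by rewrite /crossed; have [->|->] := separates_sides sKL; rewrite PK (negbTE PL).
  have : closure (edge s) (line_point z w t) by case: sKL => _ _ _ <-.
  have cI : closed (g @^-1` F (inr s)).
    apply: closed_comp; last exact: interval_closed.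
    by move=> x _; exact: continuous_affine2.
  rewrite -(gu t t01) -/(g _).
  suff : closure (edge s) `<=` g @^-1` F (inr s) by apply.
  move/closure_id: cI => ->.
  apply: closure_subset => _ [r /andP[r0 r1] <-].
  rewrite /= in_itv /= ge_min le_max.
  have -> : g (line_point (endpoints s).1 (endpoints s).2 r) =
      (1 - r) * ga s + r * gb s by rewrite /ga /gb /g /line_point /=; ring.
  by have [ab|ab] := leP (ga s) (gb s); apply/andP; split; apply/orP; [left|right|right|left]; nra.
apply: (le_trans (measure_le_bigsetU mZ mF ZF)).
rewrite big_sumType /= big1 ?add0e; last first.
  move=> [K L] _; case: pselect => e; last by rewrite measure0.
  by rewrite lebesgue_measure_set1.
apply: (@le_trans _ _ (\sum_(s | crossed s) (2 * c * edge_length s)%:E)%E).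
  apply: lee_sum => s _; rewrite lebesgue_measure_itv /= lte_fin.
  (* Each coordinate difference is at most the length of the edge; the two coordinates give the
     factor 2. *)
  have gab : `|ga s - gb s| <= 2 * c * edge_length s.
    have -> : ga s - gb s = a1 * ((endpoints s).1.1 - (endpoints s).2.1)
        + a2 * ((endpoints s).1.2 - (endpoints s).2.2) by rewrite /ga /gb /g; ring.
    apply: (le_trans (ler_normD _ _)); rewrite !normrM.
    rewrite -mulrA [leRHS](_ : _ = c * edge_length s + c * edge_length s); last by ring.
    by apply: lerD; apply: ler_pM => //; [exact: edist_ge_fst|exact: edist_ge_snd].
  case: ifPn => _; last by rewrite lee_fin (le_trans _ gab).
  rewrite -EFinD lee_fin; apply: le_trans gab.
  by have [ab|ab] := leP (ga s) (gb s); [rewrite distrC|]; exact: ler_norm.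
rewrite sumEFin lee_fin /perimeter mulr_sumr [leLHS]big_mkcond /=.
apply: ler_sum => s _; rewrite /crossed; case: (sides s) => [[K L]|]; last by rewrite mulr0.
by case: ifP; rewrite ?mulr0.
Qed.

End mesh_geometry.

(** * Transfer of the isoperimetric inequality to parallelograms *)

Section isoperimetric.
Variable R : realType.
Local Notation mu := (@lebesgue_measure R).
Local Notation mR := (measurableTypeR R).
Local Notation mR2 := (measurableTypeR R * measurableTypeR R)%type.
Implicit Types (Omega G : set (R * R)) (x p q : R * R).

(** The mesh is one of [Omega], not of [G], and it is quantified after the constant; the perimeter
    also counts edges outside [G]. *)
Definition isoperimetric Omega G := exists2 C : R, 0 <= C &
  forall (M : mesh Omega) (P : pred (cells M)),
    Num.min (ar (cells_in P `&` G)) (ar (cells_in (predC P) `&` G))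
      <= C * perimeter P ^+ 2.

Definition parallelogram x p q := [set aff x p q z | z in @unit_square R].

Definition aff_inv x p q (z : R * R) : R * R :=
  (((z.1 - x.1) * q.2 - (z.2 - x.2) * q.1) / cross p q,
   (p.1 * (z.2 - x.2) - p.2 * (z.1 - x.1)) / cross p q).

Lemma affK x p q : cross p q != 0 -> cancel (aff x p q) (aff_inv x p q).
Proof.
move=> pq z; rewrite [RHS](surjective_pairing z) /aff_inv /aff /=.
by move: pq; rewrite /cross => pq; congr pair; field.
Qed.

Lemma aff_invK x p q : cross p q != 0 -> cancel (aff_inv x p q) (aff x p q).
Proof.
move=> pq z; rewrite [RHS](surjective_pairing z) /aff_inv /aff /=.
by move: pq; rewrite /cross => pq; congr pair; field.
Qed.

Lemma parallelogramE x p q : cross p q != 0 ->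
  parallelogram x p q = aff_inv x p q @^-1` (@unit_square R).
Proof.
move=> pq; apply/seteqP; split => [_ [z Sz <-]|z Sz] /=; first by rewrite affK.
by exists (aff_inv x p q z) => //; rewrite aff_invK.
Qed.

Lemma open_unit_square : open (@unit_square R).
Proof.
rewrite unit_squareE; have -> : `]0, 1[%classic `*` `]0, 1[%classic =
  (fst @^-1` `]0, 1[%classic) `&` (snd @^-1` `]0, 1[%classic) :> set (R * R) by [].
by apply: openI; apply: open_comp; try exact: interval_open;
  move=> z _; [exact: cvg_fst|exact: cvg_snd].
Qed.

Lemma open_parallelogram x p q : cross p q != 0 -> open (parallelogram x p q).
Proof.
move=> pq; rewrite parallelogramE//; apply: open_comp; last exact: open_unit_square.
move=> z _; rewrite (_ : aff_inv x p q = fun z =>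
  (q.2 / cross p q * z.1 + - (q.1 / cross p q) * z.2
     + (q.1 * x.2 - q.2 * x.1) / cross p q,
   - (p.2 / cross p q) * z.1 + p.1 / cross p q * z.2
     + (p.2 * x.1 - p.1 * x.2) / cross p q)).
  by apply: continuous_pair; exact: continuous_affine2.
by apply/funext => y; rewrite /aff_inv; move: pq; rewrite /cross => pq; congr pair; field.
Qed.

Lemma convex_combination_itv (a b t : R) : 0 < a < 1 -> 0 < b < 1 -> 0 <= t <= 1 ->
  0 < (1 - t) * a + t * b < 1.
Proof.
move=> /andP[a0 a1] /andP[b0 b1] /andP[t0 t1].
have h1 : 0 <= (1 - t) * a by rewrite mulr_ge0; lra.
have h2 : 0 <= t * b by rewrite mulr_ge0; lra.
have h3 : 0 <= (1 - t) * (1 - a) by rewrite mulr_ge0; lra.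
have h4 : 0 <= t * (1 - b) by rewrite mulr_ge0; lra.
have [t2|t2] := leP t (1/2).
- have h5 : 0 <= (1/2 - t) * a by rewrite mulr_ge0; lra.
  have h6 : 0 <= (1/2 - t) * (1 - a) by rewrite mulr_ge0; lra.
  by apply/andP; split; lra.
- have h5 : 0 <= (t - 1/2) * b by rewrite mulr_ge0; lra.
  have h6 : 0 <= (t - 1/2) * (1 - b) by rewrite mulr_ge0; lra.
  by apply/andP; split; lra.
Qed.

(** Everything is pulled back to the unit square. Its coordinates are the components of [aff_inv],
    affine functions whose coefficients are bounded by [c], so both common shadows have measure at
    most [2 * c * perimeter P]. *)
Lemma parallelogram_isoperimetric Omega x p q : cross p q != 0 ->
  parallelogram x p q `<=` Omega -> isoperimetric Omega (parallelogram x p q).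
Proof.
move=> pq QO; pose c := (`|p.1| + `|p.2| + `|q.1| + `|q.2|) / `|cross p q|.
have pq0 : 0 < `|cross p q| by rewrite normr_gt0.
exists (`|cross p q| * (2 * c) ^+ 2); first by rewrite mulr_ge0// sqr_ge0.
move=> M P; set Q := parallelogram x p q.
have oQ : open Q by exact: open_parallelogram.
have QS w : unit_square w -> Omega (aff x p q w) by move=> Sw; apply: QO; exists w.
have arQ P' : ar (cells_in P' `&` Q) = `|cross p q| *
    ar (aff x p q @^-1` (@cells_in _ _ M P') `&` @unit_square R).
  rewrite {1}/ar (@area_aff _ x p q _ pq); last first.
    by apply: open_measurable2; apply: openI => //; exact: open_cells_in.
  rewrite preimage_setI (_ : aff x p q @^-1` Q = @unit_square R).
    rewrite arE//; apply: (bounded_areaW (@bounded_area_square R)) => //.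
    apply: measurableI; last by apply: open_measurable2; exact: open_unit_square.
    by apply: measurable_preimage_aff; apply: open_measurable2; exact: open_cells_in.
  by apply/seteqP; split => z /=; rewrite /Q parallelogramE//= affK.
have oA (P' : pred (cells M)) : open (aff x p q @^-1` (cells_in P') `&` @unit_square R).
  apply: openI; last exact: open_unit_square.
  by apply: open_comp; [move=> z _; exact: continuous_aff|exact: open_cells_in].
have cx a : (`|a| <= `|p.1| + `|p.2| + `|q.1| + `|q.2|) -> `|a / cross p q| <= c.
  by move=> ac; rewrite normrM normfV ler_pM2r ?invr_gt0.
have n1 := normr_ge0 p.1; have n2 := normr_ge0 p.2.
have n3 := normr_ge0 q.1; have n4 := normr_ge0 q.2.
rewrite !arQ -minr_pMr ?normr_ge0// -mulrA ler_pM2l// -exprMn.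
have lineE (z w : R * R) t : line_point (aff x p q z) (aff x p q w) t =
    aff x p q (line_point z w t) by rewrite /line_point /aff /=; congr pair; ring.
have SO (z w : R * R) t : unit_square z -> unit_square w -> 0 <= t <= 1 ->
    unit_square (line_point z w t).
  by move=> [z1 z2] [w1 w2] t01; split; exact: convex_combination_itv.
have [mL L0] := mesh_lines_null M.
apply: (square_isoperimetric (oA P) (oA (predC P))
  (N := aff x p q @^-1` @mesh_lines _ _ M)).
- by move=> z [].
- by move=> z [].
- exact: measurable_preimage_aff.
- apply/eqP; have := area_aff x pq mL; rewrite L0 => /esym/eqP.
  by rewrite mule_eq0 eqe normr_eq0 (negbTE pq).
- move=> z Sz; have /subset_closure /(@closure_cells_lines _ _ M) := QS _ Sz.
  move=> [[K _ Kz]|Lz]; last by right.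
  by left; have [PK|PK] := boolP (P K); [left|right]; split => //; exists K.
- apply: (@projection_bound _ _ M P (q.2 / cross p q) (- q.1 / cross p q)
    ((q.1 * x.2 - q.2 * x.1) / cross p q)).
  + by apply: cx; lra.
  + by apply: cx; rewrite normrN; lra.
  + by apply: measurableI; exact: open_fst.
  + move=> u [[z [Pz Sz] <-] [w [Pw Sw] wz]].
    exists (aff x p q z), (aff x p q w); split => // t t01; rewrite lineE.
      by apply: QS; exact: SO.
    rewrite -[RHS](_ : (line_point z w t).1 = _); last by rewrite /line_point /= wz; ring.
    by rewrite /aff /line_point /=; move: pq; rewrite /cross => pq; field.
- apply: (@projection_bound _ _ M P (- p.2 / cross p q) (p.1 / cross p q)
    ((p.2 * x.1 - p.1 * x.2) / cross p q)).
  + by apply: cx; rewrite normrN; lra.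
  + by apply: cx; lra.
  + by apply: measurableI; exact: open_snd.
  + move=> u [[z [Pz Sz] <-] [w [Pw Sw] wz]].
    exists (aff x p q z), (aff x p q w); split => // t t01; rewrite lineE.
      by apply: QS; exact: SO.
    rewrite -[RHS](_ : (line_point z w t).2 = _); last by rewrite /line_point /= wz; ring.
    by rewrite /aff /line_point /=; move: pq; rewrite /cross => pq; field.
Qed.

End isoperimetric.

(** * Covering a polygonal domain by parallelograms *)

Lemma mem_consr (T : eqType) (x y : T) (s : seq T) : y \in s -> y \in x :: s.
Proof. by move=> ys; rewrite inE ys orbT. Qed.

Section triangles.
Variable R : realType.
Local Notation mR2 := (measurableTypeR R * measurableTypeR R)%type.
Implicit Types (E N : set (R * R)) (a b c d e x y z : R * R).
Implicit Types (Q : set (R * R) -> Prop).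

Definition null E := measurable (E : set mR2) /\ area E = 0%E.

Lemma null0 : null set0.
Proof. by split => //; rewrite /area measure0. Qed.

Lemma nullU E N : null E -> null N -> null (E `|` N).
Proof.
move=> [mE E0] [mN N0]; split; first exact: measurableU.
apply/eqP; rewrite eq_le area_ge0 andbT -[leRHS]adde0 -{1}E0 -{1}N0.
by rewrite /area; exact: measureU2.
Qed.

Lemma null_line a b : a != b -> null [set z | side a b z = 0].
Proof.
by move=> ab; split; [apply: closed_measurable2; exact: closed_side|exact: area_line].
Qed.

Definition bary a b c (u v w : R) : R * R :=
  (u * a.1 + v * b.1 + w * c.1, u * a.2 + v * b.2 + w * c.2).

Definition tri a b c : set (R * R) := [set z | exists u v w : R,
  [/\ 0 < u, 0 < v, 0 < w, u + v + w = 1 & z = bary a b c u v w]].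

Lemma triC a b c : tri a b c = tri b a c.
Proof.
by apply/seteqP; split => z [u [v [w [u0 v0 w0 uvw ->]]]]; exists v, u, w;
  split; rewrite // 1?addrC -?uvw /bary; try congr pair; ring.
Qed.

Lemma tri_rot a b c : tri a b c = tri b c a.
Proof.
apply/seteqP; split => z [u [v [w [u0 v0 w0 uvw ->]]]].
- by exists v, w, u; split; rewrite // -?uvw /bary; try congr pair; ring.
- by exists w, u, v; split; rewrite // -?uvw /bary; try congr pair; ring.
Qed.

Lemma side_bary e f a b c (u v w : R) : u + v + w = 1 ->
  side e f (bary a b c u v w) = u * side e f a + v * side e f b + w * side e f c.
Proof.
move=> uvw; have -> : u = 1 - v - w by rewrite -uvw; ring.
by rewrite /side /bary /=; ring.
Qed.

Lemma side_rot a b c : side a b c = side b c a.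
Proof. by rewrite /side; ring. Qed.

(** Overlaps are allowed and a null set may be missed: only a covering from inside is wanted. *)
Definition tiled Q E := exists2 s : seq ((R * R) * (R * R) * (R * R)),
  (forall T, T \in s -> [/\ side T.1.1 T.1.2 T.2 != 0, tri T.1.1 T.1.2 T.2 `<=` E &
     Q (tri T.1.1 T.1.2 T.2)]) &
  exists2 N, null N & forall z, E z -> N z \/
     exists2 T, T \in s & tri T.1.1 T.1.2 T.2 z.

Lemma tiled_tri Q a b c : side a b c != 0 -> Q (tri a b c) -> tiled Q (tri a b c).
Proof.
move=> abc Qabc; exists [:: (a, b, c)]; first by move=> T; rewrite inE => /eqP ->; split.
exists set0; first exact: null0.
by move=> z abcz; right; exists (a, b, c) => //; exact: mem_head.
Qed.

Lemma tiledU Q E E1 E2 N : E1 `<=` E -> E2 `<=` E -> null N ->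
  E `<=` E1 `|` E2 `|` N -> tiled Q E1 -> tiled Q E2 -> tiled Q E.
Proof.
move=> E1E E2E N0 EN [s1 s1E [N1 N10 E1s]] [s2 s2E [N2 N20 E2s]].
exists (s1 ++ s2).
  by move=> T; rewrite mem_cat => /orP[/s1E|/s2E] [? TE ?]; split => //;
    apply: subset_trans TE _.
exists (N `|` (N1 `|` N2)); first exact: nullU N0 (nullU N10 N20).
move=> z /EN[[|]|Nz]; last by left; left.
- move=> /E1s[?|[T Ts Tz]]; first by left; right; left.
  by right; exists T => //; rewrite mem_cat Ts.
- move=> /E2s[?|[T Ts Tz]]; first by left; right; right.
  by right; exists T => //; rewrite mem_cat Ts orbT.
Qed.

Lemma tiled_trans Q Q' E : tiled Q E ->
  (forall a b c, side a b c != 0 -> Q (tri a b c) -> tiled Q' (tri a b c)) ->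
  tiled Q' E.
Proof.
move=> [s sE [N N0 Es]] H.
have : exists2 s' : seq ((R * R) * (R * R) * (R * R)), (forall T, T \in s' ->
     [/\ side T.1.1 T.1.2 T.2 != 0, tri T.1.1 T.1.2 T.2 `<=` E &
       Q' (tri T.1.1 T.1.2 T.2)]) &
    exists2 N, null N & forall z, (exists2 T, T \in s & tri T.1.1 T.1.2 T.2 z) -> N z \/
     exists2 T, T \in s' & tri T.1.1 T.1.2 T.2 z; last first.
  move=> [s' s'E [N' N'0 Es']].
  exists s' => //; exists (N `|` N'); first exact: nullU.
  move=> z /Es[?|/Es'[?|?]]; [by left; left|by left; right|by right].
elim: s sE {Es} => [_|T s IH sE].
  by exists [::] => //; exists set0; [exact: null0|move=> z []].
have [s' s'E [N' N'0 Es']] := IH (fun T' T's => sE T' (mem_consr _ T's)).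
have [T0 TE QT] := sE T (mem_head _ _).
have [s1 s1E [N1 N10 E1s]] := H _ _ _ T0 QT.
exists (s1 ++ s').
  move=> T'; rewrite mem_cat => /orP[/s1E[? T'T ?]|/s'E//].
  by split => //; exact: subset_trans T'T TE.
exists (N1 `|` N'); first exact: nullU.
move=> z [T']; rewrite inE => /orP[/eqP ->|T's] T'z.
  have [?|[T2 T2s ?]] := E1s _ T'z; first by left; left.
  by right; exists T2 => //; rewrite mem_cat T2s.
have [|?|[T2 T2s ?]] := Es' z; [by exists T'|by left; right|].
by right; exists T2 => //; rewrite mem_cat T2s orbT.
Qed.

Lemma tiled_bisect Q a b c (t : R) : 0 < t < 1 -> side a b c != 0 ->
  tiled Q (tri a (line_point a b t) c) -> tiled Q (tri (line_point a b t) b c) ->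
  tiled Q (tri a b c).
Proof.
move=> /andP[t0 t1] abc; set d := line_point a b t.
have t'0 : 1 - t != 0 by lra.
have tn0 : t != 0 by lra.
have dc : d != c.
  apply: contraNneq abc => <-; apply/eqP; rewrite /d /side /line_point /=; ring.
apply: (@tiledU _ _ _ _ [set z | side d c z = 0]).
- move=> _ [u [v [w [u0 v0 w0 uvw ->]]]]; exists (u + v * (1 - t)), (v * t), w.
  split => //; [by rewrite addr_gt0// mulr_gt0//; lra|by rewrite mulr_gt0| |].
    by rewrite -[RHS]uvw; ring.
  by rewrite /d /bary /line_point /=; congr pair; ring.
- move=> _ [u [v [w [u0 v0 w0 uvw ->]]]]; exists (u * (1 - t)), (u * t + v), w.
  split => //; [by rewrite mulr_gt0//; lra|by rewrite addr_gt0// mulr_gt0| |].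
    by rewrite -[RHS]uvw; ring.
  by rewrite /d /bary /line_point /=; congr pair; ring.
- exact: null_line.
- move=> z [u [v [w [u0 v0 w0 uvw ->]]]].
  (* The sign of [u * t - v * (1 - t)] tells the side of the cut [d c]; equality means being on
     it. *)
  have [uv|uv|uv] := ltgtP (v * (1 - t)) (u * t).
  + left; left; exists (u - v * (1 - t) / t), (v / t), w; split => //.
    * by rewrite subr_gt0 ltr_pdivrMr.
    * by rewrite divr_gt0.
    * by rewrite -[RHS]uvw; field.
    * by rewrite /d /bary /line_point /=; congr pair; field.
  + left; right; exists (u / (1 - t)), (v - u * t / (1 - t)), w; split => //.
    * by rewrite divr_gt0//; lra.
    * by rewrite subr_gt0 ltr_pdivrMr//; lra.
    * by rewrite -[RHS]uvw; field.
    * by rewrite /d /bary /line_point /=; congr pair; field.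
  + right => /=; rewrite side_bary//.
    have -> : side d c a = t * side a b c by rewrite /d /side /line_point /=; ring.
    have -> : side d c b = - (1 - t) * side a b c by rewrite /d /side /line_point /=; ring.
    have -> : side d c c = 0 by rewrite /side; ring.
    have -> : u * (t * side a b c) + v * (- (1 - t) * side a b c) + w * 0 =
      (u * t - v * (1 - t)) * side a b c by ring.
    by rewrite uv subrr mul0r.
Qed.

Section cut.
Variables e f : R * R.
Hypothesis ef : e != f.
Local Notation l := (side e f).
Local Notation avoid := (fun E => forall z, E z -> l z != 0).

(** A zero of [l] inside gives [u * l a + v * l b + w * l c = 0]. Multiplied by [l a], all terms are
    nonnegative, so [l a = 0]; likewise for the others, and the vertices would be aligned. *)
Lemma tri_avoid a b c : side a b c != 0 -> 0 <= l a * l b -> 0 <= l b * l c ->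
  0 <= l a * l c -> tiled avoid (tri a b c).
Proof.
move=> abc lab lbc lac; apply: tiled_tri => // _ [u [v [w [u0 v0 w0 uvw ->]]]].
rewrite side_bary//; apply/eqP => l0.
have la2 : 0 <= l a * l a by rewrite -expr2 sqr_ge0.
have lb2 : 0 <= l b * l b by rewrite -expr2 sqr_ge0.
have lc2 : 0 <= l c * l c by rewrite -expr2 sqr_ge0.
have pz (r s : R) : 0 < r -> 0 <= s -> 0 <= r * s by move=> *; rewrite mulr_ge0// ltW.
have la0 : l a = 0.
  apply/eqP; rewrite -sqrf_eq0 expr2 -(mulrI_eq0 _ (lregP (lt0r_neq0 u0))).
  have := congr1 (fun r => r * l a) l0; have := pz _ _ u0 la2.
  have := pz _ _ v0 lab; have := pz _ _ w0 lac => h1 h2 h3 h4; apply/eqP; lra.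
have lb0 : l b = 0.
  apply/eqP; rewrite -sqrf_eq0 expr2 -(mulrI_eq0 _ (lregP (lt0r_neq0 v0))).
  have := congr1 (fun r => r * l b) l0; have := pz _ _ u0 lab.
  have := pz _ _ v0 lb2; have := pz _ _ w0 lbc => h1 h2 h3 h4; apply/eqP; lra.
have lc0 : l c = 0.
  apply/eqP; rewrite -sqrf_eq0 expr2 -(mulrI_eq0 _ (lregP (lt0r_neq0 w0))).
  have := congr1 (fun r => r * l c) l0; have := pz _ _ u0 lac.
  have := pz _ _ v0 lbc; have := pz _ _ w0 lc2 => h1 h2 h3 h4; apply/eqP; lra.
move/eqP: abc; apply.
have [ra ->] := side_eq0 ef la0; have [rb ->] := side_eq0 ef lb0.
have [rc ->] := side_eq0 ef lc0.
by rewrite /side /line_point /=; ring.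
Qed.

Lemma cut_point a b : l a * l b < 0 ->
  exists2 t, 0 < t < 1 & l (line_point a b t) = 0.
Proof.
move=> lab; have n0 : l a - l b != 0.
  by apply: contraTneq lab => /subr0_eq ->; rewrite -leNgt -expr2 sqr_ge0.
exists (l a / (l a - l b)); last by rewrite side_line_point; field.
have [la|la] := ltP 0 (l a).
- have lb : l b < 0 by rewrite -(pmulr_rlt0 _ la).
  by rewrite divr_gt0 ?ltr_pdivrMr//; lra.
- have la' : l a < 0.
    by rewrite lt_neqAle la andbT; apply: contraTneq lab => ->; rewrite mul0r ltxx.
  have lb : 0 < l b by rewrite -(nmulr_rlt0 _ la').
  by rewrite -mulrNN -invrN divr_gt0 ?ltr_pdivrMr//; lra.
Qed.

Lemma side_cut1 a b c t : side a (line_point a b t) c = t * side a b c.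
Proof. by rewrite /side /line_point /=; ring. Qed.

Lemma side_cut2 a b c t : side (line_point a b t) b c = (1 - t) * side a b c.
Proof. by rewrite /side /line_point /=; ring. Qed.

Lemma cut_tri_vertex a b c : side a b c != 0 -> l c = 0 -> tiled avoid (tri a b c).
Proof.
move=> abc lc; have [lab|lab] := leP 0 (l a * l b).
  by apply: tri_avoid => //; rewrite lc mulr0.
have [t t01 lt0] := cut_point lab; have tt := t01; move/andP: tt => [t0 t1].
apply: (tiled_bisect t01) => //; apply: tri_avoid;
  rewrite ?side_cut1 ?side_cut2 ?mulf_neq0 ?lt0 ?lc ?mulr0 ?mul0r//; lra.
Qed.

(** Bisecting at the point where the line crosses the edge leaves two triangles with a vertex on the
    line. *)
Lemma cut_tri_edge a b c : side a b c != 0 -> l a * l b < 0 -> tiled avoid (tri a b c).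
Proof.
move=> abc lab; have [t t01 lt0] := cut_point lab.
have tt := t01; move/andP: tt => [t0 t1].
apply: (tiled_bisect t01) => //.
- rewrite triC tri_rot; apply: cut_tri_vertex => //.
  have -> : side a c (line_point a b t) = - t * side a b c.
    by rewrite /side /line_point /=; ring.
  by rewrite mulf_neq0//; lra.
- rewrite tri_rot; apply: cut_tri_vertex => //.
  by rewrite -side_rot side_cut2 mulf_neq0//; lra.
Qed.

Lemma cut_tri a b c : side a b c != 0 -> tiled avoid (tri a b c).
Proof.
move=> abc; have [lab|lab] := leP 0 (l a * l b); last exact: cut_tri_edge.
have [lbc|lbc] := leP 0 (l b * l c); last first.
  by rewrite tri_rot; apply: cut_tri_edge; rewrite // -side_rot.
have [lac|lac] := leP 0 (l a * l c); first exact: tri_avoid.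
by rewrite tri_rot tri_rot; apply: cut_tri_edge; [rewrite side_rot|rewrite mulrC].
Qed.

End cut.

Lemma tiled_avoid_lines (s : seq ((R * R) * (R * R))) a b c :
  (forall e : (R * R) * (R * R), e \in s -> e.1 != e.2) -> side a b c != 0 ->
  tiled (fun E => forall e : (R * R) * (R * R), e \in s -> forall z, E z -> side e.1 e.2 z != 0)
    (tri a b c).
Proof.
move=> s0 abc; elim: s s0 => [_|e s IH s0]; first by apply: tiled_tri.
have {}IH := IH (fun g gs => s0 g (mem_consr e gs)).
apply: (tiled_trans IH) => a' b' c' abc' Q.
have [s' s'E s'N] := cut_tri (s0 e (mem_head _ _)) abc'.
exists s' => // T Ts; have [T0 TE QT] := s'E T Ts; split => // g.
by rewrite inE => /orP[/eqP -> //|es z Tz]; apply: (Q _ es); exact: TE.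
Qed.

Lemma convex2_tri a b c : convex2 (tri a b c).
Proof.
move=> _ _ t [u [v [w [u0 v0 w0 uvw ->]]]] [u' [v' [w' [u'0 v'0 w'0 uvw' ->]]]] t01.
have pos (r r' : R) : 0 < r -> 0 < r' -> 0 < (1 - t) * r + t * r'.
  move=> r0 r'0; have /andP[t0 t1] := t01.
  have [t2|t2] := leP t (1/2).
  - by rewrite ltr_wpDr ?mulr_ge0 ?mulr_gt0//; lra.
  - by rewrite ltr_pwDr ?mulr_ge0 ?mulr_gt0//; lra.
exists ((1 - t) * u + t * u'), ((1 - t) * v + t * v'), ((1 - t) * w + t * w').
split; try exact: pos.
  transitivity ((1 - t) * (u + v + w) + t * (u' + v' + w')); first by ring.
  by rewrite uvw uvw'; ring.
by rewrite /line_point /bary /=; congr pair; ring.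
Qed.

(** The parallelogram spanned at a vertex by the half edges is where the two other barycentric
    coordinates are less than 1/2. At most one coordinate reaches 1/2, so the three parallelograms
    cover. *)
Lemma tri_parallelograms a b c : side a b c != 0 ->
  exists2 s : seq ((R * R) * (R * R) * (R * R)),
    (forall T, T \in s -> cross T.1.2 T.2 != 0 /\
       parallelogram T.1.1 T.1.2 T.2 `<=` tri a b c) &
    forall z, tri a b c z -> exists2 T, T \in s & parallelogram T.1.1 T.1.2 T.2 z.
Proof.
move=> abc.
pose h (x y : R * R) : R * R := ((y.1 - x.1) / 2, (y.2 - x.2) / 2).
have hcross x y z : cross (h x y) (h x z) = side x y z / 4.
  by rewrite /cross /h /side /=; field.
have hsub x y z : parallelogram x (h x y) (h x z) `<=` tri x y z.
  move=> _ [[u v] [/= /andP[u0 u1] /andP[v0 v1]] <-].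
  exists (1 - u / 2 - v / 2), (u / 2), (v / 2); split; [lra|lra|lra|lra|].
  by rewrite /aff /h /bary /=; congr pair; field.
have hin x y z u v w : 0 < v -> 0 < w -> v < 1/2 -> w < 1/2 -> u + v + w = 1 ->
    parallelogram x (h x y) (h x z) (bary x y z u v w).
  move=> v0 w0 v1 w1 uvw; exists (2 * v, 2 * w); first by split => /=; lra.
  have -> : u = 1 - v - w by lra.
  by rewrite /aff /h /bary /=; congr pair; field.
exists [:: (a, h a b, h a c); (b, h b c, h b a); (c, h c a, h c b)].
  move=> T; rewrite !inE => /orP[|/orP[]] /eqP -> /=; rewrite hcross.
  - by split; [rewrite mulf_neq0 ?invr_neq0|exact: hsub].
  - by rewrite -side_rot tri_rot; split; [rewrite mulf_neq0 ?invr_neq0|exact: hsub].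
  - by rewrite -side_rot -side_rot tri_rot tri_rot;
      split; [rewrite mulf_neq0 ?invr_neq0|exact: hsub].
move=> z [u [v [w [u0 v0 w0 uvw ->]]]].
have [v1|v1] := ltP v (1/2); last first.
  exists (b, h b c, h b a); first by rewrite !inE eqxx orbT.
  rewrite (_ : bary a b c u v w = bary b c a v w u); first by apply: hin; lra.
  by rewrite /bary; congr pair; ring.
have [w1|w1] := ltP w (1/2); last first.
  exists (c, h c a, h c b); first by rewrite !inE eqxx !orbT.
  rewrite (_ : bary a b c u v w = bary c a b w u v); first by apply: hin; lra.
  by rewrite /bary; congr pair; ring.
by exists (a, h a b, h a c); [rewrite !inE eqxx|apply: hin].
Qed.

End triangles.

(** * Isoperimetric inequality on the domain *)

Section global_isoperimetric.
Variables (R : realType) (Omega : set (R * R)).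
Hypotheses (oO : open Omega) (bO : bounded_area Omega).
Local Notation mR2 := (measurableTypeR R * measurableTypeR R)%type.
Implicit Types (G : set (R * R)).

Let bG G : open G -> G `<=` Omega -> bounded_area G.
Proof.
by move=> oG GO; apply: (bounded_areaW bO) => //; exact: open_measurable2.
Qed.

(** If the same side is the small one in [G1] and in [G2], the bounds add up. Otherwise the overlap,
    of area [k > 0], is covered by the two small parts; then [k <= (C1 + C2) * p], and the trivial
    bound [ar G1 + ar G2 = D * k] is good enough. *)
Lemma isoperimetricU G1 G2 : open G1 -> open G2 -> G1 `<=` Omega -> G2 `<=` Omega ->
  G1 `&` G2 !=set0 -> isoperimetric Omega G1 -> isoperimetric Omega G2 ->
  isoperimetric Omega (G1 `|` G2).
Proof.
move=> o1 o2 G1O G2O G12 [C1 C10 H1] [C2 C20 H2].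
have o12 : open (G1 `&` G2) by exact: openI.
have b12 : bounded_area (G1 `&` G2) by apply: bG => // z [/G1O].
pose k := ar (G1 `&` G2).
have k0 : 0 < k by rewrite -lte_fin -arE//; exact: area_gt0.
have CC : 0 <= C1 + C2 by exact: addr_ge0.
have D0 : 0 <= (ar G1 + ar G2) / k by rewrite divr_ge0 ?addr_ge0 ?ar_ge0// ltW.
set D := (ar G1 + ar G2) / k in D0.
have Dk : D * k = ar G1 + ar G2 by rewrite divfK ?gt_eqF.
exists ((C1 + C2) * (1 + D)); first by rewrite mulr_ge0// addr_ge0.
move=> M P; set p := perimeter P ^+ 2.
have p0 : 0 <= p by exact: sqr_ge0.
have Cp0 : 0 <= (C1 + C2) * p by exact: mulr_ge0.
have mP P' G : open G -> measurable (@cells_in _ _ M P' `&` G : set mR2).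
  by move=> oG; apply: open_measurable2; apply: openI => //; exact: open_cells_in.
have arU P' : ar (cells_in P' `&` (G1 `|` G2)) <=
    ar (cells_in P' `&` G1) + ar (@cells_in _ _ M P' `&` G2).
  rewrite setIUr; apply: ar_U.
    by apply: (bounded_areaW (bG o1 G1O)); [exact: mP|move=> z []].
  by apply: (bounded_areaW (bG o2 G2O)); [exact: mP|move=> z []].
have arG P' G : open G -> G `<=` Omega -> ar (@cells_in _ _ M P' `&` G) <= ar G.
  by move=> oG GO; apply: ar_le; [exact: bG|exact: mP|move=> z []].
have mixed P' : k <= ar (cells_in P' `&` G1) + ar (@cells_in _ _ M (predC P') `&` G2).
  have [mL L0] := mesh_lines_null M.
  have bU : bounded_area (cells_in P' `&` G1 `|` @cells_in _ _ M (predC P') `&` G2).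
    apply: bounded_areaU.
      by apply: (bounded_areaW (bG o1 G1O)); [exact: mP|move=> z []].
    by apply: (bounded_areaW (bG o2 G2O)); [exact: mP|move=> z []].
  apply: (@le_trans _ _ (ar (cells_in P' `&` G1 `|` cells_in (predC P') `&` G2))).
    apply: (ar_le_null bU _ mL L0); first exact: open_measurable2.
    move=> z [G1z G2z].
    have /(@closure_cells_lines _ _ M) [[K _ Kz]|Lz] := subset_closure (G1O _ G1z).
      by left; have [PK|PK] := boolP (P' K); [left|right]; split => //; exists K.
    by right.
  apply: ar_U.
    by apply: (bounded_areaW (bG o1 G1O)); [exact: mP|move=> z []].
  by apply: (bounded_areaW (bG o2 G2O)); [exact: mP|move=> z []].
have DCp : 0 <= D * ((C1 + C2) * p) by exact: mulr_ge0.
have KE : (C1 + C2) * (1 + D) * p = (C1 + C2) * p + D * ((C1 + C2) * p) by ring.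
have big P' : k <= (C1 + C2) * p ->
    ar (@cells_in _ _ M P' `&` (G1 `|` G2)) <= (C1 + C2) * (1 + D) * p.
  move=> kC; apply: (le_trans (arU P')).
  apply: (le_trans (lerD (arG P' _ o1 G1O) (arG P' _ o2 G2O))).
  rewrite -Dk KE; apply: (le_trans (ler_wpM2l D0 kC)).
  by rewrite lerDr.
have small P' : ar (@cells_in _ _ M P' `&` G1) <= C1 * p ->
    ar (@cells_in _ _ M P' `&` G2) <= C2 * p ->
    ar (@cells_in _ _ M P' `&` (G1 `|` G2)) <= (C1 + C2) * (1 + D) * p.
  move=> h1 h2; apply: (le_trans (arU P')); apply: (le_trans (lerD h1 h2)).
  by rewrite -mulrDl KE lerDl.
have kle (x y : R) : k <= x + y -> x <= C1 * p -> y <= C2 * p -> k <= (C1 + C2) * p.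
  by move=> kxy xC yC; apply: (le_trans kxy); rewrite mulrDl lerD.
have cellsN : cells_in (predC (predC P)) = cells_in P.
  by apply/seteqP; split => z [K PK Kz]; exists K => //; move: PK; rewrite /= negbK.
rewrite ge_min; apply/orP.
have := H2 M P; have := H1 M P; rewrite -/p 2!ge_min => /orP[h1|h1] /orP[h2|h2].
- by left; exact: small.
- by left; apply: big; exact: kle (mixed P) h1 h2.
- have := mixed (predC P); rewrite cellsN => km.
  by left; apply: big; exact: kle km h1 h2.
- by right; exact: small.
Qed.

Lemma open_box_isoperimetric x : Omega x -> exists G,
  [/\ open G, G `<=` Omega, G x & isoperimetric Omega G].
Proof.
move=> Ox; have [e e0 eO] := open_box oO Ox.
pose G := parallelogram (x.1 - e, x.2 - e) (2 * e, 0) (0, 2 * e).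
have c0 : cross (2 * e, 0) (0, 2 * e) != 0.
  by rewrite /cross /= mul0r subr0 mulf_neq0 ?mulf_neq0 ?pnatr_eq0 ?gt_eqF.
have GO : G `<=` Omega.
  move=> _ [[u v] [/= /andP[u0 u1] /andP[v0 v1]] <-]; apply: eO; rewrite /aff /=.
  - rewrite (_ : _ - _ = e * (1 - 2 * u)); last by ring.
    by rewrite normrM gtr0_norm// gtr_pMr// ltr_norml; lra.
  - rewrite (_ : _ - _ = e * (1 - 2 * v)); last by ring.
    by rewrite normrM gtr0_norm// gtr_pMr// ltr_norml; lra.
exists G; split => //; [exact: open_parallelogram| |exact: parallelogram_isoperimetric].
exists (1/2, 1/2); first by split => /=; lra.
by rewrite /aff /= [RHS](surjective_pairing x); congr pair; field.
Qed.

(** The points that can be joined to [x] by such a set form an open and relatively closed subset: a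
    small box around a point is isoperimetric and can be added to the set or not, uniformly over the
    box. *)
Lemma isoperimetric_connect : connected Omega -> forall x y, Omega x -> Omega y ->
  exists G, [/\ open G, G `<=` Omega, G x, G y & isoperimetric Omega G].
Proof.
move=> cO x y Ox Oy.
pose U := [set y | exists G, [/\ open G, G `<=` Omega, G x, G y & isoperimetric Omega G]].
have UO : U `<=` Omega by move=> z [G [_ GO _ Gz _]]; exact: GO.
suff UE : U = Omega by have : U y by rewrite UE.
have step z : Omega z -> exists G, [/\ open G, G z & forall w, G w -> U w <-> U z].
  move=> Oz; have [G [oG GO Gz iG]] := open_box_isoperimetric Oz.
  have link w w' : G w -> G w' -> U w -> U w'.
    move=> Gw Gw' [H [oH HO Hx Hw iH]]; exists (H `|` G); split.
    - exact: openU.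
    - by rewrite subUset.
    - by left.
    - by right.
    - by apply: isoperimetricU => //; exists w.
  by exists G; split => // w Gw; split; exact: link.
apply: cO.
- by exists x; have [G [oG GO Gx iG]] := open_box_isoperimetric Ox; exists G.
- exists U; last by rewrite setIidr.
  rewrite openE => z Uz; have [G [oG Gz GU]] := step z (UO _ Uz).
  apply: (filterS _ (open_nbhs_nbhs (conj oG Gz))) => w Gw; exact/(GU w Gw).
- exists (~` (Omega `\` U)); last first.
    apply/seteqP; split => z.
      by move=> Uz; split; [exact: UO|case].
    by move=> [Oz nOU]; apply: contrapT => nUz; apply: nOU.
  rewrite closedC openE => z [Oz nUz]; have [G [oG Gz GU]] := step z Oz.
  apply: (filterS _ (open_nbhs_nbhs (conj (openI oO oG) (conj Oz Gz)))).
  by move=> w [Ow Gw]; split => //; move/(GU w Gw).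
Qed.

(** The parallelograms need not overlap, so before each one is added, a connecting set is inserted
    to make the overlap nonempty. *)
Lemma isoperimetric_finite (s : seq ((R * R) * (R * R) * (R * R))) :
  connected Omega -> Omega !=set0 ->
  (forall T, T \in s -> cross T.1.2 T.2 != 0 /\
     parallelogram T.1.1 T.1.2 T.2 `<=` Omega) ->
  exists G, [/\ open G, G `<=` Omega, G !=set0, isoperimetric Omega G &
    forall T, T \in s -> parallelogram T.1.1 T.1.2 T.2 `<=` G].
Proof.
move=> cO [x0 Ox0]; elim: s => [_|T s IH sO].
  have [G [oG GO Gx iG]] := open_box_isoperimetric Ox0.
  by exists G; split => //; exists x0.
have [G [oG GO [x Gx] iG sG]] := IH (fun T' T's => sO T' (mem_consr T T's)).
have [T0 TO] := sO T (mem_head _ _).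
set Q := parallelogram T.1.1 T.1.2 T.2 in TO *.
have oQ : open Q by exact: open_parallelogram.
have iQ : isoperimetric Omega Q by exact: parallelogram_isoperimetric.
pose y := aff T.1.1 T.1.2 T.2 (1/2, 1/2).
have Qy : Q y by exists (1/2, 1/2) => //; split => /=; lra.
have [H [oH HO Hx Hy iH]] := isoperimetric_connect cO (GO _ Gx) (TO _ Qy).
have GHO : G `|` H `<=` Omega by rewrite subUset.
have iGH : isoperimetric Omega (G `|` H).
  by apply: isoperimetricU => //; exists x.
exists ((G `|` H) `|` Q); split.
- by apply: openU => //; exact: openU.
- by rewrite subUset.
- by exists x; left; left.
- apply: isoperimetricU => //; first exact: openU.
  by exists y; split => //; right.
- move=> T'; rewrite inE => /orP[/eqP -> z Qz|T's z T'z]; first by right.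
  by left; left; exact: sG T's _ T'z.
Qed.

Lemma polygonal_parallelograms (B : R) : polygonal Omega ->
  (forall z, Omega z -> `|z.1| < B /\ `|z.2| < B) ->
  exists s : seq ((R * R) * (R * R) * (R * R)),
    (forall T, T \in s -> cross T.1.2 T.2 != 0 /\
       parallelogram T.1.1 T.1.2 T.2 `<=` Omega) /\
    exists2 N, null N & forall z, Omega z -> N z \/
      exists2 T, T \in s & parallelogram T.1.1 T.1.2 T.2 z.
Proof.
move=> [ls [ls0 frO]] OB.
have [[x Ox]|nO] := pselect (Omega !=set0); last first.
  exists [::]; split => //; exists set0; first exact: null0.
  by move=> z Oz; exfalso; apply: nO; exists z.
have B0 : 0 < B by have [xB _] := OB x Ox; exact: le_lt_trans xB.
(* This right triangle contains the open square of half-side [B]: its hypotenuse passes through the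
   corner [(B, B)]. *)
have T0 : side (- B, - B) (3 * B, - B) (- B, 3 * B) != 0.
  rewrite /side /= (_ : _ - _ = 16 * (B * B)); last by ring.
  by rewrite !mulf_neq0 ?gt_eqF.
have [ts tsE [N N0 tsN]] := tiled_avoid_lines ls0 T0.
have inT z : Omega z -> tri (- B, - B) (3 * B, - B) (- B, 3 * B) z.
  move=> /OB[]; rewrite !ltr_norml => /andP[z1 z1'] /andP[z2 z2'].
  have B4 : 0 < (4 * B)^-1 by rewrite invr_gt0; lra.
  have Bn : B != 0 by rewrite gt_eqF.
  exists ((2 * B - z.1 - z.2) * (4 * B)^-1), ((z.1 + B) * (4 * B)^-1),
    ((z.2 + B) * (4 * B)^-1).
  split; try (by rewrite mulr_gt0//; lra); first by field.
  by rewrite [LHS](surjective_pairing z) /bary /=; congr pair; field.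
(* A segment of the tile that left [Omega] would meet the frontier, hence a boundary line, which the
   tile avoids. *)
have inside T z : T \in ts -> tri T.1.1 T.1.2 T.2 z -> Omega z ->
    tri T.1.1 T.1.2 T.2 `<=` Omega.
  move=> Tts Tz Oz w Tw; apply: contrapT => nOw.
  have [_ _ avoid] := tsE T Tts.
  have [|||||t t01 [cl ncl]] :=
    @segment_closed_meet R (closure Omega) (~` Omega) z w.
  - exact: closed_closure.
  - by rewrite closedC.
  - exact: subset_closure.
  - exact: nOw.
  - move=> t _; have [Ot|] := pselect (Omega (line_point z w t)); last by right.
    by left; exact: subset_closure.
  have : frontier Omega (line_point z w t) by split => // /interior_subset.
  rewrite frO => -[e els [r _ rE]].
  have := avoid e els _ (@convex2_tri R _ _ _ _ _ _ Tz Tw t01).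
  by rewrite -rE => /eqP; apply; rewrite /side /line_point /=; ring.
pose good (T : (R * R) * (R * R) * (R * R)) := `[< tri T.1.1 T.1.2 T.2 `<=` Omega >].
have cover (l : seq ((R * R) * (R * R) * (R * R))) : {subset l <= ts} ->
  exists2 s : seq ((R * R) * (R * R) * (R * R)),
    (forall T, T \in s -> cross T.1.2 T.2 != 0 /\
       parallelogram T.1.1 T.1.2 T.2 `<=` Omega) &
    forall T z, T \in l -> tri T.1.1 T.1.2 T.2 z -> Omega z ->
      exists2 T, T \in s & parallelogram T.1.1 T.1.2 T.2 z.
  elim: l => [_|T l IH lts]; first by exists [::].
  have [s sE ls1] := IH (fun T' T'l => lts T' (mem_consr T T'l)).
  have Tts := lts T (mem_head _ _).
  have [[z [Tz Oz]]|nTO] := pselect (exists z, tri T.1.1 T.1.2 T.2 z /\ Omega z); last first.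
    exists s => // T' z; rewrite inE => /orP[/eqP -> Tz Oz|]; last exact: ls1.
    by exfalso; apply: nTO; exists z.
  have TO := inside T z Tts Tz Oz.
  have [T00 _ _] := tsE T Tts.
  have [s1 s1E s1T] := tri_parallelograms T00.
  exists (s1 ++ s).
    move=> T'; rewrite mem_cat => /orP[/s1E[? T'T]|/sE//].
    by split => //; exact: subset_trans T'T TO.
  move=> T' y; rewrite inE => /orP[/eqP -> Ty Oy|T'l T'y Oy].
    by have [T2 T2s ?] := s1T _ Ty; exists T2 => //; rewrite mem_cat T2s.
  by have [T2 T2s ?] := ls1 T' y T'l T'y Oy; exists T2 => //; rewrite mem_cat T2s orbT.
have [s sE tss] := cover ts (fun _ => id).
exists s; split => //; exists N => // z Oz.
by have [?|[T Tts Tz]] := tsN z (inT z Oz); [left|right; exact: (tss _ _ Tts Tz Oz)].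
Qed.

Lemma cells_isoperimetric (B : R) : connected Omega -> Omega !=set0 -> polygonal Omega ->
  (forall z, Omega z -> `|z.1| < B /\ `|z.2| < B) ->
  exists2 C : R, 0 <= C & forall (M : mesh Omega) (P : pred (cells M)),
    Num.min (\sum_(K | P K) cell_area K) (\sum_(K | ~~ P K) cell_area K)
      <= C * perimeter P ^+ 2.
Proof.
move=> cO nO pO OB.
have [s [sO [N [mN N0] Os]]] := polygonal_parallelograms pO OB.
have [G [oG GO _ [C C0 iG] sG]] := isoperimetric_finite cO nO sO.
exists C => // M P; apply: le_trans (iG M P).
(* [G] fills [Omega] up to the null set [N], so cutting the cells by [G] loses no area. *)
have H (Q : pred (cells M)) : \sum_(K | Q K) cell_area K <= ar (cells_in Q `&` G).
  have bQG : bounded_area (cells_in Q `&` G).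
    apply: (bounded_areaW (bG oG GO)); last by move=> z [].
    by apply: open_measurable2; apply: openI => //; exact: open_cells_in.
  apply: (@le_trans _ _ (\sum_(K | Q K) ar (cell K `&` G))).
    apply: ler_sum => K _; apply: (@ar_le_null _ _ _ N _ _ mN N0).
    - apply: (bounded_areaW (bG oG GO)); last by move=> z [].
      by apply: open_measurable2; apply: openI => //; exact: cell_open.
    - by apply: open_measurable2; exact: cell_open.
    - move=> z Kz; have [?|[T Ts Tz]] := Os z (cell_sub Kz); first by right.
      by left; split => //; exact: sG Ts _ Tz.
  apply: ar_bigcup => //.
  - move=> K _; apply: open_measurable2; apply: openI => //; exact: cell_open.
  - by move=> K QK z [Kz Gz]; split => //; exists K.
  - by move=> K L _ _ KL; rewrite setIACA cell_disjoint// set0I.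
by rewrite le_min !ge_min; apply/andP; split; apply/orP; [left|right]; exact: H.
Qed.

End global_isoperimetric.

(** * Coarea formula and Sobolev inequalities *)

Section finite_sums.
Variables (R : realType) (I : finType).
Implicit Types (w u v f h : I -> R).

Lemma sum_cauchy_schwarz w u v : (forall i, 0 <= w i) ->
  (\sum_i w i * (u i * v i)) ^+ 2 <=
  (\sum_i w i * u i ^+ 2) * (\sum_i w i * v i ^+ 2).
Proof.
move=> w0; set A := \sum_i w i * u i ^+ 2; set B := \sum_i _; set C := \sum_i w i * v i ^+ 2.
have A0 : 0 <= A by apply: sumr_ge0 => i _; rewrite mulr_ge0 ?sqr_ge0.
have [A_eq0|An0] := eqVneq A 0.
  have B0 : B = 0.
    apply: big1 => i _; have : w i * u i ^+ 2 = 0.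
      apply: (psumr_eq0P _ A_eq0) => // j _; by rewrite mulr_ge0 ?sqr_ge0.
    by move=> /eqP; rewrite mulf_eq0 sqrf_eq0 => /orP[] /eqP ->; ring.
  by rewrite B0 A_eq0 mul0r expr0n.
have Agt0 : 0 < A by rewrite lt_neqAle eq_sym An0.
have : 0 <= A * (A * C - B ^+ 2).
  rewrite (_ : A * _ = \sum_i w i * (A * v i - B * u i) ^+ 2).
    by apply: sumr_ge0 => i _; rewrite mulr_ge0 ?sqr_ge0.
  transitivity (\sum_i (A ^+ 2 * (w i * v i ^+ 2) - 2 * A * B * (w i * (u i * v i))
      + B ^+ 2 * (w i * u i ^+ 2))); last by apply: eq_bigr => i _; ring.
  by rewrite big_split sumrB /= -!mulr_sumr -/A -/B -/C; ring.
by rewrite pmulr_rge0// subr_ge0.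
Qed.

(** The witness is the least value at or below which lies half of the mass. If more than half lay
    strictly below, the largest value below would already qualify. *)
Lemma median w f : (forall i, 0 <= w i) -> (0 < #|I|)%N -> exists c,
  \sum_(i | f i < c) w i <= \sum_(i | ~~ (f i < c)) w i /\
  \sum_(i | c < f i) w i <= \sum_(i | ~~ (c < f i)) w i.
Proof.
move=> w0 /card_gt0P[i0 _].
pose tot := \sum_i w i.
have sp (P : pred I) : \sum_(i | P i) w i + \sum_(i | ~~ P i) w i = tot.
  by rewrite /tot [RHS](bigID P).
have s0 (P : pred I) : 0 <= \sum_(i | P i) w i by exact: sumr_ge0.
pose heavy i := tot <= 2 * \sum_(j | f j <= f i) w j.
pose imax := [arg max_(i > i0 | true) f i]%O.
have fmax j : f j <= f imax by rewrite /imax; case: arg_maxP => // i _; exact.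
have hmax : heavy imax.
  rewrite /heavy (_ : \sum_(j | _) _ = tot).
    by have := s0 xpredT; rewrite -/tot; lra.
  by apply: eq_bigl => j; rewrite fmax.
pose i1 := [arg min_(i < imax | heavy i) f i]%O.
have [h1 min1] : heavy i1 /\ forall j, heavy j -> f i1 <= f j.
  by rewrite /i1; case: arg_minP.
exists (f i1); split.
- rewrite leNgt; apply/negP => big.
  have /existsP[j0 fj0] : [exists j, f j < f i1].
    apply: contraT => /existsPn no; move: big.
    by rewrite [X in _ < X]big1 ?ltNge ?s0// => j /[dup] fj; rewrite (negbTE (no j)).
  pose j1 := [arg max_(j > j0 | f j < f i1) f j]%O.
  have [lt1 max1] : f j1 < f i1 /\ forall j, f j < f i1 -> f j <= f j1.
    by rewrite /j1; case: arg_maxP.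
  have : heavy j1.
    rewrite /heavy (_ : \sum_(j | _) _ = \sum_(i | f i < f i1) w i).
      by have := sp (fun i => f i < f i1); lra.
    apply: eq_bigl => j; apply/idP/idP; last exact: max1.
    by move=> /le_lt_trans; apply.
  by move=> /min1; rewrite leNgt lt1.
- have := sp (fun i => f i1 < f i).
  have -> : \sum_(i | ~~ (f i1 < f i)) w i = \sum_(i | f i <= f i1) w i.
    by apply: eq_bigl => i; rewrite -leNgt.
  by move: h1; rewrite /heavy; lra.
Qed.

End finite_sums.

(** * From the isoperimetric inequality to energy bounds, on an abstract weighted graph *)

Section coarea.
Variables (R : realType) (I S : finType) (m : I -> R) (len d : S -> R)
  (sd : S -> option (I * I)) (C : R).
Hypotheses (m0 : forall i, 0 <= m i) (len0 : forall s, 0 <= len s) (C0 : 0 <= C).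
Implicit Types (h f : I -> R) (P : pred I).

Definition variation h := \sum_s (if sd s is Some (K, L)
  then len s * `|h K - h L| else 0).

Definition cut P := \sum_s (if sd s is Some (K, L)
  then if P K != P L then len s else 0 else 0).

Lemma variation_ge0 h : 0 <= variation h.
Proof.
by apply: sumr_ge0 => s _; case: (sd s) => [[K L]|//]; rewrite mulr_ge0.
Qed.

(* Induction on the support: subtract the least positive value of [h] on [0 < h]. *)
Lemma coarea h : (forall i, 0 <= h i) ->
  (forall t, 0 <= t -> \sum_(i | t < h i) m i <= C * cut (fun i => t < h i) ^+ 2) ->
  \sum_i m i * h i ^+ 2 <= C * variation h ^+ 2.
Proof.
have [n] := ubnP #|[pred i | 0 < h i]|; elim: n h => // n IH h hn h0 hC.
have [/existsP[i0 hi0]|/existsPn nh] := boolP [exists i, 0 < h i]; last first.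
  rewrite big1; first by rewrite mulr_ge0 ?sqr_ge0.
  move=> i _; have -> : h i = 0 by apply/eqP; rewrite eq_le h0 leNgt nh.
  by rewrite expr0n mulr0.
pose i1 := [arg min_(i < i0 | 0 < h i) h i]%O.
have [h1 min1] : 0 < h i1 /\ forall j, 0 < h j -> h i1 <= h j.
  by rewrite /i1; case: arg_minP.
pose t := h i1; pose A i := 0 < h i.
pose h' i := if A i then h i - t else 0.
have h'0 i : 0 <= h' i by rewrite /h'; case: ifP => // /min1; rewrite subr_ge0.
have lev u : 0 <= u -> (fun i => u < h' i) = (fun i => t + u < h i).
  move=> u0; apply/funext => i; rewrite /h' /A; case: ifP => hi; first by apply/idP/idP; lra.
  apply/idP/idP; first by rewrite ltNge u0.
  by move: hi => /negbT; rewrite -leNgt /t; lra.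
have IH' : \sum_i m i * h' i ^+ 2 <= C * variation h' ^+ 2.
  apply: IH => //.
  - apply: (@leq_trans #|[pred i | 0 < h i]|); last by rewrite -ltnS.
    apply/proper_card/properP; split.
      apply/fintype.subsetP => i; rewrite !inE /h' /A; case: ifP => //; by rewrite ltxx.
    by exists i1; rewrite !inE // /h' /A h1 /t subrr ltxx.
  - move=> u u0; under eq_bigl do rewrite (congr1 (fun F => F _) (lev u u0)).
    rewrite lev//; apply: hC; by rewrite addr_ge0// ltW.
have hA := hC 0 (lexx 0).
set a := \sum_(i | 0 < h i) m i in hA; set p := cut _ in hA.
have p0 : 0 <= p.
  by apply: sumr_ge0 => s _; case: (sd s) => [[K L]|//]; case: ifP.
have a0 : 0 <= a by exact: sumr_ge0.
have t0 : 0 < t by [].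
(* Exact, because [h >= t] on the support: an edge leaving the support loses exactly [t], and any
   other edge loses nothing. *)
have VE : variation h = t * p + variation h'.
  rewrite /variation /p /cut mulr_sumr -big_split /=; apply: eq_bigr => s _.
  case: (sd s) => [[K L]|]; last by rewrite mulr0 addr0.
  rewrite /h' /A; have [hK|hK] := boolP (0 < h K); have [hL|hL] := boolP (0 < h L) => /=.
  + by rewrite mulr0 add0r; congr (_ * `|_|); ring.
  + have -> : h L = 0 by apply/eqP; rewrite eq_le h0 leNgt hL.
    have := min1 K hK; rewrite -/t => tK.
    by rewrite !subr0 !ger0_norm ?subr_ge0//; ring.
  + have -> : h K = 0 by apply/eqP; rewrite eq_le h0 leNgt hK.
    have := min1 L hL; rewrite -/t => tL.
    by rewrite !sub0r !normrN !ger0_norm ?subr_ge0//; ring.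
  + have -> : h K = 0 by apply/eqP; rewrite eq_le h0 leNgt hK.
    have -> : h L = 0 by apply/eqP; rewrite eq_le h0 leNgt hL.
    by rewrite subrr normr0 !mulr0 addr0.
have V'0 := variation_ge0 h'.
pose b := \sum_(i | 0 < h i) m i * h' i.
have b0 : 0 <= b by apply: sumr_ge0 => i _; exact: mulr_ge0.
have SE : \sum_i m i * h i ^+ 2 = t ^+ 2 * a + 2 * t * b + \sum_i m i * h' i ^+ 2.
  rewrite /a /b !mulr_sumr [in RHS]big_mkcond [X in _ + X + _]big_mkcond /=.
  rewrite -!big_split /=; apply: eq_bigr => i _; rewrite /h' /A.
  case: ifPn => hi; first by ring.
  have -> : h i = 0 by apply/eqP; rewrite eq_le h0 leNgt hi.
  by rewrite expr0n; ring.
(* Cauchy-Schwarz combines the level-0 bound on [a] with the induction hypothesis. This is just the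
   cross term in the square of [t * p + variation h']. *)
have bC : b <= C * (p * variation h').
  have Cpv : 0 <= C * (p * variation h') by rewrite !mulr_ge0.
  rewrite -(ler_pXn2r (n := 2)) ?nnegrE//.
  have bE : b = \sum_i m i * ((if 0 < h i then 1 else 0) * h' i).
    rewrite /b big_mkcond; apply: eq_bigr => i _.
    by case: ifP => _; rewrite ?mul1r// !mul0r mulr0.
  have aE : a = \sum_i m i * (if 0 < h i then 1 else 0) ^+ 2.
    rewrite /a big_mkcond; apply: eq_bigr => i _.
    by case: ifP => _; rewrite ?expr1n ?mulr1// expr0n mulr0.
  rewrite bE; apply: (le_trans (sum_cauchy_schwarz _ _ m0)); rewrite -aE.
  apply: (@le_trans _ _ ((C * p ^+ 2) * (C * variation h' ^+ 2))).
    by apply: ler_pM => //; apply: sumr_ge0 => i _; rewrite mulr_ge0 ?sqr_ge0.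
  by rewrite le_eqVlt; apply/orP; left; apply/eqP; ring.
rewrite SE VE; apply: (@le_trans _ _ (t ^+ 2 * (C * p ^+ 2) +
  2 * t * (C * (p * variation h')) + C * variation h' ^+ 2)).
  apply: lerD => //; apply: lerD; first by rewrite ler_wpM2l ?sqr_ge0.
  by rewrite ler_wpM2l// mulr_ge0// ltW.
by rewrite le_eqVlt; apply/orP; left; apply/eqP; ring.
Qed.

Hypothesis iso : forall P, Num.min (\sum_(i | P i) m i) (\sum_(i | ~~ P i) m i)
  <= C * cut P ^+ 2.

(** Every superlevel set above 0 carries at most half of the mass, so [iso] bounds that set itself,
    as [coarea] requires. *)
Lemma sobolev_positive_part h :
  \sum_(i | 0 < h i) m i <= \sum_(i | ~~ (0 < h i)) m i ->
  \sum_i m i * Num.max (h i) 0 ^+ 2 <= C * variation (fun i => Num.max (h i) 0) ^+ 2.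
Proof.
move=> hmed; apply: coarea => [i|t t0]; first by rewrite le_max lexx orbT.
have lev : (fun i => t < Num.max (h i) 0) = (fun i => t < h i).
  by apply/funext => i; rewrite lt_max [t < 0]ltNge t0 orbF.
under eq_bigl do rewrite (congr1 (fun F => F _) lev); rewrite lev.
have := iso (fun i => t < h i); rewrite ge_min => /orP[//|]; apply: le_trans.
apply: (@le_trans _ _ (\sum_(i | 0 < h i) m i)).
  rewrite [leLHS]big_mkcond [leRHS]big_mkcond; apply: ler_sum => i _.
  by case: ifP => [/(le_lt_trans t0) ->//|_]; case: ifP.
apply: (le_trans hmed).
rewrite [leLHS]big_mkcond [leRHS]big_mkcond; apply: ler_sum => i _.
rewrite -!leNgt; case: ifP => [hi|_]; last by case: ifP.
by rewrite (le_trans hi t0).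
Qed.

(** 0 is a median of [h] for the mass [m]. *)
Definition centered h :=
  \sum_(i | 0 < h i) m i <= \sum_(i | ~~ (0 < h i)) m i /\
  \sum_(i | h i < 0) m i <= \sum_(i | ~~ (h i < 0)) m i.

(** Both the variation and the sum of squares are additive over the positive and negative parts, and
    the sum of two squares of nonnegative numbers is at most the square of their sum. *)
Lemma sobolev h : centered h -> \sum_i m i * h i ^+ 2 <= C * variation h ^+ 2.
Proof.
move=> [hp hn].
have Hp := sobolev_positive_part hp.
have Hn : \sum_i m i * Num.max (- h i) 0 ^+ 2
    <= C * variation (fun i => Num.max (- h i) 0) ^+ 2.
  apply: (@sobolev_positive_part (fun i => - h i)).
  under eq_bigl do rewrite oppr_gt0; apply: (le_trans hn).
  by rewrite le_eqVlt; apply/orP; left; apply/eqP; apply: eq_bigl => i; rewrite oppr_gt0.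
set hp' := fun i => Num.max (h i) 0 in Hp; set hn' := fun i => Num.max (- h i) 0 in Hn.
have maxE (x : R) : Num.max x 0 = if 0 <= x then x else 0.
  by rewrite maxElt ltNge; case: (0 <= x).
have negE (x : R) : 0 <= x -> (if x <= 0 then - x else 0) = 0.
  by move=> x0; case: ifP => // x0'; apply/eqP; rewrite oppr_eq0 eq_le x0 x0'.
have VE : variation h = variation hp' + variation hn'.
  rewrite /variation -big_split /=; apply: eq_bigr => s _.
  case: (sd s) => [[K L]|]; last by rewrite addr0.
  rewrite -mulrDr; congr (_ * _); rewrite /hp' /hn' !maxE !oppr_ge0.
  have [hK|hK] := leP 0 (h K); have [hL|hL] := leP 0 (h L).
  + by rewrite !negE// subrr normr0 addr0.
  + rewrite (ltW hL) negE//; rewrite subr0 sub0r opprK (ger0_norm hK) (ltr0_norm hL) ger0_norm; lra.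
  + rewrite (ltW hK) negE//; rewrite subr0 sub0r normrN (ger0_norm hL) normrN (ltr0_norm hK) ler0_norm; lra.
  + by rewrite (ltW hK) (ltW hL) subrr normr0 add0r -opprD normrN.
have SE : \sum_i m i * h i ^+ 2 = \sum_i m i * hp' i ^+ 2 + \sum_i m i * hn' i ^+ 2.
  rewrite -big_split /=; apply: eq_bigr => i _.
  rewrite /hp' /hn' !maxE oppr_ge0.
  by have [hi|hi|hi] := ltgtP (h i) 0; rewrite ?hi ?oppr0; ring.
have := variation_ge0 hp'; have := variation_ge0 hn' => n0 p0.
rewrite SE VE; apply: (le_trans (lerD Hp Hn)); rewrite -mulrDr ler_wpM2l//.
by rewrite sqrrD lerD2r lerDl mulrn_wge0// mulr_ge0.
Qed.

Variable D : R.
Hypotheses (d0 : forall s K L, sd s = Some (K, L) -> 0 < d s)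
  (edge_sum : forall w : I -> R, (forall i, 0 <= w i) ->
    \sum_s (if sd s is Some (K, L) then len s * d s * (w K + w L) else 0)
      <= D * \sum_i m i * w i).

Definition energy h := \sum_s (if sd s is Some (K, L)
  then len s / d s * `|h K - h L| ^+ 2 else 0).

Lemma energy_ge0 h : 0 <= energy h.
Proof.
apply: sumr_ge0 => s _; case E : (sd s) => [[K L]|//].
by rewrite mulr_ge0 ?sqr_ge0 ?divr_ge0// ltW// (d0 E).
Qed.

(** Cauchy-Schwarz with weight [len / d], after writing [len] as [(len / d) * d]; then
    [(w K + w L) ^+ 2] is at most twice the sum of the squares, and [edge_sum] applies to
    [w ^+ 2]. *)
Lemma weighted_variation h (w : I -> R) : (forall i, 0 <= w i) ->
  (\sum_s (if sd s is Some (K, L)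
     then len s * ((w K + w L) * `|h K - h L|) else 0)) ^+ 2 <=
  2 * D * (\sum_i m i * w i ^+ 2) * energy h.
Proof.
move=> w0.
pose q s := if sd s is Some _ then len s / d s else 0.
pose u s := if sd s is Some (K, L) then d s * (w K + w L) else 0.
pose v s := if sd s is Some (K, L) then `|h K - h L| else 0.
have q0 s : 0 <= q s.
  by rewrite /q; case E : (sd s) => [[K L]|//]; rewrite divr_ge0// ltW// (d0 E).
rewrite (_ : \sum_s _ = \sum_s q s * (u s * v s)); last first.
  apply: eq_bigr => s _; rewrite /q /u /v; case E : (sd s) => [[K L]|]; last by ring.
  by have := d0 E => ds0; field; rewrite gt_eqF.
apply: (le_trans (sum_cauchy_schwarz _ _ q0)).
rewrite (_ : \sum_s q s * v s ^+ 2 = energy h); last first.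
  apply: eq_bigr => s _; rewrite /q /v; case: (sd s) => [[K L]|]; ring.
apply: ler_wpM2r; first exact: energy_ge0.
have := edge_sum (fun i => sqr_ge0 (w i)) => H.
rewrite -mulrA; apply: (@le_trans _ _ (2 * \sum_s
    (if sd s is Some (K, L) then len s * d s * (w K ^+ 2 + w L ^+ 2) else 0)));
  last by rewrite ler_wpM2l.
  rewrite mulr_sumr; apply: ler_sum => s _; rewrite /q /u.
  case E : (sd s) => [[K L]|]; last by rewrite !mulr0 mul0r.
  have ds0 := d0 E; have ld0 : 0 <= len s * d s by rewrite mulr_ge0// ltW.
  rewrite (_ : _ / _ * _ = len s * d s * (w K + w L) ^+ 2); last by field; rewrite gt_eqF.
  rewrite [leRHS]mulrCA ler_wpM2l//.
  by have := sqr_ge0 (w K - w L); rewrite sqrrB sqrrD; lra.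
Qed.

Lemma poincare h : centered h ->
  \sum_i m i * h i ^+ 2 <= C * D * (\sum_i m i) / 2 * energy h.
Proof.
move=> hc; apply: (le_trans (sobolev hc)).
(* With the constant weight 1/2, the weighted variation is the variation itself. *)
have w0 (i : I) : 0 <= 1 / 2 :> R by lra.
have := @weighted_variation h (fun=> 1/2) w0.
rewrite (_ : \sum_s _ = variation h); last first.
  by apply: eq_bigr => s _; case: (sd s) => [[K L]|//]; congr (_ * _); field.
rewrite /= -mulr_suml => H.
apply: (@le_trans _ _ (C * (2 * D * ((\sum_i m i) * (1/2) ^+ 2) * energy h))).
  exact: ler_wpM2l.
by rewrite le_eqVlt; apply/orP; left; apply/eqP; field.
Qed.

(** [g = h * |h|] has the signs of [h], hence is centred, and [g ^+ 2 = h ^+ 4]. The variation of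
    [g] is bounded by the variation of [h] weighted by [|h|], whose square involves the L^2 norm of
    [h], which [poincare] controls. *)
Lemma sobolev4 h : 0 <= D -> centered h ->
  \sum_i m i * h i ^+ 4 <= (\sum_i m i) * (C * D * energy h) ^+ 2.
Proof.
move=> D0 hc; pose g i := h i * `|h i|.
have gc : centered g.
  have gp i : (0 < g i) = (0 < h i).
    rewrite /g; have [hi|hi|hi] := ltgtP 0 (h i); last by rewrite -hi mul0r ltxx.
      by rewrite mulr_gt0// normr_gt0 gt_eqF.
    by rewrite pmulr_lgt0 ?normr_gt0 ?lt_eqF// ltNge ltW.
  have gn i : (g i < 0) = (h i < 0).
    rewrite /g; have [hi|hi|hi] := ltgtP 0 (h i); last by rewrite -hi mul0r ltxx.
      by rewrite pmulr_llt0 ?normr_gt0 ?gt_eqF// ltNge ltW.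
    by rewrite pmulr_llt0 ?normr_gt0 ?lt_eqF.
  rewrite /centered; under eq_bigl do rewrite gp; under [in leRHS]eq_bigl do rewrite gp.
  by under [X in _ /\ X <= _]eq_bigl do rewrite gn; under [X in _ /\ _ <= X]eq_bigl do rewrite gn.
have E0 := energy_ge0 h.
have M0 : 0 <= \sum_i m i by exact: sumr_ge0.
have gE i : g i ^+ 2 = h i ^+ 4.
  by rewrite /g exprMn real_normK ?num_real// -exprD.
under eq_bigr do rewrite -gE.
apply: (le_trans (sobolev gc)).
pose W := \sum_s (if sd s is Some (K, L)
     then len s * ((`|h K| + `|h L|) * `|h K - h L|) else 0).
have VW : variation g <= W.
  apply: ler_sum => s _; case: (sd s) => [[K L]|//]; rewrite ler_wpM2l// /g.
  have h2 (x y : R) : `|x * `|x| - y * `|y| | <= (`|x| + `|y|) * `|x - y|.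
    rewrite (_ : _ - _ = ((`|x| + `|y|) * (x - y) + (x + y) * (`|x| - `|y|)) / 2).
      have a1 := ler_normD x y; have a2 := ler_dist_dist x y.
      have a3 : `|x + y| * `| `|x| - `|y| | <= (`|x| + `|y|) * `|x - y| by exact: ler_pM.
      rewrite normrM [X in _ * X]ger0_norm; last by lra.
      rewrite ler_pdivrMr//; apply: (le_trans (ler_normD _ _)); rewrite !normrM.
      by rewrite [`| `|x| + `|y| |]ger0_norm ?addr_ge0//; lra.
    by field.
  exact: h2.
have W2 : W ^+ 2 <= 2 * D * (\sum_i m i * h i ^+ 2) * energy h.
  have <- : \sum_i m i * `|h i| ^+ 2 = \sum_i m i * h i ^+ 2.
    by apply: eq_bigr => i _; rewrite real_normK ?num_real.
  exact: (@weighted_variation h (fun i => `|h i|) (fun i => normr_ge0 _)).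
have V2 : variation g ^+ 2 <= W ^+ 2.
  by rewrite lerXn2r ?nnegrE ?variation_ge0// (le_trans _ VW)// variation_ge0.
have P2 := poincare hc.
apply: (@le_trans _ _ (C * (2 * D * (C * D * (\sum_i m i) / 2 * energy h) * energy h))).
  apply: ler_wpM2l => //; apply: (le_trans V2); apply: (le_trans W2).
  by apply: ler_wpM2r => //; apply: ler_wpM2l => //; rewrite mulr_ge0.
by rewrite le_eqVlt; apply/orP; left; apply/eqP; field.
Qed.

End coarea.

(** * Functional inequalities for weights of total mass 1 *)

Section probability_weights.
Variables (R : realType) (I : finType) (w : I -> R).
Hypotheses (w0 : forall i, 0 <= w i) (w1 : \sum_i w i = 1).
Implicit Types (f g h : I -> R).

Local Notation E f := (\sum_i w i * f i).

Let E_ge0 f : (forall i, 0 <= f i) -> 0 <= E f.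
Proof. by move=> f0; apply: sumr_ge0 => i _; exact: mulr_ge0. Qed.

Lemma mean_sqr_le f : (E f) ^+ 2 <= \sum_i w i * f i ^+ 2.
Proof.
have := sum_cauchy_schwarz (fun=> 1) f w0.
under eq_bigr do rewrite mul1r.
by rewrite [X in _ <= X * _](_ : _ = 1) ?mul1r// -[RHS]w1; apply: eq_bigr => i _; ring.
Qed.

Lemma variance_expand f c : \sum_i w i * (f i - c) ^+ 2 =
  \sum_i w i * f i ^+ 2 - 2 * c * E f + c ^+ 2.
Proof.
have -> : c ^+ 2 = \sum_i w i * c ^+ 2 by rewrite -mulr_suml w1 mul1r.
rewrite mulr_sumr -sumrB -big_split /=.
by apply: eq_bigr => i _; ring.
Qed.

Lemma variance_le f c :
  \sum_i w i * (f i - E f) ^+ 2 <= \sum_i w i * (f i - c) ^+ 2.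
Proof.
rewrite !variance_expand.
by have := sqr_ge0 (E f - c); rewrite sqrrB; lra.
Qed.

(** Convexity of the exponential between [ln x] and 0. *)
Lemma powR_bernoulli (x r : R) : 0 <= x -> 0 < r <= 1 -> x `^ r <= r * x + (1 - r).
Proof.
move=> x0 /andP[r0 r1]; have [->|xn0] := eqVneq x 0.
  by rewrite powR0 ?gt_eqF//; lra.
have xgt0 : 0 < x by rewrite lt_neqAle eq_sym xn0.
have := @convex_expR R (Itv01 (ltW r0) r1) (ln x) 0.
rewrite !convRE /= /unstable.onem expR0 lnK ?posrE// mulr0 addr0 mulr1.
by rewrite /powR (negbTE xn0).
Qed.

(** [powR_bernoulli] at [g i / E g], averaged: the right-hand side has mean [r + (1 - r) = 1]. *)
Lemma powR_jensen g (r : R) : (forall i, 0 <= g i) -> 0 < r <= 1 ->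
  \sum_i w i * g i `^ r <= (E g) `^ r.
Proof.
move=> g0 r01; have /andP[r0 r1] := r01.
have G0 : 0 <= E g by exact: E_ge0.
have [Geq0|Gn0] := eqVneq (E g) 0.
  rewrite Geq0 powR0 ?gt_eqF// big1// => i _.
  have : w i * g i = 0 by apply: (psumr_eq0P _ Geq0) => // j _; exact: mulr_ge0.
  by move=> /eqP; rewrite mulf_eq0 => /orP[] /eqP ->; rewrite ?mul0r// powR0 ?mulr0 ?gt_eqF.
have Ggt0 : 0 < E g by rewrite lt_neqAle eq_sym Gn0.
have Gr0 : 0 < (E g) `^ r by rewrite powR_gt0.
rewrite -[leRHS]mul1r -ler_pdivrMr// mulr_suml.
apply: (@le_trans _ _ (\sum_i (r / E g * (w i * g i) + (1 - r) * w i))).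
  apply: ler_sum => i _.
  rewrite (_ : w i * g i `^ r / _ = w i * (g i / E g) `^ r).
    have := powR_bernoulli (divr_ge0 (g0 i) G0) r01 => /(ler_wpM2l (w0 i)) H.
    by apply: (le_trans H); rewrite le_eqVlt; apply/orP; left; apply/eqP; field.
  rewrite powRM ?invr_ge0// -mulrA; congr (_ * (_ * _)).
  apply: (mulIf (lt0r_neq0 Gr0)); rewrite mulVf ?gt_eqF// -powRM ?invr_ge0//.
  by rewrite mulVf// powR1.
by rewrite big_split /= -!mulr_sumr w1 divfK//; lra.
Qed.

(** Jensen with exponent [p / 2 <= 1] applied to [f] to the power [2 / p] gives [(E f) ^+ 2 <= G] to
    the power [p], so the left-hand side is at most the variance. *)
Lemma beckner f (p : R) : 1 < p <= 2 -> (forall i, 0 <= f i) ->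
  \sum_i w i * f i ^+ 2 - (\sum_i w i * f i `^ (2 / p)) `^ p <=
  \sum_i w i * (f i - E f) ^+ 2.
Proof.
move=> /andP[p1 p2] f0; rewrite variance_expand.
set G := \sum_i w i * f i `^ (2 / p).
have G0 : 0 <= G by apply: E_ge0 => i; exact: powR_ge0.
have p0 : p != 0 by lra.
have r01 : 0 < p / 2 <= 1 by lra.
have := @powR_jensen (fun i => f i `^ (2 / p)) (p / 2) (fun i => powR_ge0 _ _) r01.
rewrite (_ : \sum_i w i * (f i `^ (2 / p)) `^ (p / 2) = E f); last first.
  apply: eq_bigr => i _; rewrite -powRrM (_ : 2 / p * (p / 2) = 1) ?powRr1//.
  by field.
rewrite -/G => H.
have : (E f) ^+ 2 <= G `^ p.
  rewrite (_ : G `^ p = (G `^ (p / 2)) ^+ 2).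
    by rewrite lerXn2r ?nnegrE ?powR_ge0// E_ge0.
  by rewrite -powR_mulrn ?powR_ge0// -powRrM divfK.
have -> : 2 * E f * E f = 2 * (E f) ^+ 2 by ring.
by lra.
Qed.

Lemma ln_le_sub1 (x : R) : 0 < x -> ln x <= x - 1.
Proof.
by move=> x0; rewrite -{1}(subrK 1 x) addrC le_ln1Dx//; lra.
Qed.

(* [ln x <= x / b + b] with [x = f^2 / N] and [b = sqrt (E f^4) / N] *)
Lemma entropy_le_L4 f : (forall i, 0 < f i) ->
  \sum_i w i * (f i ^+ 2 * ln (f i ^+ 2 / \sum_j w j * f j ^+ 2)) <=
  2 * Num.sqrt (\sum_i w i * f i ^+ 4).
Proof.
move=> f0; set N := \sum_j w j * f j ^+ 2; set F := \sum_i w i * f i ^+ 4.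
have F0 : 0 <= F by apply: E_ge0 => i; rewrite -[4%N]/(2 * 2)%N exprM sqr_ge0.
have FN : N ^+ 2 <= F.
  rewrite (_ : F = \sum_i w i * (f i ^+ 2) ^+ 2); first exact: (mean_sqr_le (fun i => f i ^+ 2)).
  by apply: eq_bigr => i _; rewrite -exprM.
have N0 : 0 < N.
  have N_ge0 : 0 <= N by apply: E_ge0 => i; exact: sqr_ge0.
  rewrite lt_neqAle N_ge0 andbT eq_sym; apply/eqP => N0; have : \sum_i w i = 0.
    apply: big1 => i _; have : w i * f i ^+ 2 = 0.
      by apply: (psumr_eq0P _ N0) => // j _; rewrite mulr_ge0 ?sqr_ge0.
    by move=> /eqP; rewrite mulf_eq0 sqrf_eq0 (gt_eqF (f0 i)) orbF => /eqP.
  by rewrite w1 => /eqP; rewrite oner_eq0.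
have Fgt0 : 0 < F by apply: lt_le_trans FN; rewrite exprn_gt0.
set s := Num.sqrt F; have s0 : 0 < s by rewrite sqrtr_gt0.
have ss : s ^+ 2 = F by rewrite sqr_sqrtr.
apply: (@le_trans _ _ (\sum_i ((w i * f i ^+ 4) / s + s / N * (w i * f i ^+ 2)))).
  apply: ler_sum => i _.
  have fi := f0 i; have f2 : 0 < f i ^+ 2 by rewrite exprn_gt0.
  have : ln (f i ^+ 2 / N) <= f i ^+ 2 / s + s / N.
    have -> : f i ^+ 2 / N = (f i ^+ 2 / s) * (s / N).
      by field; rewrite !gt_eqF.
    rewrite lnM ?posrE ?divr_gt0//; apply: lerD; apply/ltW/ln_sublinear; exact: divr_gt0.
  move=> /(ler_wpM2l (ltW f2)) /(ler_wpM2l (w0 i)) H; apply: (le_trans H).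
  rewrite le_eqVlt; apply/orP; left; apply/eqP; field.
  by rewrite !gt_eqF.
rewrite big_split /= -mulr_suml -mulr_sumr -/F -/N -ss divfK ?gt_eqF//.
by rewrite expr2 mulfK ?gt_eqF//; lra.
Qed.

(** [(g + k) ^+ 4 <= 8 * (g ^+ 4 + k ^+ 4)], and the hypothesis turns the second half into another
    8. *)
Lemma sum_shift_pow4_le g (k : R) : k ^+ 4 <= \sum_i w i * g i ^+ 4 ->
  \sum_i w i * (g i + k) ^+ 4 <= 16 * \sum_i w i * g i ^+ 4.
Proof.
set Q := \sum_i w i * g i ^+ 4 => kQ.
have pow4 (x : R) : x ^+ 4 = (x ^+ 2) ^+ 2 by rewrite -exprM.
apply: (@le_trans _ _ (\sum_i (8 * (w i * g i ^+ 4) + 8 * k ^+ 4 * w i))).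
  apply: ler_sum => i _.
  rewrite [leRHS](_ : _ = w i * (8 * (g i ^+ 4 + k ^+ 4))); last by ring.
  rewrite ler_wpM2l// !pow4.
  have h3 := sqr_ge0 (g i + k).
  have h4 : (g i + k) ^+ 2 <= 2 * (g i ^+ 2 + k ^+ 2).
    by rewrite -subr_ge0 (_ : _ - _ = (g i - k) ^+ 2) ?sqr_ge0//; ring.
  have h5 : ((g i + k) ^+ 2) ^+ 2 <= (2 * (g i ^+ 2 + k ^+ 2)) ^+ 2.
    by rewrite lerXn2r ?nnegrE// (le_trans h3).
  apply: (le_trans h5).
  rewrite -subr_ge0 (_ : _ - _ = 4 * (g i ^+ 2 - k ^+ 2) ^+ 2); last by ring.
  by rewrite mulr_ge0 ?sqr_ge0.
by rewrite big_split /= -!mulr_sumr w1 mulr1 -/Q; lra.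
Qed.

(* If [E (f - m)^2 <= m^2], use [ln (f^2 / N) <= 2 (f / m - 1)] with [N >= m^2];
   otherwise [m] is dominated by [f - m] and [entropy_le_L4] suffices. *)
Lemma entropy_le_centered f : (forall i, 0 < f i) ->
  \sum_i w i * (f i ^+ 2 * ln (f i ^+ 2 / \sum_j w j * f j ^+ 2)) <=
  8 * Num.sqrt (\sum_i w i * (f i - E f) ^+ 4).
Proof.
move=> f0; set m := E f; set Q := \sum_i w i * (f i - m) ^+ 4.
set N := \sum_j w j * f j ^+ 2.
pose g i := f i - m; pose G2 := \sum_i w i * g i ^+ 2.
have pow4 (x : R) : x ^+ 4 = (x ^+ 2) ^+ 2 by rewrite -exprM.
have Q0 : 0 <= Q by apply: E_ge0 => i; rewrite pow4 sqr_ge0.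
have G20 : 0 <= G2 by apply: E_ge0 => i; exact: sqr_ge0.
have G2Q : G2 ^+ 2 <= Q.
  apply: (le_trans (mean_sqr_le (fun i => g i ^+ 2))).
  by rewrite /Q; apply: ler_sum => i _; rewrite pow4.
set s := Num.sqrt Q; have s0 : 0 <= s by exact: sqrtr_ge0.
have ss : s ^+ 2 = Q by rewrite sqr_sqrtr.
have G2s : G2 <= s by rewrite -(ler_pXn2r (n := 2)) ?nnegrE// ss.
have gm : E g = 0.
  rewrite /g; under eq_bigr do rewrite mulrBr.
  by rewrite sumrB -mulr_suml w1 mul1r subrr.
have NE : N = m ^+ 2 + G2.
  by rewrite /G2 /g variance_expand -/N -/m; ring.
have m0 : 0 < m.
  have m_ge0 : 0 <= m by apply: E_ge0 => i; exact: ltW.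
  rewrite lt_neqAle m_ge0 andbT eq_sym; apply/eqP => m0; have : \sum_i w i = 0.
    apply: big1 => i _; have : w i * f i = 0.
      by apply: (psumr_eq0P _ m0) => // j _; rewrite mulr_ge0 // ltW.
    by move=> /eqP; rewrite mulf_eq0 (gt_eqF (f0 i)) orbF => /eqP.
  by rewrite w1 => /eqP; rewrite oner_eq0.
have [G2m|mG2] := leP G2 (m ^+ 2); last first.
  apply: (le_trans (entropy_le_L4 f0)).
  have : \sum_i w i * f i ^+ 4 <= 16 * Q.
    rewrite (_ : \sum_i w i * f i ^+ 4 = \sum_i w i * (g i + m) ^+ 4); last first.
      by apply: eq_bigr => i _; rewrite /g subrK.
    apply: sum_shift_pow4_le; apply: le_trans G2Q.
    by rewrite pow4 lerXn2r ?nnegrE ?sqr_ge0//; exact: ltW.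
  move=> /ler_wsqrtr; rewrite sqrtrM// (_ : 16 = 4 ^+ 2); last by ring.
  by rewrite sqrtr_sqr ger0_norm// -/s; lra.
have N0 : 0 < N by rewrite NE ltr_pwDl// exprn_gt0.
pose G3 := \sum_i w i * g i ^+ 3.
have G3s : G3 <= m * s.
  have ms0 : 0 <= m * s by rewrite mulr_ge0// ltW.
  have [G30|/ltW G30] := leP G3 0; first exact: le_trans ms0.
  rewrite -(ler_pXn2r (n := 2)) ?nnegrE// exprMn ss.
  have := sum_cauchy_schwarz g (fun i => g i ^+ 2) w0.
  rewrite (_ : \sum_i w i * (g i * g i ^+ 2) = G3); last first.
    by apply: eq_bigr => i _; rewrite -exprS.
  rewrite (_ : \sum_i w i * (g i ^+ 2) ^+ 2 = Q); last first.
    by apply: eq_bigr => i _; rewrite -pow4.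
  by move=> /le_trans; apply; rewrite ler_wpM2r.
(* With [f = m + g], this expands [f ^+ 2 * 2 * (f / m - 1)]. The linear term has mean 0, and the
   other two give [4 * s + 2 * s], below the [8 * s] set by the case [m ^+ 2 < G2]. *)
apply: (@le_trans _ _ (\sum_i (2 * m * (w i * g i) + 4 * (w i * g i ^+ 2)
    + 2 / m * (w i * g i ^+ 3)))).
  apply: ler_sum => i _; have fi := f0 i.
  have f2 : 0 < f i ^+ 2 by rewrite exprn_gt0.
  have fm0 : 0 < f i / m by rewrite divr_gt0.
  have : ln (f i ^+ 2 / N) <= 2 * (f i / m - 1).
    apply: (@le_trans _ _ (ln ((f i / m) ^+ 2))).
      rewrite ler_ln ?posrE ?divr_gt0 ?exprn_gt0// exprMn exprVn.
      rewrite ler_pM2l// lef_pV2 ?posrE ?exprn_gt0//.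
      by rewrite NE lerDl.
    by rewrite lnXn// mulr_natl lerMn2r ln_le_sub1.
  move=> /(ler_wpM2l (ltW f2)) /(ler_wpM2l (w0 i)) H; apply: (le_trans H).
  rewrite /g le_eqVlt; apply/orP; left; apply/eqP; field.
  by rewrite gt_eqF.
rewrite !big_split /= -!mulr_sumr gm mulr0 add0r -/G2 -/G3.
have : 2 / m * G3 <= 2 * s.
  rewrite mulrAC ler_pdivrMr// -mulrA ler_pM2l//.
  by rewrite mulrC.
by lra.
Qed.

(** Moving the centre from the mean to [c] costs a factor 16 on fourth powers, that is 4 after the
    square root. *)
Lemma entropy_le f c : (forall i, 0 < f i) ->
  \sum_i w i * (f i ^+ 2 * ln (f i ^+ 2 / \sum_j w j * f j ^+ 2)) <=
  32 * Num.sqrt (\sum_i w i * (f i - c) ^+ 4).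
Proof.
move=> f0; apply: (le_trans (entropy_le_centered f0)).
pose h i := f i - c; set m := E f.
have pow4 (x : R) : x ^+ 4 = (x ^+ 2) ^+ 2 by rewrite -exprM.
have hm : E h = m - c.
  rewrite /h; under eq_bigr do rewrite mulrBr.
  by rewrite sumrB -mulr_suml w1 mul1r.
set H := \sum_i w i * (f i - c) ^+ 4.
have mH : (m - c) ^+ 4 <= H.
  rewrite -hm pow4; apply: (@le_trans _ _ ((\sum_i w i * h i ^+ 2) ^+ 2)).
    by rewrite lerXn2r ?nnegrE ?sqr_ge0 ?mean_sqr_le// E_ge0// => i; exact: sqr_ge0.
  apply: (le_trans (mean_sqr_le (fun i => h i ^+ 2))).
  by rewrite /H; apply: ler_sum => i _; rewrite pow4.
have : \sum_i w i * (f i - m) ^+ 4 <= 16 * H.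
  rewrite (_ : \sum_i _ = \sum_i w i * (h i + - (m - c)) ^+ 4); last first.
    by apply: eq_bigr => i _; rewrite /h; congr (_ * _ ^+ 4); ring.
  by apply: sum_shift_pow4_le; rewrite pow4 sqrrN -pow4.
move=> /ler_wsqrtr; rewrite sqrtrM// (_ : 16 = 4 ^+ 2); last by ring.
by rewrite sqrtr_sqr ger0_norm//; lra.
Qed.

End probability_weights.

(** * Sums over the edges of a cell *)

Section segments.
Variable R : realType.
Implicit Types (a b c x y z : R * R).

Lemma line_point_inj a b : a != b -> injective (line_point a b).
Proof.
move=> /dist2_gt0; set D := (X in 0 < X) => D0 r s rs.
have : (r - s) * D = 0.
  have /= e1 := congr1 fst rs; have /= e2 := congr1 snd rs.
  rewrite (_ : _ * D = (b.1 - a.1) * ((line_point a b r).1 - (line_point a b s).1)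
     + (b.2 - a.2) * ((line_point a b r).2 - (line_point a b s).2)).
    by rewrite /= e1 e2 !subrr !mulr0 addr0.
  by rewrite /line_point /D /=; ring.
by move=> /eqP; rewrite mulf_eq0 (gt_eqF D0) orbF subr_eq0 => /eqP.
Qed.

Lemma line_point_line_point a b (r s t : R) :
  line_point (line_point a b r) (line_point a b s) t =
  line_point a b ((1 - t) * r + t * s).
Proof. by rewrite /line_point /=; congr pair; ring. Qed.

(** The step [d] is chosen small against the slope [be - al]. It serves to find a second common
    point of two aligned edges that share one. *)
Lemma perturb_in_interval (al be r : R) : 0 < r < 1 -> 0 < (1 - r) * al + r * be < 1 ->
  exists r', [/\ r' != r, 0 < r' < 1 & 0 < (1 - r') * al + r' * be < 1].
Proof.
move=> r01; set r1 := (1 - r) * al + r * be => r101.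
have [r0 r1'] := andP r01; have [r10 r11] := andP r101.
pose q := `|be - al| + 1; have q1 : 1 <= q by rewrite /q lerDr.
have qle : `|be - al| <= q by rewrite /q lerDl.
pose d := Num.min (1 - r) (Num.min r1 (1 - r1)) / (2 * q).
have mm : 0 < Num.min (1 - r) (Num.min r1 (1 - r1)) by rewrite !lt_min; lra.
have d0 : 0 < d by rewrite /d divr_gt0//; lra.
have dq : d * q = Num.min (1 - r) (Num.min r1 (1 - r1)) / 2.
  by rewrite /d; field; lra.
have dq1 : d * q < 1 - r.
  have : Num.min (1 - r) (Num.min r1 (1 - r1)) <= 1 - r by rewrite ge_min lexx.
  by lra.
have dq2 : d * q < r1.
  have : Num.min (1 - r) (Num.min r1 (1 - r1)) <= r1 by rewrite !ge_min lexx orbT.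
  by lra.
have dq3 : d * q < 1 - r1.
  have : Num.min (1 - r) (Num.min r1 (1 - r1)) <= 1 - r1 by rewrite !ge_min lexx !orbT.
  by lra.
have ddq : d <= d * q by rewrite ler_peMr// ltW.
have dab : `|d * (be - al)| <= d * q by rewrite normrM gtr0_norm// ler_pM2l.
exists (r + d); split; first by rewrite -subr_eq0; lra.
  by lra.
have -> : (1 - (r + d)) * al + (r + d) * be = r1 + d * (be - al) by rewrite /r1; ring.
by move: dab; rewrite ler_norml; lra.
Qed.

Lemma closed_closed_segment a b : a != b -> closed (closed_segment a b).
Proof.
move=> ab; have := dist2_gt0 ab; set D := (X in 0 < X) => D0.
have Dn0 : D != 0 by rewrite gt_eqF.
pose pr z := (b.1 - a.1) / D * z.1 + (b.2 - a.2) / D * z.2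
  + - (((b.1 - a.1) * a.1 + (b.2 - a.2) * a.2) / D).
have prE r : pr (line_point a b r) = r.
  rewrite /pr /line_point /=; move: Dn0; rewrite /D => Dn0'; field.
  by rewrite -/D.
rewrite (_ : closed_segment a b =
  [set z | side a b z = 0] `&` (pr @^-1` `[0, 1]%classic)).
  apply: closedI; first exact: closed_side.
  apply: closed_comp; last exact: interval_closed.
  by move=> z _; exact: continuous_affine2.
apply/seteqP; split => [_ [t t01 <-]|z [zab] /=].
  split; first by rewrite /side /line_point /=; ring.
  by rewrite /= prE in_itv.
have [r ->] := side_eq0 ab zab; rewrite prE in_itv /= => r01.
by exists r.
Qed.

Lemma closure_open_segment a b : a != b ->
  closure (open_segment a b) = closed_segment a b.
Proof.
move=> ab; apply/seteqP; split.
  have /closure_id -> := closed_closed_segment ab.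
  apply: closure_subset => _ [t /andP[t0 t1] <-]; exists t => //=.
  by rewrite !ltW.
move=> _ [t /andP[t0 t1] <-] V.
move=> /(@continuous_line_point R a b t) /nbhs_ballP[e /= e0 eV].
pose d := Num.min 1 e; have d0 : 0 < d by rewrite lt_min ltr01.
have d1 : d <= 1 by rewrite ge_min lexx.
have de : d <= e by rewrite ge_min lexx orbT.
pose t' := t + d * (1/2 - t).
have k1 : 0 <= (1 - d) * t by rewrite mulr_ge0; lra.
have k2 : 0 <= (1 - d) * (1 - t) by rewrite mulr_ge0; lra.
have k3 : 0 <= d * t by rewrite mulr_ge0; lra.
have k4 : 0 <= d * (1 - t) by rewrite mulr_ge0; lra.
exists (line_point a b t'); split; first by exists t' => //; rewrite /t' /=; lra.
by apply: eV; rewrite /ball /= /t' ltr_norml; lra.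
Qed.

(** Equal closed segments have the same end points, possibly exchanged. It links [separates], which
    speaks of closures, to [edge_inj], which speaks of open segments. *)
Lemma open_segment_eq a b a' b' : a != b -> a' != b' ->
  closed_segment a b = closed_segment a' b' -> open_segment a b = open_segment a' b'.
Proof.
move=> ab ab' E.
have end0 (c d : R * R) : closed_segment c d c.
  by exists 0; rewrite ?line_point0//= lexx ler01.
have end1 (c d : R * R) : closed_segment c d d.
  by exists 1; rewrite ?line_point1//= lexx ler01.
have [al /= al01 alE] : closed_segment a b a' by rewrite E.
have [be /= be01 beE] : closed_segment a b b' by rewrite E.
have [ga /= ga01 gaE] : closed_segment a' b' a by rewrite -E.
have [de /= de01 deE] : closed_segment a' b' b by rewrite -E.
have g0 : (1 - ga) * al + ga * be = 0.
  by apply: (line_point_inj ab); rewrite -line_point_line_point alE beE gaE line_point0.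
have g1 : (1 - de) * al + de * be = 1.
  by apply: (line_point_inj ab); rewrite -line_point_line_point alE beE deE line_point1.
have [[al0 be1]|[al1 be0]] : (al = 0 /\ be = 1) \/ (al = 1 /\ be = 0).
  clear E alE beE gaE deE ab ab' end0 end1.
  have p1 : 0 <= (1 - ga) * al by rewrite mulr_ge0; lra.
  have p2 : 0 <= ga * be by rewrite mulr_ge0; lra.
  have p3 : 0 <= (1 - de) * (1 - al) by rewrite mulr_ge0; lra.
  have p4 : 0 <= de * (1 - be) by rewrite mulr_ge0; lra.
  have /eqP : (1 - ga) * al = 0 by lra.
  have /eqP : (1 - de) * (1 - al) = 0 by lra.
  have /eqP : ga * be = 0 by lra.
  have /eqP : de * (1 - be) = 0 by lra.
  rewrite !mulf_eq0 => /orP[]/eqP h1 /orP[]/eqP h2 /orP[]/eqP h3 /orP[]/eqP h4;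
    solve [left; lra|right; lra|exfalso; lra].
- by move: alE beE; rewrite al0 be1 line_point0 line_point1 => -> ->.
- move: alE beE; rewrite al1 be0 line_point0 line_point1 => <- <-.
  apply/seteqP; split => _ [t /= t01 <-]; exists (1 - t);
    rewrite /= 1?[LHS]line_pointC ?subKr//; clear -t01; lra.
Qed.

End segments.

(** * Triangles over the edges of a cell and the use of regularity *)

Section edge_triangles.
Variables (R : realType) (Omega : set (R * R)) (M : mesh Omega).
Hypothesis bO : bounded_area Omega.
Local Notation mR2 := (measurableTypeR R * measurableTypeR R)%type.
Implicit Types (K L : cells M) (s : edges M).

Local Notation ea s := (endpoints s).1.
Local Notation eb s := (endpoints s).2.

Lemma separates_disjoint s K L z : separates s K L -> edge s z -> ~ cell K z.
Proof.
move=> sKL ez Kz; have [KL _ _ _] := sKL.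
have Lz : closure (cell L) z by exact: separates_open_segment (separatesC sKL) _ ez.
exact: (open_disjoint_closure (@cell_open _ _ M K) (cell_disjoint KL) Kz Lz).
Qed.

Lemma separates_side_neq0 s K L z : separates s K L -> cell K z ->
  side (ea s) (eb s) z != 0.
Proof.
move=> sKL Kz.
apply: (side_neq0 (@cell_open _ _ M K) (@cell_convex2 _ _ M K) (endpoints_neq s) _ _ Kz).
- exact: separates_open_segment sKL.
- by move=> y sy; exact: separates_disjoint sKL sy.
Qed.

Lemma separates_closure_side s K L z : separates s K L -> closure (cell K) z ->
  0 <= side (ea s) (eb s) (Defs.center K) * side (ea s) (eb s) z.
Proof.
move=> sKL; set k := side _ _ (Defs.center K).
pose F := (fun z : R * R => (k * - ((eb s).2 - (ea s).2)) * z.1 +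
   (k * ((eb s).1 - (ea s).1)) * z.2 + k * (((eb s).2 - (ea s).2) * (ea s).1
   - ((eb s).1 - (ea s).1) * (ea s).2)) @^-1` [set u | 0 <= u].
have FE y : F y = (0 <= k * side (ea s) (eb s) y).
  by rewrite /F /side /=; congr (is_true (0 <= _)); ring.
have cF : closed F.
  apply: closed_comp; last exact: closed_ge.
  by move=> y _; exact: continuous_affine2.
rewrite -FE; move/closure_id: cF => ->; apply: closure_subset => y Ky.
rewrite FE ltW// /k; apply: (side_same_sign (@cell_open _ _ M K) (@cell_convex2 _ _ M K)
  (endpoints_neq s) _ _ (center_in K) Ky).
- exact: separates_open_segment sKL.
- by move=> y' sy; exact: separates_disjoint sKL sy.
Qed.

Lemma common_subsegment s s' z r r' : edge s z -> 0 < r < 1 ->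
  z = line_point (ea s') (eb s') r -> r' != r -> 0 < r' < 1 ->
  edge s (line_point (ea s') (eb s') r') ->
  exists c d, [/\ c != d, open_segment c d `<=` edge s & open_segment c d `<=` edge s'].
Proof.
move=> [u /= u01 uz] r01 zE rr r'01 [v /= v01 vz].
exists z, (line_point (ea s') (eb s') r'); split.
- by rewrite zE; apply: contra_neq rr => /(line_point_inj (endpoints_neq s')).
- move=> _ [t /= t01 <-]; rewrite -uz -vz line_point_line_point.
  by eexists; last reflexivity; apply: convex_combination_itv => //; lra.
- move=> _ [t /= t01 <-]; rewrite zE line_point_line_point.
  by eexists; last reflexivity; apply: convex_combination_itv => //; lra.
Qed.

(** With the same neighbour, both edges have the same closure. Otherwise [s'] stays on one side of
    the line of [s] and touches it at an inner point, so it lies in that line; the edges then share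
    a segment, which [three_cells] forbids. *)
Lemma edges_of_cell_disjoint s s' K L L' z : separates s K L -> separates s' K L' ->
  edge s z -> edge s' z -> s = s'.
Proof.
move=> sKL sKL' sz s'z.
have [KL _ _ eKL] := sKL; have [KL' _ _ eKL'] := sKL'.
have [LL'|LL'] := eqVneq L L'.
  subst L'; apply: edge_inj; apply: open_segment_eq; [exact: endpoints_neq|exact: endpoints_neq|].
  rewrite -!closure_open_segment; [|exact: endpoints_neq|exact: endpoints_neq].
  by rewrite -/(edge s) -/(edge s') -eKL -eKL'.
exfalso.
have [r /= r01 rz] := s'z; have [r1 /= r101 r1z] := sz.
have sz0 : side (ea s) (eb s) z = 0.
  by rewrite -r1z /side /line_point /=; ring.
pose k := side (ea s) (eb s) (Defs.center K).
have k0 : k != 0 by exact: separates_side_neq0 sKL (center_in K).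
pose l t := side (ea s) (eb s) (line_point (ea s') (eb s') t).
have lE t : l t = (1 - t) * l 0 + t * l 1.
  by rewrite /l !side_line_point; ring.
have lr : l r = 0 by rewrite /l rz.
have lpos t : 0 < t < 1 -> 0 <= k * l t.
  move=> t01; apply: separates_closure_side sKL _.
  by apply: (separates_open_segment sKL'); exists t.
(* An affine function that vanishes at [r] and has one sign at both [r / 2] and [(1 + r) / 2] is
   constant. *)
have l00 : l 0 = l 1.
  have [r0 r1'] := andP r01.
  have h1 := lpos (r / 2); have h2 := lpos ((1 + r) / 2).
  have /h1 {}h1 : 0 < r / 2 < 1 by lra.
  have /h2 {}h2 : 0 < (1 + r) / 2 < 1 by lra.
  have e0 : k * ((1 - r) * l 0 + r * l 1) = 0 by rewrite -lE lr mulr0.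
  have : k * (l 1 - l 0) = 0.
    move: h1 h2; rewrite (lE (r / 2)) (lE ((1 + r) / 2)) => h1 h2.
    have h3 : 0 <= - (r / 2 * (k * (l 1 - l 0))) by move: h1 e0; lra.
    have h4 : 0 <= (1 - r) / 2 * (k * (l 1 - l 0)) by move: h2 e0; lra.
    rewrite oppr_ge0 pmulr_rle0 in h3; last by lra.
    rewrite pmulr_rge0 in h4; last by lra.
    by apply/eqP; rewrite eq_le h3 h4.
  by move=> /eqP; rewrite mulf_eq0 (negbTE k0) subr_eq0 => /eqP.
have l10 : l 1 = 0 by rewrite -[RHS]lr (lE r) l00; ring.
have l_0 t : l t = 0 by rewrite (lE t) l00 l10; ring.
have [al alE] := side_eq0 (endpoints_neq s) (l_0 0).
have [be beE] := side_eq0 (endpoints_neq s) (l_0 1).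
rewrite line_point0 in alE; rewrite line_point1 in beE.
have rho t : line_point (ea s') (eb s') t =
    line_point (ea s) (eb s) ((1 - t) * al + t * be).
  by rewrite {1}alE {1}beE line_point_line_point.
have r1E : (1 - r) * al + r * be = r1.
  by apply: (line_point_inj (endpoints_neq s)); rewrite -rho rz r1z.
have [r' [r'r r'01 rho01]] : exists r', [/\ r' != r, 0 < r' < 1 &
    0 < (1 - r') * al + r' * be < 1].
  by rewrite -r1E in r101; exact: perturb_in_interval.
have [c [c' [cc' cs cs']]] := common_subsegment sz r01 (esym rz) r'r r'01
  (ex_intro2 _ _ ((1 - r') * al + r' * be) rho01 (esym (rho r'))).
have oc K0 : open (cell K0) /\ convex2 (cell K0).
  by split; [exact: cell_open|exact: cell_convex2].
apply: (three_cells cc' (oc K) (oc L) (oc L') (cell_disjoint KL) (cell_disjoint KL')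
  (cell_disjoint LL') (cell_neq0 K) (cell_neq0 L) (cell_neq0 L')).
- exact: subset_trans cs (separates_open_segment sKL).
- exact: subset_trans cs (separates_open_segment (separatesC sKL)).
- exact: subset_trans cs' (separates_open_segment (separatesC sKL')).
Qed.

Definition half (x y : R * R) : R * R := ((y.1 - x.1) / 2, (y.2 - x.2) / 2).

(* Contained in the triangle with apex [center K] and base [s], of half its area. *)
Definition edge_region K s : set (R * R) :=
  parallelogram (Defs.center K) (half (Defs.center K) (ea s)) (half (Defs.center K) (eb s)).

Lemma edge_region_cone K s z : edge_region K s z -> exists t y,
  [/\ 0 < t < 1, edge s y & z = line_point (Defs.center K) y t].
Proof.
move=> [[u v] [/= /andP[u0 u1] /andP[v0 v1]] <-].
have uv0 : u + v != 0 by lra.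
exists ((u + v) / 2), (line_point (ea s) (eb s) (v / (u + v))); split.
- by lra.
- exists (v / (u + v)) => //=.
  by rewrite divr_gt0 ?ltr_pdivrMr; lra.
- by rewrite /aff /line_point /half /=; congr pair; field.
Qed.

Lemma edge_region_sub K L s : separates s K L -> edge_region K s `<=` cell K.
Proof.
move=> sKL _ /edge_region_cone[t [y [t01 sy ->]]].
apply: (convex2_interior_segment (@cell_open _ _ M K) (@cell_convex2 _ _ M K) (center_in K)).
- exact: separates_open_segment sKL _ sy.
- by lra.
Qed.

(** A common point is on a ray from the centre to each edge. If one edge were hit first, that hit
    point would be interior to the cell; if both are hit together, the edges share a point. *)
Lemma edge_region_disjoint K L L' s s' : separates s K L -> separates s' K L' ->
  s != s' -> edge_region K s `&` edge_region K s' = set0.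
Proof.
move=> sKL sKL' ss'; apply/seteqP; split => // z [].
move=> /edge_region_cone[t [y [t01 sy zE]]] /edge_region_cone[t' [y' [t'01 sy' zE']]].
have ray r r' s1 s2 L1 L2 y1 y2 : 0 < r -> r < r' -> separates s1 K L1 ->
    separates s2 K L2 -> edge s1 y1 -> edge s2 y2 ->
    line_point (Defs.center K) y1 r = line_point (Defs.center K) y2 r' -> False.
  move=> r0 rr' s1K s2K sy1 sy2 E.
  have r'0 : r' != 0 by rewrite gt_eqF// (lt_trans r0).
  apply: (separates_disjoint s2K sy2).
  have -> : y2 = line_point (Defs.center K) y1 (r / r').
    have e1 := congr1 fst E; have e2 := congr1 snd E.
    rewrite /line_point /= in e1 e2 *; rewrite [LHS](surjective_pairing y2); congr pair.
    - rewrite -[LHS](mulKf r'0); have -> : r' * y2.1 = (1 - r) * (Defs.center K).1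
          + r * y1.1 - (1 - r') * (Defs.center K).1 by rewrite e1; ring.
      by field.
    - rewrite -[LHS](mulKf r'0); have -> : r' * y2.2 = (1 - r) * (Defs.center K).2
          + r * y1.2 - (1 - r') * (Defs.center K).2 by rewrite e2; ring.
      by field.
  apply: (convex2_interior_segment (@cell_open _ _ M K) (@cell_convex2 _ _ M K) (center_in K)).
    exact: separates_open_segment s1K _ sy1.
  by rewrite divr_ge0 ?ltr_pdivrMr ?mul1r ?(lt_trans r0)// ltW// (lt_trans r0).
have [t0 _] := andP t01; have [t'0 _] := andP t'01.
have [tt'|tt'|tt'] := ltgtP t t'.
- by apply: (ray t t' s s' L L' y y') => //; rewrite -zE.
- by apply: (ray t' t s' s L' L y' y) => //; rewrite -zE.
have yy' : y = y'.
  have tn0 : t != 0 by rewrite gt_eqF.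
  have E : line_point (Defs.center K) y t = line_point (Defs.center K) y' t by rewrite -zE zE' tt'.
  have /addrI /(mulfI tn0) e1 := congr1 fst E.
  have /addrI /(mulfI tn0) e2 := congr1 snd E.
  by rewrite (surjective_pairing y) (surjective_pairing y') e1 e2.
subst y'; move/eqP: ss'; apply.
exact: edges_of_cell_disjoint sKL sKL' sy sy'.
Qed.

Lemma cross_half (x : R * R) s :
  cross (half x (ea s)) (half x (eb s)) = side (ea s) (eb s) x / 4.
Proof. by rewrite /cross /half /side /=; field. Qed.

Lemma cross_half_neq0 K L s : separates s K L ->
  cross (half (Defs.center K) (ea s)) (half (Defs.center K) (eb s)) != 0.
Proof.
move=> sKL; rewrite cross_half mulf_neq0 ?invr_neq0//.
exact: separates_side_neq0 sKL (center_in K).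
Qed.

Lemma edge_region_area K L s : separates s K L ->
  ar (edge_region K s) = `|side (ea s) (eb s) (Defs.center K)| / 4.
Proof.
move=> sKL; have k0 := separates_side_neq0 sKL (center_in K).
have cE := cross_half (Defs.center K) s; have c0 := cross_half_neq0 sKL.
rewrite {1}/ar (@area_aff _ (Defs.center K) _ _ _ c0); last first.
  by apply: open_measurable2; exact: open_parallelogram.
rewrite (_ : _ @^-1` _ = @unit_square R); last first.
  by apply/seteqP; split => z /=; rewrite /edge_region parallelogramE//= affK.
rewrite arE; last exact: bounded_area_square.
rewrite /= (_ : ar (@unit_square R) = 1) ?mulr1.
  by rewrite cE normrM [`|4^-1|]ger0_norm.
rewrite unit_squareE area_setX ?mulr1//; try exact: measurable_itv.
by rewrite /len lebesgue_measure_itv /= lte_fin ltr01 -EFinD /= subr0 mulr1.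
Qed.

Lemma edge_length_gt0 s : 0 < edge_length s.
Proof.
rewrite /edge_length /Defs.edist sqrtr_gt0 /dot /= -!expr2.
by have := dist2_gt0 (endpoints_neq s); rewrite -(sqrrN ((eb s).1 - _)) -(sqrrN ((eb s).2 - _)) !opprB.
Qed.

Lemma edge_length_dist (x : R * R) s :
  edge_length s * dist_edge x s = `|side (ea s) (eb s) x|.
Proof.
have := dist2_gt0 (endpoints_neq s).
rewrite /edge_length /dist_edge /Defs.edist; move: (endpoints s) => [a b] /= D0.
rewrite -sqrtrM; last by rewrite /dot addr_ge0// -expr2 sqr_ge0.
rewrite -sqrtr_sqr; congr Num.sqrt; rewrite /line_proj /dot /line_point /side /=.
by field; rewrite -!expr2 gt_eqF.
Qed.

Lemma cell_bounded_area K : bounded_area (cell K).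
Proof.
apply: (bounded_areaW bO _ (@cell_sub _ _ M K)).
by apply: open_measurable2; exact: cell_open.
Qed.

(** Goes through [sides] rather than [cell_edges], so that every incident edge comes with a
    [separates]. *)
Definition incident s K := if sides s is Some (K1, K2) then (K == K1) || (K == K2) else false.

Lemma incident_separates s K : incident s K -> exists L, separates s K L.
Proof.
rewrite /incident; case E : (sides s) => [[K1 K2]|//] /orP[] /eqP ->.
- by exists K2; exact: sides_separates.
- by exists K1; apply: separatesC; exact: sides_separates.
Qed.

Lemma cell_edge_sum K :
  \sum_(s | incident s K) edge_length s * dist_edge (Defs.center K) s <= 4 * cell_area K.
Proof.
rewrite -ler_pdivrMl// mulr_sumr.
rewrite (_ : \sum_(s | _) _ = \sum_(s | incident s K) ar (edge_region K s)).
  apply: ar_bigcup; first exact: cell_bounded_area.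
  - move=> s /incident_separates[L sKL]; apply: open_measurable2; apply: open_parallelogram.
    exact: cross_half_neq0 sKL.
  - by move=> s /incident_separates[L]; exact: edge_region_sub.
  - move=> s s' /incident_separates[L sKL] /incident_separates[L' sKL'] ss'.
    exact: edge_region_disjoint sKL sKL' ss'.
apply: eq_bigr => s /incident_separates[L sKL].
by rewrite edge_length_dist (edge_region_area sKL) mulrC.
Qed.

Lemma separates_opposite s K L : separates s K L ->
  side (ea s) (eb s) (Defs.center K) * side (ea s) (eb s) (Defs.center L) < 0.
Proof.
move=> sKL; have [KL _ _ _] := sKL.
rewrite lt_neqAle mulf_neq0 /=; last 2 first.
- exact: separates_side_neq0 sKL (center_in K).
- exact: separates_side_neq0 (separatesC sKL) (center_in L).
rewrite leNgt; apply/negP => pos.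
have := same_side_meet (@cell_open _ _ M K) (@cell_convex2 _ _ M K)
  (@cell_open _ _ M L) (@cell_convex2 _ _ M L)
  (separates_open_segment sKL) (separates_open_segment (separatesC sKL))
  (center_in K) (center_in L) pos.
by rewrite cell_disjoint// => -[].
Qed.

Lemma edge_dist_sides s K L : sides s = Some (K, L) ->
  edge_dist s = Defs.edist (Defs.center K) (Defs.center L).
Proof. by rewrite /edge_dist => ->. Qed.

Lemma edge_dist_gt0 s K L : sides s = Some (K, L) -> 0 < edge_dist s.
Proof.
move=> E; rewrite (edge_dist_sides E); have sKL := sides_separates E.
have KL : Defs.center K != Defs.center L.
  apply/eqP => KL; have := separates_opposite sKL.
  by rewrite KL -expr2 ltNge sqr_ge0.
rewrite /Defs.edist sqrtr_gt0 /dot /= -!expr2.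
by have := dist2_gt0 KL; rewrite -sqrrN opprB -(sqrrN ((Defs.center L).2 - _)) opprB.
Qed.

(** The centres are on opposite sides, so the distance from one to the line is at most the normal
    component of their difference; the square left over at the end is the tangential component. *)
Lemma dist_edge_le s K L : separates s K L ->
  dist_edge (Defs.center K) s <= Defs.edist (Defs.center K) (Defs.center L).
Proof.
move=> sKL; rewrite -(ler_pM2l (edge_length_gt0 s)) edge_length_dist.
have opp := separates_opposite sKL.
set x := Defs.center K in opp *; set y := Defs.center L in opp *.
apply: (@le_trans _ _ `|side (ea s) (eb s) x - side (ea s) (eb s) y|).
  have [sx|sx] := ltP 0 (side (ea s) (eb s) x).
  - have sy : side (ea s) (eb s) y < 0 by rewrite -(pmulr_rlt0 _ sx).
    by rewrite !ger0_norm; lra.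
  - have sx' : side (ea s) (eb s) x < 0.
      by rewrite lt_neqAle sx andbT; apply: contraTneq opp => ->; rewrite mul0r ltxx.
    have sy : 0 < side (ea s) (eb s) y by rewrite -(nmulr_rlt0 _ sx').
    by rewrite !ler0_norm; lra.
rewrite /edge_length /Defs.edist -sqrtrM; last first.
  by rewrite /dot addr_ge0// -expr2 sqr_ge0.
rewrite -sqrtr_sqr ler_wsqrtr// /dot /side /= -subr_ge0.
set a := ea s; set b := eb s.
rewrite (_ : _ - _ = ((b.1 - a.1) * (x.1 - y.1) + (b.2 - a.2) * (x.2 - y.2)) ^+ 2); last by ring.
exact: sqr_ge0.
Qed.

(** Regularity replaces [edge_dist s] by the distance from either centre, each paired with its own
    weight; exchanging the sums then leaves [cell_edge_sum] for every cell. *)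
Lemma edge_sum (zeta : R) (w : cells M -> R) : 0 < zeta -> regular_mesh M zeta ->
  (forall K, 0 <= w K) ->
  \sum_s (if sides s is Some (K, L)
     then edge_length s * edge_dist s * (w K + w L) else 0)
    <= 4 / zeta * \sum_K cell_area K * w K.
Proof.
move=> z0 reg w0.
have key s K : s \in cell_edges K ->
    edge_length s * edge_dist s <= zeta^-1 * (edge_length s * dist_edge (Defs.center K) s).
  move=> sK; rewrite mulrCA ler_pM2l ?edge_length_gt0//.
  by rewrite mulrC ler_pdivlMr// mulrC reg.
apply: (@le_trans _ _ (zeta^-1 * \sum_s \sum_(K | incident s K)
    edge_length s * dist_edge (Defs.center K) s * w K)).
  rewrite mulr_sumr; apply: ler_sum => s _; rewrite /incident.
  case E : (sides s) => [[K L]|]; last by rewrite big_pred0// mulr0.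
  have [KL sK sL _] := sides_separates E.
  rewrite (bigD1 K) ?eqxx//= (bigD1 L) /=; last by rewrite eqxx orbT eq_sym.
  rewrite big1 ?addr0; last first.
    by move=> K' /andP[/andP[/orP[]/eqP -> h1] h2]; rewrite eqxx in h1 h2.
  rewrite mulrDr [leRHS]mulrDr; apply: lerD.
  - by rewrite mulrA ler_wpM2r// key.
  - by rewrite mulrA ler_wpM2r// key.
rewrite (exchange_big_dep xpredT) //= [4 / _]mulrC -mulrA ler_pM2l ?invr_gt0//.
rewrite mulr_sumr; apply: ler_sum => K _.
rewrite -mulr_suml mulrA ler_wpM2r//; exact: cell_edge_sum.
Qed.

Lemma regular_zeta_le1 (zeta : R) s K L : regular_mesh M zeta ->
  sides s = Some (K, L) -> zeta <= 1.
Proof.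
move=> reg E; have sKL := sides_separates E; have [_ sK _ _] := sKL.
have d0 := edge_dist_gt0 E.
rewrite -(ler_pM2r d0) mul1r; apply: (le_trans (reg _ _ sK)).
by rewrite (edge_dist_sides E); exact: dist_edge_le.
Qed.

End edge_triangles.

(** * The inequalities on the mesh *)

Lemma bounded_set_box (R : realType) (Omega : set (R * R)) :
  bounded_set (Omega : set (R^o * R^o)) ->
  exists B : R, forall z, Omega z -> `|z.1| < B /\ `|z.2| < B.
Proof.
move=> [B [_ HB]]; exists (B + 2) => z Oz.
have := HB (B + 1) _ z Oz; rewrite ltrDl ltr01 => /(_ isT) /=.
rewrite prod_normE /= ge_max => /andP[z1 z2].
by split; [apply: (le_lt_trans z1)|apply: (le_lt_trans z2)]; lra.
Qed.

Section mesh_inequalities.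
Variables (R : realType) (Omega : set (R * R)) (C : R).
Hypotheses (bO : bounded_area Omega) (C0 : 0 <= C)
  (iso : forall (M : mesh Omega) (P : pred (cells M)),
    Num.min (\sum_(K | P K) cell_area K) (\sum_(K | ~~ P K) cell_area K)
      <= C * perimeter P ^+ 2).
Variables (M : mesh Omega) (zeta : R) (mu : cells M -> R).
Hypotheses (z0 : 0 < zeta) (reg : regular_mesh M zeta) (mu0 : forall K, 0 <= mu K)
  (mu1 : \sum_K cell_area K * mu K = 1).

Local Notation mu_inf := (sup (range mu)).
Local Notation A := (ar Omega).
Local Notation E := (@dirichlet_energy R Omega M).

Let area0 (K : cells M) : 0 <= cell_area K.
Proof. exact: ar_ge0. Qed.

Let w0 (K : cells M) : 0 <= cell_area K * mu K.
Proof. exact: mulr_ge0. Qed.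

Lemma mu_le_sup K : mu K <= mu_inf.
Proof.
apply: ub_le_sup; last by exists K.
exists (\sum_L mu L) => _ [L _ <-].
by rewrite (bigD1 L) //= lerDl sumr_ge0.
Qed.

Lemma sum_cell_area_le : \sum_(K : cells M) cell_area K <= A.
Proof.
apply: ar_bigcup => //.
- by move=> K _; apply: open_measurable2; exact: cell_open.
- by move=> K _; exact: cell_sub.
- by move=> K L _ _; exact: cell_disjoint.
Qed.

Lemma exists_cell : exists K : cells M, True.
Proof.
apply: contrapT => no; have : \sum_(K : cells M) cell_area K * mu K = 0.
  by apply: big1 => K _; exfalso; apply: no; exists K.
by rewrite mu1 => /eqP; rewrite oner_eq0.
Qed.

Lemma mu_inf_ge0 : 0 <= mu_inf.
Proof. by have [K _] := exists_cell; exact: le_trans (mu_le_sup K). Qed.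

Lemma mu_sum_le (g : cells M -> R) : (forall K, 0 <= g K) ->
  \sum_K cell_area K * mu K * g K <= mu_inf * \sum_K cell_area K * g K.
Proof.
move=> g0; rewrite mulr_sumr; apply: ler_sum => K _.
by rewrite mulrAC mulrC ler_wpM2r ?mulr_ge0// mu_le_sup.
Qed.

(** The median is the one for the area alone, without the density [mu]. *)
Lemma exists_centering (f : cells M -> R) : exists c,
  centered (fun K : cells M => cell_area K) (fun K => f K - c).
Proof.
have [K _] := exists_cell.
have [|c [c1 c2]] := @median R (cells M) (fun K => cell_area K) f area0.
  by apply/card_gt0P; exists K.
exists c; split.
- under eq_bigl do rewrite subr_gt0; under [leRHS]eq_bigl do rewrite subr_gt0.
  exact: c2.
- under eq_bigl do rewrite subr_lt0; under [leRHS]eq_bigl do rewrite subr_lt0.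
  exact: c1.
Qed.

Lemma energy_shift (f : cells M -> R) c :
  energy (@edge_length R Omega M) (@edge_dist R Omega M) (@sides R Omega M)
    (fun K => f K - c) = E f.
Proof.
apply: eq_bigr => s _; case: (sides s) => [[K L]|//].
by congr (_ * `|_| ^+ 2); ring.
Qed.

Lemma dirichlet_energy_ge0 f : 0 <= E f.
Proof.
rewrite -(energy_shift f 0); apply: energy_ge0 => [s|s K L].
  exact: edge_length_ge0.
exact: edge_dist_gt0.
Qed.

Lemma mesh_poincare (f : cells M -> R) :
  \sum_K cell_area K * mu K * (f K - \sum_L cell_area L * mu L * f L) ^+ 2
    <= (2 * C * A + 1) / zeta * mu_inf * E f.
Proof.
have [c hc] := exists_centering f.
have D0 : 0 <= 4 / zeta by rewrite divr_ge0// ltW.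
apply: (le_trans (variance_le mu1 f c)).
apply: (le_trans (mu_sum_le (fun K => sqr_ge0 (f K - c)))).
have := @poincare R _ _ (fun K : cells M => cell_area K) (@edge_length R Omega M)
  (@edge_dist R Omega M) (@sides R Omega M) C area0 (@edge_length_ge0 R Omega M) C0 (iso (M := M))
  (4 / zeta) (@edge_dist_gt0 R Omega M) (fun w => edge_sum bO z0 reg (w := w)) _ hc.
rewrite energy_shift => H.
(* [2 * C * A / zeta] is the constant of [poincare] with [D = 4 / zeta]. *)
apply: (@le_trans _ _ (mu_inf * (2 * C * A / zeta * E f))).
  apply: ler_wpM2l; first exact: mu_inf_ge0.
  apply: (le_trans H); apply: ler_wpM2r; first exact: dirichlet_energy_ge0.
  rewrite (_ : C * _ * _ / 2 = 2 * C / zeta * \sum_(K : cells M) cell_area K); last first.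
    by field; rewrite gt_eqF.
  rewrite [leRHS]mulrAC; apply: ler_wpM2l; last exact: sum_cell_area_le.
  by rewrite divr_ge0 ?mulr_ge0// ltW.
have h1 : 0 <= mu_inf * (E f / zeta).
  by rewrite mulr_ge0 ?mu_inf_ge0// divr_ge0 ?dirichlet_energy_ge0// ltW.
rewrite -subr_ge0 (_ : _ - _ = mu_inf * (E f / zeta))//.
by field; rewrite gt_eqF.
Qed.

Lemma energy_zeta (f : cells M -> R) : E f / zeta <= E f / zeta ^+ 2.
Proof.
have [[s sE]|no] := pselect (exists s : edges M, sides s).
  case E1 : (sides s) => [[K L]|]; last by rewrite E1 in sE.
  have z1 := regular_zeta_le1 reg E1.
  rewrite ler_wpM2l ?dirichlet_energy_ge0// lef_pV2 ?posrE ?exprn_gt0//.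
  by rewrite expr2 ger_pMr.
have -> : E f = 0.
  apply: big1 => s _; case E1 : (sides s) => [[K L]|//].
  by exfalso; apply: no; exists s; rewrite E1.
by rewrite !mul0r.
Qed.

(** [entropy_le] at the area median, then the square root of [sobolev4]: 128 is 32 times the 4 of
    [D = 4 / zeta], and the roots of [A] and [mu_inf] come out. *)
Lemma mesh_log_sobolev (f : cells M -> R) : (forall K, 0 < f K) ->
  \sum_K cell_area K * mu K * (f K ^+ 2 * ln (f K ^+ 2 /
      \sum_L cell_area L * mu L * f L ^+ 2))
    <= (128 * Num.sqrt A * C + 1) / zeta ^+ 2 * Num.sqrt mu_inf * E f.
Proof.
move=> f0; have [c hc] := exists_centering f.
have D0 : 0 <= 4 / zeta by rewrite divr_ge0// ltW.
have E0 := dirichlet_energy_ge0 f.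
apply: (le_trans (entropy_le (w := fun K => cell_area K * mu K) w0 mu1 c f0)).
have pow4 (x : R) : 0 <= x ^+ 4 by rewrite (exprM x 2 2) sqr_ge0.
have H4 := mu_sum_le (fun K => pow4 (f K - c)).
have := @sobolev4 R _ _ (fun K : cells M => cell_area K) (@edge_length R Omega M)
  (@edge_dist R Omega M) (@sides R Omega M) C area0 (@edge_length_ge0 R Omega M) C0 (iso (M := M))
  (4 / zeta) (@edge_dist_gt0 R Omega M) (fun w => edge_sum bO z0 reg (w := w)) _ D0 hc.
rewrite energy_shift => H.
have CE0 : 0 <= C * (4 / zeta) * E f by rewrite mulr_ge0// mulr_ge0.
have : \sum_K cell_area K * mu K * (f K - c) ^+ 4 <=
    mu_inf * (A * (C * (4 / zeta) * E f) ^+ 2).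
  apply: (le_trans H4); apply: ler_wpM2l; first exact: mu_inf_ge0.
  apply: (le_trans H); apply: ler_wpM2r; first exact: sqr_ge0.
  exact: sum_cell_area_le.
move=> /ler_wsqrtr; rewrite sqrtrM ?mu_inf_ge0// sqrtrM ?ar_ge0//.
rewrite sqrtr_sqr ger0_norm// => HS.
apply: (@le_trans _ _ (32 * (Num.sqrt mu_inf * (Num.sqrt A * (C * (4 / zeta) * E f))))).
  exact: ler_wpM2l.
set k := 128 * Num.sqrt A * C.
have k0 : 0 <= k by rewrite !mulr_ge0 ?sqrtr_ge0.
apply: (@le_trans _ _ (k * Num.sqrt mu_inf * (E f / zeta))).
  by rewrite le_eqVlt; apply/orP; left; apply/eqP; rewrite /k; field; rewrite gt_eqF.
apply: (@le_trans _ _ (k * Num.sqrt mu_inf * (E f / zeta ^+ 2))).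
  by apply: ler_wpM2l; [rewrite mulr_ge0 ?sqrtr_ge0|exact: energy_zeta].
rewrite -subr_ge0 (_ : _ - _ = Num.sqrt mu_inf * (E f / zeta ^+ 2)); last first.
  by field; rewrite gt_eqF.
by rewrite mulr_ge0 ?sqrtr_ge0// divr_ge0// sqr_ge0.
Qed.

End mesh_inequalities.

Theorem theorem5p1 (R : realType) (Omega : set (R * R))
    (Omega_open : open Omega)
    (Omega_connected : connected Omega)
    (Omega_bounded : bounded_set (Omega : set (R^o * R^o)))
    (Omega_polygonal : polygonal Omega) :
  exists C_PW C_B C_LS : R,
    [/\ 0 < C_PW, 0 < C_B, 0 < C_LS, C_B = C_PW &
    forall (M : mesh Omega) (zeta : R) (mu : cells M -> R),
      0 < zeta ->
      regular_mesh M zeta ->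
      (forall K, 0 <= mu K) ->
      \sum_K cell_area K * mu K = 1 ->
      let mu_inf := sup (range mu) in
      [/\ forall f : cells M -> R,
            \sum_K cell_area K
                * `|f K - \sum_L cell_area L * f L * mu L| ^+ 2 * mu K
            <= C_PW / zeta * mu_inf * dirichlet_energy f,
          forall (p : R) (f : cells M -> R),
            1 < p <= 2 ->
            (forall K, 0 <= f K) ->
            \sum_K cell_area K * f K ^+ 2 * mu K
              - (\sum_K cell_area K * (f K) `^ (2 / p) * mu K) `^ p
            <= C_B / zeta * mu_inf * dirichlet_energy f &
          forall f : cells M -> R,
            (forall K, 0 < f K) ->
            \sum_K cell_area K * f K ^+ 2
                * ln (f K ^+ 2 / \sum_L cell_area L * f L ^+ 2 * mu L) * mu K
            <= C_LS / zeta ^+ 2 * Num.sqrt mu_inf * dirichlet_energy f]].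
Proof.
have [B OB] := bounded_set_box Omega_bounded.
have bO : bounded_area Omega.
  apply: (@bounded_area_box _ B); first exact: open_measurable2.
  by move=> z /OB[z1 z2]; rewrite !ltW.
have [neO|eO] := pselect (Omega !=set0); last first.
  (* Total mass 1 forces a cell to exist, and its centre would lie in the empty [Omega]; any
     constants do. *)
  exists 1, 1, 1; split; rewrite ?ltr01// => M zeta mu _ _ _ mu1; exfalso.
  have [K _] := exists_cell mu1.
  by apply: eO; exists (Defs.center K); apply: cell_sub; exact: center_in.
have [C C0 iso] := cells_isoperimetric Omega_open bO Omega_connected neO
  Omega_polygonal OB.
have A0 := ar_ge0 Omega.
exists (2 * C * ar Omega + 1), (2 * C * ar Omega + 1),
  (128 * Num.sqrt (ar Omega) * C + 1).
have PW0 : 0 < 2 * C * ar Omega + 1 by rewrite ltr_wpDl// !mulr_ge0.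
have LS0 : 0 < 128 * Num.sqrt (ar Omega) * C + 1.
  by rewrite ltr_wpDl// !mulr_ge0 ?sqrtr_ge0.
split; [exact: PW0|exact: PW0|exact: LS0|reflexivity|].
move=> M zeta mu z0 reg mu0 mu1 mu_inf.
have w0 (K : cells M) : 0 <= cell_area K * mu K by exact: mulr_ge0 (ar_ge0 _) (mu0 K).
have muC (g : cells M -> R) : \sum_K cell_area K * g K * mu K =
    \sum_K cell_area K * mu K * g K by apply: eq_bigr => K _; exact: mulrAC.
have PW := mesh_poincare bO C0 iso z0 reg mu0 mu1.
split => [f|p f p12 f0|f f0].
- rewrite !muC; apply: le_trans (PW f).
  by apply: ler_sum => K _; rewrite real_normK ?num_real.
- by rewrite !muC; apply: le_trans (PW f); exact: (beckner w0 mu1).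
- rewrite muC; apply: le_trans (mesh_log_sobolev bO C0 iso z0 reg mu0 mu1 f0).
  by apply: ler_sum => K _; rewrite le_eqVlt; apply/orP; left; apply/eqP; ring.
Qed.
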